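(* Let $0<\rho\le1$, $-1<\mu,\upsilon\le-\frac12$, and let $s\ge1$ and $N\ge1$ be integers with $s\le N+1$. If $f\bigl(1-(1-t)^{1/\rho}\bigr)\in B_{\mu,\upsilon}^{s,1}(J)$, then $$\|f-J_{N,\rho}^{\mu,\upsilon}f\|_\infty\le cN^{1/2-s}\,\bigl\|\partial_t^s\{f(1-(1-t)^{1/\rho})\}\bigr\|_{0,\varkappa^{\mu+s,\upsilon+s,1}},$$ where, for fixed $s$, $c$ is a constant independent of $N$ and $f$.
   Context: $J=[0,1]$ and $\|\cdot\|_\infty$ is the supremum norm on $J$. $\varkappa^{a,b,1}(t)=(1-t)^at^b$; for a weight $\varkappa$, $\|f\|_{0,\varkappa}=(\int_0^1f^2\varkappa\,dt)^{1/2}$ and $L^2_\varkappa(J)$ is the associated space. $B_{\mu,\upsilon}^{s,1}(J)=\{f:\ \partial_t^kf\in L^2_{\varkappa^{\mu+k,\upsilon+k,1}}(J),\ 0\le k\le s\}$ (weak derivatives; elements are identified with their continuous representatives). With $\mathcal{P}_r^{\mu,\upsilon}$ the classical Jacobi polynomial of degree $r$ on $[-1,1]$ (weight $(1-x)^\mu(1+x)^\upsilon$), set $\mathcal{P}_r^{\mu,\upsilon,\rho}(t)=\mathcal{P}_r^{\mu,\upsilon}(1-2(1-t)^\rho)$. The nodes $\{t_i\}_{i=0}^N\subset(0,1)$ are the zeros of $\mathcal{P}_{N+1}^{\mu,\upsilon,\rho}$, and $$h_{j,\rho}^{\mu,\upsilon}(t)=\prod_{i=0,\,i\ne j}^N\frac{(1-t)^\rho-(1-t_i)^\rho}{(1-t_j)^\rho-(1-t_i)^\rho},\qquad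 J_{N,\rho}^{\mu,\upsilon}f(t)=\sum_{j=0}^Nf(t_j)\,h_{j,\rho}^{\mu,\upsilon}(t).$$ The notation $\partial_t^s\{f(1-(1-t)^{1/\rho})\}$ means the $s$-th derivative of the composed function $t\mapsto f(1-(1-t)^{1/\rho})$. *)

(* Defs.v *)
From HB Require Import structures.
From mathcomp Require Import all_boot all_order all_algebra.
From mathcomp Require Import all_classical all_reals all_analysis.

Set Implicit Arguments.
Unset Strict Implicit.
Unset Printing Implicit Defensive.

Import Order.TTheory GRing.Theory Num.Theory.
Import numFieldNormedType.Exports.

Local Open Scope classical_set_scope.
Local Open Scope ring_scope.

Definition gbinomial (R : realType) (x : R) (k : nat) : R :=
  (\prod_(i < k) (x - i%:R)) / k`!%:R.

(* P_n^{(a,b)} for the weight (1-x)^a (1+x)^b, normalised by P_n(1) = C(n+a, n):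
   the sum obtained from Rodrigues' formula by the Leibniz rule. *)
Definition jacobi (R : realType) (a b : R) (n : nat) : {poly R} :=
  \sum_(k < n.+1)
    (gbinomial (n%:R + a) (n - k) * gbinomial (n%:R + b) k) *:
      ((2^-1 *: ('X - 1)) ^+ k * (2^-1 *: ('X + 1)) ^+ (n - k)).

Definition gjacobi (R : realType) (mu ups rho : R) (n : nat) (t : R) : R :=
  (jacobi mu ups n).[1 - 2 * (1 - t) `^ rho].

Definition gjacobi_nodes (R : realType) (mu ups rho : R) (N : nat)
    (t : 'I_N.+1 -> R) : Prop :=
  injective t /\
  range t = [set x : R | 0 < x < 1 /\ gjacobi mu ups rho N.+1 x = 0].

Definition lagrange_basis (R : realType) (rho : R) (N : nat)
    (t : 'I_N.+1 -> R) (j : 'I_N.+1) (x : R) : R :=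
  \prod_(i < N.+1 | i != j)
    (((1 - x) `^ rho - (1 - t i) `^ rho) /
     ((1 - t j) `^ rho - (1 - t i) `^ rho)).

Definition interpolant (R : realType) (rho : R) (N : nat)
    (t : 'I_N.+1 -> R) (f : R -> R) (x : R) : R :=
  \sum_(j < N.+1) f (t j) * lagrange_basis rho t j x.

Definition pullback (R : realType) (rho : R) (f : R -> R) (t : R) : R :=
  f (1 - (1 - t) `^ rho^-1).

Definition weight (R : realType) (a b t : R) : R := (1 - t) `^ a * t `^ b.

(* Extended-real valued, so that an infinite norm is +oo. *)
Definition wL2norm (R : realType) (a b : R) (f : R -> R) : \bar R :=
  ((\int[lebesgue_measure]_(t in `]0%R, 1%R[) ((f t) ^+ 2 * weight a b t)%:E)
     `^ 2^-1)%E.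

Definition wL2 (R : realType) (a b : R) (f : R -> R) : Prop :=
  measurable_fun (`]0, 1[ : set R) f /\ (wL2norm a b f < +oo)%E.

Definition supnorm (R : realType) (f : R -> R) : \bar R :=
  ereal_sup [set `|f t|%:E | t in `[0, 1]].

Definition test_function (R : realType) (phi : R -> R) : Prop :=
  (forall (n : nat) (x : R), derivable (derive1n n phi) x 1) /\
  exists K : set R,
    [/\ compact K, K `<=` `]0, 1[ & forall x, ~ K x -> phi x = 0].

Definition is_weak_derivative (R : realType) (k : nat) (g v : R -> R) : Prop :=
  [/\ locally_integrable `]0, 1[ g,
      locally_integrable `]0, 1[ v &
      forall phi : R -> R, test_function phi ->
        \int[lebesgue_measure]_(x in `]0, 1[) (g x * derive1n k phi x) =
        (-1) ^+ k * \int[lebesgue_measure]_(x in `]0, 1[) (v x * phi x)].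

Definition in_B (R : realType) (mu ups : R) (s : nat) (g : R -> R) : Prop :=
  forall k : nat, (k <= s)%N ->
    exists2 v : R -> R,
      is_weak_derivative k g v & wL2 (mu + k%:R) (ups + k%:R) v.

(* Main.v *)
Require Import Defs.
From HB Require Import structures.
From mathcomp Require Import all_boot all_order all_algebra.
From mathcomp Require Import all_classical all_reals all_analysis.
From mathcomp Require Import measurable_realfun ring lra zify.

(* The substitution y = 1 - (1 - t)^rho turns the generalized Lagrange functions
   into ordinary ones at the zeros of a shifted Jacobi polynomial, so it is
   enough to treat g = pullback rho f and polynomial interpolation on [0, 1].

   Write g as the limit of its Jacobi partial sums S_n.  Testing the weak
   derivative against q w_{a+s,b+s} times smooth cutoffs gives Bessel's
   inequality for the s-th derivatives, ||S_n^(s)|| <= ||v||, and since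
   J_k^(s) has squared norm of order k^(2s) ||J_k||^2, every tail
   E = S_n - S_{N+1} satisfies
     N ||E||_{a,b}^2 + N^-1 ||E'||_{a+1,b+1}^2 <= C N^(1-2s) ||v||^2.
   For a, b <= -1/2 the left-hand side bounds the square of the sup norm of E,
   because w_{a+1/2,b+1/2} >= 1.  It also bounds the square of the
   interpolation error of E: for the interpolant of E the first term is its
   Gauss quadrature sum, and the second is controlled by Markov's inequality.
   The Gauss sum of E^2 is compared with the integral cell by cell, on the
   cells between consecutive extrema of a Chebyshev polynomial: a Gauss weight
   is bounded by the integral of any squared polynomial of degree <= N that is
   large near the node, and T_m(t)/(t - y) for a zero y of T_m is localized
   enough for this.  Finally, S_{N+1} is reproduced by interpolation, and
   S_n -> g uniformly, as g - S_n is continuous and orthogonal to the powers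
   of bump polynomials. *)

Set Implicit Arguments.
Unset Strict Implicit.
Unset Printing Implicit Defensive.

Import Order.TTheory GRing.Theory Num.Theory.
Import numFieldNormedType.Exports.

Local Open Scope classical_set_scope.
Local Open Scope ring_scope.

(** * Shifted Jacobi polynomials *)

(** The combination N ||E||^2 + N^-1 ||E'||^2 is balanced at frequency N: a value of E^2 is at most
    its mean plus its variation, the variation is split by the arithmetic-geometric inequality with
    parameter N, and Markov's inequality ||p'|| <= N ||p|| in degree N leads from the second term
    back to the first. One bound on the tail therefore controls both its sup norm and its
    interpolation error, and no Lebesgue constant of the nodes enters the rate.

    The Gauss sum is the delicate term, because neither the position nor the spacing of the Jacobi
    zeros is controlled. All nodes in one Chebyshev cell are treated together: a peak L with 16 L^2
    >= 1 on the cell bounds the sum of their weights by 16 times the full Gauss sum of L^2, which is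
    exactly the integral of L^2. The Chebyshev cells serve only as a partition with explicit
    trigonometric geometry, on which the weight is at least 1/81 of its value at the zero. *)

Section JacobiAlgebra.
Variable R : realType.
Implicit Types (a b : R) (q : {poly R}) (n k : nat).

(** With x = 2t - 1 the factors (x - 1)/2 and (x + 1)/2 of [jacobi] become t - 1 and t. *)
Definition shifted_jacobi a b n : {poly R} :=
  \sum_(k < n.+1) (gbinomial (n%:R + a) (n - k) * gbinomial (n%:R + b) k) *:
    (('X - 1) ^+ k * 'X ^+ (n - k)).

Lemma shifted_jacobiE a b n (t : R) :
  (jacobi a b n).[1 - 2 * (1 - t)] = (shifted_jacobi a b n).[t].
Proof.
rewrite /jacobi /shifted_jacobi !horner_sum; apply: eq_bigr => k _.
rewrite !(hornerZ, hornerM, horner_exp, hornerD, hornerN, hornerX, hornerC).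
by congr (_ * (_ ^+ _ * _ ^+ _)); field.
Qed.

Lemma gbinomialS (x : R) k :
  gbinomial x k.+1 * k.+1%:R = gbinomial x k * (x - k%:R).
Proof.
rewrite /gbinomial big_ord_recr/= factS natrM.
have : k`!%:R != 0 :> R by rewrite pnatr_eq0 -lt0n fact_gt0.
have : k.+1%:R != 0 :> R by rewrite pnatr_eq0.
by move=> ? ?; field; rewrite addrC natr1; apply/andP.
Qed.

(** The terms k and k + 1 of the differentiated sum meet in the same product of powers. By
    [gbinomialS] they carry the factors 1 + a + k and n + 1 + b - k, whose sum does not depend on
    k. *)
Lemma deriv_shifted_jacobi a b n : (shifted_jacobi a b n.+1)^`() =
  (n.+1%:R + a + b + 1) *: shifted_jacobi (a + 1) (b + 1) n.
Proof.
pose G k : R := gbinomial (n.+1%:R + a) (n.+1 - k) * gbinomial (n.+1%:R + b) k.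
have E k : ((('X - 1) ^+ k * 'X ^+ (n.+1 - k)) : {poly R})^`() =
    k%:R *: (('X - 1) ^+ k.-1 * 'X ^+ (n.+1 - k)) +
    (n.+1 - k)%:R *: (('X - 1) ^+ k * 'X ^+ (n - k)).
  rewrite derivM !derivXn -polyC1 deriv_exp derivXsubC mul1r.
  by rewrite subSKn !scaler_nat mulrnAl mulrnAr.
rewrite /shifted_jacobi linear_sum /=.
under eq_bigr => k _ do rewrite derivZ E scalerDr !scalerA.
rewrite big_split/= big_ord_recl/= mulr0 scale0r add0r.
rewrite [X in _ + X]big_ord_recr/= subnn mulr0 scale0r addr0 -big_split/=.
rewrite scaler_sumr; apply: eq_bigr => k _.
rewrite /bump/= add1n subSS -scalerDl scalerA; congr (_ *: _).
have kn : (k <= n)%N by rewrite -ltnS.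
have := gbinomialS (n.+1%:R + b) k.
have := gbinomialS (n.+1%:R + a) (n - k).
rewrite subSn// natrB// -!natr1 => e1 e2.
rewrite (_ : n%:R + (a + 1) = n%:R + 1 + a); last by ring.
rewrite (_ : n%:R + (b + 1) = n%:R + 1 + b); last by ring.
rewrite -mulrA e2.
by rewrite [X in _ + X]mulrAC e1; ring.
Qed.

(* [(q w)' = Dw a b q * w / (t (1 - t))] for the weight [w = (1 - t)^a t^b]. *)
Definition Dw a b q : {poly R} :=
  'X * (1 - 'X) * q^`() + (b *: (1 - 'X) - a *: 'X) * q.

(** One step of Rodrigues' formula. Paired with [deriv_shifted_jacobi], it is the source of the
    differential equation, of orthogonality and of the recurrence for the norms. *)
Lemma Dw_shifted_jacobi a b n :
  Dw (a + 1) (b + 1) (shifted_jacobi (a + 1) (b + 1) n) =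
  - n.+1%:R *: shifted_jacobi a b n.+1.
Proof.
have DwE k : (k <= n)%N ->
   Dw (a + 1) (b + 1) (('X - 1) ^+ k * 'X ^+ (n - k)) =
   - (a + 1 + k%:R) *: (('X - 1) ^+ k * 'X ^+ (n.+1 - k)) -
   (b + 1 + n%:R - k%:R) *: (('X - 1) ^+ k.+1 * 'X ^+ (n.+1 - k.+1)).
  move=> kn; rewrite -(addrA _ n%:R) -natrB// subSS subSn//.
  move: (n - k)%N => j; rewrite /Dw derivM derivXn -polyC1 deriv_exp derivXsubC.
  rewrite mul1r -(scaler_nat j) -(scaler_nat k).
  rewrite -!mul_polyC !(polyCD, polyCB, polyCN) !exprS.
  by case: k kn => [|k] _; case: j => [|j] /=; rewrite ?exprS ?expr0 ?polyC0; ring.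
rewrite /shifted_jacobi.
have DwD (I : finType) (c : I -> R) (F : I -> {poly R}) :
    Dw (a + 1) (b + 1) (\sum_i c i *: F i) = \sum_i c i *: Dw (a+1) (b+1) (F i).
  rewrite /Dw linear_sum !mulr_sumr -big_split/=; apply: eq_bigr => i _.
  by rewrite derivZ -!mul_polyC; ring.
rewrite DwD.
under eq_bigr => k _.
  rewrite DwE; last by rewrite -ltnS.
  rewrite scalerBr !scalerA; over.
rewrite sumrB scaler_sumr.
pose G k : R := gbinomial (n.+1%:R + a) (n.+1 - k) * gbinomial (n.+1%:R + b) k.
pose B k : {poly R} := ('X - 1) ^+ k * 'X^(n.+1 - k).
(* The factor n + 1 is split as (n + 1 - k) + k to match the two families of terms on the left; the
   last summand of the first sum and the first summand of the second vanish. *)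
have -> : \sum_(k < n.+2) - n.+1%:R *: (G k *: B k) =
   \sum_(k < n.+2) (- (n.+1%:R - k%:R) * G k) *: B k -
   \sum_(k < n.+2) (k%:R * G k) *: B k.
  rewrite -sumrB; apply: eq_bigr => k _; rewrite scalerA -scalerBl.
  by congr (_ *: _); ring.
rewrite [in RHS]big_ord_recr/= subrr oppr0 mul0r scale0r addr0.
rewrite [X in _ = _ - X]big_ord_recl/= mul0r scale0r add0r.
congr (_ - _); apply: eq_bigr => k _; have kn : (k <= n)%N by rewrite -ltnS.
- congr (_ *: _); rewrite /G.
  have := gbinomialS (n.+1%:R + a) (n - k).
  rewrite subSn// -!natr1 natrB// => e1.
  rewrite (_ : n%:R + (a + 1) = n%:R + 1 + a); last by ring.
  rewrite (_ : n%:R + (b + 1) = n%:R + 1 + b); last by ring.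
  have -> : n%:R + 1 - k%:R = n%:R - k%:R + 1 :> R by ring.
  rewrite [RHS](_ : _ = - (gbinomial (n%:R + 1 + a) (n - k).+1 *
    (n%:R - k%:R + 1)) * gbinomial (n%:R + 1 + b) k); last by ring.
  by rewrite e1; ring.
- rewrite /bump/= add1n /B; congr (_ *: _); rewrite /G subSS.
  have := gbinomialS (n.+1%:R + b) k.
  rewrite -!natr1 => e2.
  rewrite (_ : n%:R + (a + 1) = n%:R + 1 + a); last by ring.
  rewrite (_ : n%:R + (b + 1) = n%:R + 1 + b); last by ring.
  rewrite [RHS](_ : _ = gbinomial (n%:R + 1 + a) (n - k) *
    (gbinomial (n%:R + 1 + b) k.+1 * (k%:R + 1))); last by ring.
  by rewrite e2; ring.
Qed.

Lemma DwD a b p q : Dw a b (p + q) = Dw a b p + Dw a b q.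
Proof. by rewrite /Dw derivD; ring. Qed.

Lemma DwZ a b (c : R) q : Dw a b (c *: q) = c *: Dw a b q.
Proof. by rewrite /Dw derivZ -!mul_polyC; ring. Qed.

(* The Jacobi differential equation. *)
Lemma Dw_deriv_shifted_jacobi a b n :
  Dw (a + 1) (b + 1) (shifted_jacobi a b n)^`() =
  - (n%:R * (n%:R + a + b + 1)) *: shifted_jacobi a b n.
Proof.
case: n => [|n].
  rewrite mul0r oppr0 scale0r /shifted_jacobi big_ord1 /= subn0 expr0 mulr1.
  by rewrite derivZ -polyC1 derivC scaler0 /Dw derivC !mulr0 addr0.
by rewrite deriv_shifted_jacobi DwZ Dw_shifted_jacobi scalerA; congr (_ *: _); ring.
Qed.

Lemma shifted_jacobi0 a b : shifted_jacobi a b 0 = 1.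
Proof.
rewrite /shifted_jacobi big_ord1/= subn0 !expr0 mulr1.
by rewrite /gbinomial !big_ord0 fact0 !divr1 mulr1 scale1r.
Qed.

Lemma size_deriv_realType q : size q^`() = (size q).-1.
Proof.
have [->|q0] := eqVneq q 0; first by rewrite deriv0 size_poly0.
apply/eqP; rewrite eqn_leq; have := lt_size_deriv q0.
have : (0 < size q)%N by rewrite size_poly_gt0.
case E : (size q) => [//|m] _; rewrite ltnS => -> /=.
rewrite leqNgt; apply/negP => qm; case: m => [//|m] in E qm *.
have : q^`()`_m = 0 by apply: nth_default; rewrite -ltnS.
rewrite coef_deriv => /eqP; rewrite mulrn_eq0/= => /eqP lq.
by move: q0; rewrite -lead_coef_eq0 lead_coefE E/= lq eqxx.
Qed.

(** Induction through the derivative: for a, b > -1 its factor n + a + b + 2 is positive, so no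
    degree is lost. *)
Lemma size_shifted_jacobi a b n : -1 < a -> -1 < b ->
  size (shifted_jacobi a b n) = n.+1.
Proof.
elim: n a b => [|n IH] a b a1 b1; first by rewrite shifted_jacobi0 size_poly1.
have := deriv_shifted_jacobi a b n.
have c0 : n.+1%:R + a + b + 1 != 0.
  by rewrite gt_eqF// -natr1; have : 0 <= n%:R :> R by []; lra.
move/(congr1 (fun p : {poly R} => size p)).
rewrite size_scale// IH; [|lra|lra].
by rewrite size_deriv_realType; case: (size _) => [//|m /= ->].
Qed.

(* The [s]-fold version of [Dw]: [(q w_{a+s,b+s})^(s) = Dwn s a b q * w_{a,b}]. *)
Fixpoint Dwn s a b q : {poly R} :=
  if s is s'.+1 then Dw (a + 1) (b + 1) (Dwn s' (a + 1) (b + 1) q) else q.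

Lemma DwnZ s a b (c : R) q : Dwn s a b (c *: q) = c *: Dwn s a b q.
Proof. by elim: s a b => //= s IH a b; rewrite IH DwZ. Qed.

Lemma DwnD s a b p q : Dwn s a b (p + q) = Dwn s a b p + Dwn s a b q.
Proof. by elim: s a b => //= s IH a b; rewrite IH DwD. Qed.

Lemma Dwn0 s a b : Dwn s a b 0 = 0.
Proof. by have := DwnZ s a b 0 0; rewrite !scale0r. Qed.

(** The m-th derivative of J_k is a multiple of J_{k-m} with parameters a + m, b + m, whose
    eigenvalue is (k - m)(k + m + a + b + 1). Subtraction in [nat] truncates, so the product
    vanishes for k < s, as J_k^(s) does. *)
Definition eigenprod s a b k : R :=
  \prod_(m < s) ((k - m)%:R * (k%:R + m%:R + a + b + 1)).

Lemma Dwn_derivn_shifted_jacobi s a b k :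
  Dwn s a b (shifted_jacobi a b k)^`(s) =
  ((-1) ^+ s * eigenprod s a b k) *: shifted_jacobi a b k.
Proof.
elim: s a b k => [|s IH] a b k.
  by rewrite /eigenprod big_ord0 mulr1 scale1r derivn0.
case: k => [|k].
  rewrite shifted_jacobi0 derivSn -polyC1 derivC -/(derivn s 0) linear0 /eigenprod.
  rewrite big_ord_recl/= sub0n !mul0r mulr0 scale0r.
  by rewrite Dwn0 /Dw deriv0 !mulr0 addr0.
rewrite derivSn deriv_shifted_jacobi derivnZ /= DwnZ IH.
have -> : (k.+1%:R + a + b + 1) *: (((-1) ^+ s * eigenprod s (a + 1) (b + 1) k) *:
    shifted_jacobi (a + 1) (b + 1) k) =
  ((-1) ^+ s * eigenprod s (a + 1) (b + 1) k) *: (shifted_jacobi a b k.+1)^`().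
  by rewrite deriv_shifted_jacobi !scalerA; congr (_ *: _); exact: mulrC.
rewrite DwZ.
rewrite Dw_deriv_shifted_jacobi scalerA; congr (_ *: _).
rewrite /eigenprod [in RHS]big_ord_recl/= subn0 addr0 exprS.
rewrite (eq_bigr (fun i : 'I_s => ((k.+1 - bump 0 i)%:R *
  (k.+1%:R + (bump 0 i)%:R + a + b + 1)))); last first.
  move=> i _; rewrite /bump/= add1n subSS; congr (_ * _).
  by rewrite -!natr1; ring.
ring.
Qed.

Lemma eigenprod_ge s a b k (c : R) : 0 <= c ->
  (forall m, (m < s)%N -> c <= (k - m)%:R * (k%:R + m%:R + a + b + 1)) ->
  c ^+ s <= eigenprod s a b k.
Proof.
move=> c0 H; rewrite /eigenprod -[in leLHS](card_ord s) -prodr_const.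
by apply: ler_prod => m _; rewrite c0 H.
Qed.


End JacobiAlgebra.

(** * Weighted integrals on the unit interval *)

Section OpenIntervalIntegrals.
Variable R : realType.
Notation mu := (@lebesgue_measure R).
Implicit Types (f g F : R -> R) (a b c x M : R).

(** On an increasing family of closed intervals the integral is a difference of two values of F,
    hence at most 2M; monotone convergence passes to the open interval. *)
Lemma integrable_oo_ge0 f F a b M : a < b ->
  (forall x, x \in `]a, b[ -> 0 <= f x) ->
  (forall x, x \in `]a, b[ -> {for x, continuous f}) ->
  (forall x, x \in `]a, b[ -> is_derive x 1 F (f x)) ->
  (forall x, x \in `]a, b[ -> `|F x| <= M) ->
  mu.-integrable `]a, b[ (EFin \o f).
Proof.
move=> ab f0 cf dF FM.
have mf : measurable_fun (`]a, b[ : set R) f.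
  apply: open_continuous_measurable_fun => //.
  by move=> x; rewrite inE => /cf.
(* The denominator starts at 3 so that even the first interval [a + d, b - d] is nondegenerate. *)
pose d (i : nat) : R := (b - a) / i.+3%:R.
have d0 i : 0 < d i by rewrite divr_gt0// subr_gt0.
have dS i j : (i <= j)%N -> d j <= d i.
  move=> ij; rewrite /d ler_pM2l ?subr_gt0// lef_pV2 ?posrE//.
  by rewrite ler_nat !ltnS.
have d3 i : d i <= (b - a) / 3.
  by rewrite (le_trans (dS 0%N i _)).
pose S : nat -> set R := fun i => [set` `[a + d i, b - d i]].
have Sab i : S i `<=` `]a, b[.
  by move=> x; rewrite /S/= !in_itv/=; have := d0 i; lra.
have ndS : nondecreasing_seq S.
  move=> i j /dS ij; rewrite subsetEset => x; rewrite /S/= !in_itv/=; lra.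
have bS : \bigcup_i S i = `]a, b[%classic.
  rewrite eqEsubset; split=> [x [i _ /Sab]//|x]; rewrite /= in_itv/= => /andP[ax xb].
  have m0 : 0 < Num.min (x - a) (b - x) by rewrite lt_min !subr_gt0 ax xb.
  have [k kP] : exists k : nat, (b - a) / Num.min (x - a) (b - x) < k%:R.
    exists (Num.truncn ((b - a) / Num.min (x - a) (b - x))).+1.
    by rewrite truncnS_gt.
  exists k => //; have : d k < Num.min (x - a) (b - x).
    rewrite /d ltr_pdivrMr// mulrC -ltr_pdivrMr//.
    by rewrite (lt_le_trans kP)// ler_nat -addn3 leq_addr.
  by rewrite lt_min /S/= in_itv/=; lra.
apply/integrableP; split; first exact/measurable_EFinP.
rewrite (_ : (fun x => _) = fun x => `|f x|%:E) //.
have -> : (\int[mu]_(x in `]a, b[) `|f x|%:E = \int[mu]_(x in `]a, b[) (f x)%:E)%E.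
  by apply: eq_integral => x; rewrite inE => /f0 ?; rewrite ger0_norm.
have mfS i : measurable_fun (S i) (EFin \o f).
  apply/measurable_EFinP; apply: measurable_funS mf => //; exact: Sab.
have mS i : measurable (S i) by exact: measurable_itv.
have f0S i x : S i x -> (0 <= (EFin \o f) x)%E by move=> /Sab /f0.
have /= := ge0_nondecreasing_set_cvg_integral (mu := mu) ndS mS mfS f0S.
rewrite bS => /cvg_lim <- //.
apply: le_lt_trans (ltry (M + M)).
apply: lime_le.
  apply: ereal_nondecreasing_is_cvgn.
  apply: ge0_nondecreasing_set_nondecreasing_integral => //.
apply: nearW => i.
have lt_S : a + d i < b - d i by have := d3 i; have := d0 i; lra.
have inS x : x \in `[a + d i, b - d i] -> x \in `]a, b[.
  by move=> xS; have := Sab i x; rewrite /= -/(is_true _); apply.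
rewrite (@continuous_FTC2 _ f F (a + d i) (b - d i))//.
- rewrite -EFinB lee_fin (le_trans (ler_norm _))// (le_trans (ler_normB _ _))//.
  by rewrite lerD// FM// inS// in_itv/= ?lexx ?(ltW lt_S).
- apply: continuous_in_subspaceT => x; rewrite inE => xS.
  by apply: cf; apply: inS.
- split.
  + move=> x xS; have [] // := dF x.
    by apply: inS; apply: subset_itv_oo_cc.
  + apply: cvg_at_right_filter; apply: differentiable_continuous.
    apply/derivable1_diffP; have [] // := dF (a + d i).
    by rewrite inS// in_itv/= lexx ltW.
  + apply: cvg_at_left_filter; apply: differentiable_continuous.
    apply/derivable1_diffP; have [] // := dF (b - d i).
    by rewrite inS// in_itv/= lexx ltW.
- move=> x xS; rewrite derive1E.
  have [//|_ ->//] := dF x.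
  by apply: inS; apply: subset_itv_oo_cc.
Qed.

Lemma integrable_oo_cc f a b : mu.-integrable `]a, b[ (EFin \o f) ->
  mu.-integrable `[a, b] (EFin \o f).
Proof.
move=> /integrableP[mf foo]; apply/integrableP; split.
  exact: emeasurable_fun_itv_cc mf.
rewrite (@integral_itv_bndoo _ a b _ true false)//.
exact: measurableT_comp.
Qed.

(** Since f may blow up at the ends, F is compared with the indefinite integral G: F - G is
    continuous on [a, b] with zero derivative inside, and the mean value theorem equates its end
    values. *)
Lemma Rintegral_oo_FTC f F a b : a < b ->
  (forall x, x \in `]a, b[ -> {for x, continuous f}) ->
  (forall x, x \in `]a, b[ -> is_derive x 1 F (f x)) ->
  {within `[a, b], continuous F} ->
  mu.-integrable `]a, b[ (EFin \o f) ->
  \int[mu]_(x in `]a, b[) f x = F b - F a.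
Proof.
move=> ab cf dF cF intf.
have intf' := integrable_oo_cc intf.
pose G x := \int[mu]_(t in `[a, x]) f t.
have dG x : x \in `]a, b[ -> is_derive x 1 G (f x).
  move=> xab; have /andP[ax xb] : a < x < b by move: xab; rewrite in_itv.
  have [dGx G'x] := continuous_FTC1_closed xb intf' ax (cf _ xab).
  by split; [exact: dGx|rewrite -derive1E; exact: G'x].
have cG : {within `[a, b], continuous G}.
  exact: parameterized_integral_continuous (ltW ab) intf'.
have dH x : x \in `]a, b[ -> is_derive x 1 (F - G) (f x - f x).
  by move=> xab; apply: is_deriveB; [exact: dF|exact: dG].
have cH : {within `[a, b], continuous (F - G)}.
  by move=> x; apply: cvgB; [exact: cF|exact: cG].
have [c _] := MVT ab dH cH.
rewrite subrr mul0r => /eqP; rewrite subr_eq0 => /eqP.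
rewrite !fctE /G set_itv1 Rintegral_set1 subr0 => E.
have -> : \int[mu]_(x in `]a, b[) f x = \int[mu]_(x in `[a, b]) f x.
  rewrite /Rintegral (@integral_itv_bndoo _ a b _ true false)//.
  by case/integrableP: intf.
by rewrite -E; ring.
Qed.

End OpenIntervalIntegrals.

(** * The weight (1 - t)^a t^b and integration by parts against it *)

Section Weight.
Variable R : realType.
Notation mu := (@lebesgue_measure R).
Implicit Types (f g F : R -> R) (a b c d t x : R) (p q : {poly R}).

Lemma weight_gt0 a b t : 0 < t -> t < 1 -> 0 < weight a b t.
Proof. by move=> t0 t1; rewrite mulr_gt0// powR_gt0// subr_gt0. Qed.

Lemma weightM a b c d t : 0 < t -> t < 1 ->
  weight a b t * weight c d t = weight (a + c) (b + d) t.
Proof.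
move=> t0 t1; rewrite /weight !powRD; [ring| |];
  by apply/implyP => _; rewrite gt_eqF// subr_gt0.
Qed.

Lemma weight11 t : 0 < t -> t < 1 -> weight 1 1 t = (1 - t) * t.
Proof. by move=> t0 t1; rewrite /weight !powRr1// ?subr_ge0 ltW. Qed.

Lemma weight_natr n t : 0 < t -> t < 1 ->
  weight n%:R n%:R t = ((1 - t) * t) ^+ n.
Proof. by move=> t0 t1; rewrite /weight !powR_mulrn ?subr_ge0 ?ltW// exprMn. Qed.

Lemma powR_le1 x b : 0 < x -> x <= 1 -> 0 <= b -> x `^ b <= 1.
Proof. by move=> x0 x1 b0; rewrite -(powRr0 x); apply: ger_powR; rewrite ?x0. Qed.

Lemma powR_ge1 x b : 0 < x -> x <= 1 -> b <= 0 -> 1 <= x `^ b.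
Proof. by move=> x0 x1 b0; rewrite -(powRr0 x); apply: ger_powR; rewrite ?x0. Qed.

Lemma powRB1 x a : 0 < x -> x `^ a = x * x `^ (a - 1).
Proof.
move=> x0; rewrite -[X in X * _]powRr1 ?ltW// -powRD; last first.
  by apply/implyP => _; rewrite gt_eqF.
by congr (_ `^ _); ring.
Qed.

Lemma is_derive_onem_powR a t : t < 1 ->
  is_derive t 1 (fun x => (1 - x) `^ a) (- (a * (1 - t) `^ (a - 1))).
Proof.
move=> t1; have t1' : 0 < 1 - t by rewrite subr_gt0.
have d1 : is_derive t 1 (fun x => 1 - x) (-1 : R).
  have : is_derive t 1 (cst 1 - id) (0 - 1 : R) by exact: is_deriveB.
  by rewrite sub0r.
have : is_derive t 1 ((fun x : R => x `^ a) \o (fun x => 1 - x))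
    (a * (1 - t) `^ (a - 1) * (-1)).
  by apply: is_derive1_comp; exact: is_derive1_powR.
by move/is_derive_eq; apply; rewrite mulrN1.
Qed.

Lemma is_derive_continuous f t (df : R) : is_derive t 1 f df ->
  {for t, continuous f}.
Proof.
move=> [d _]; apply: differentiable_continuous; exact/derivable1_diffP.
Qed.

Lemma is_derive_weight a b t : 0 < t -> t < 1 ->
  is_derive t 1 (weight a b)
    ((b * (1 - t) - a * t) * weight (a - 1) (b - 1) t).
Proof.
move=> t0 t1; have t1' : 0 < 1 - t by rewrite subr_gt0.
have d2 := is_derive_onem_powR a t1.
have d3 : is_derive t 1 (fun x => x `^ b) (b * t `^ (b - 1)).
  exact: is_derive1_powR.
have := is_deriveM d2 d3.
rewrite (_ : _ * _ = weight a b); last by apply/funext => x.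
move/is_derive_eq; apply; rewrite /= /weight /GRing.scale/=.
by rewrite (powRB1 a t1') (powRB1 b t0); ring.
Qed.

Lemma weightDw a b q t : 0 < t -> t < 1 ->
  is_derive t 1 (fun x => q.[x] * weight a b x)
    ((Dw a b q).[t] * weight (a - 1) (b - 1) t).
Proof.
move=> t0 t1.
have := is_deriveM (is_derive_poly q t) (is_derive_weight a b t0 t1).
move/is_derive_eq; apply.
have t1' : 0 < 1 - t by rewrite subr_gt0.
have -> : weight a b t = t * (1 - t) * weight (a - 1) (b - 1) t.
  by rewrite /weight (powRB1 a t1') (powRB1 b t0); ring.
rewrite /Dw !(hornerD, hornerM, hornerN, hornerZ, hornerX, hornerC) /GRing.scale/=.
ring.
Qed.

Lemma continuous_weight a b t : 0 < t -> t < 1 -> {for t, continuous (weight a b)}.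
Proof. move=> t0 t1; exact: is_derive_continuous (is_derive_weight a b t0 t1). Qed.

Lemma onem_cvg_at_left : (1 - x : R) @[x --> 1^'-] --> 0^'+.
Proof.
move=> P [e /= e0 H]; exists e => //= y ye y1; apply: H; last by rewrite subr_gt0.
by move: ye; rewrite /ball/= sub0r normrN.
Qed.

Lemma within_continuous_weight a b : 0 < a -> 0 < b ->
  {within `[0, 1], continuous (weight a b)}.
Proof.
move=> a0 b0; apply/continuous_within_itvP => //; split.
- by move=> x; rewrite in_itv/= => /andP[x0 x1]; exact: continuous_weight.
- rewrite /weight powR0 ?gt_eqF// mulr0.
  rewrite -[X in _ --> X](mulr0 ((1 - 0) `^ a)); apply: cvgM; last exact: powR_cvg0.
  apply: cvg_at_right_filter.
  exact: (is_derive_continuous (is_derive_onem_powR a ltr01)).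
- rewrite /weight subrr powR0 ?gt_eqF// mul0r.
  rewrite -[X in _ --> X](mul0r (1 `^ b)); apply: cvgM.
    exact: cvg_comp onem_cvg_at_left (powR_cvg0 a0).
  apply: cvg_at_left_filter.
  exact: (is_derive_continuous (is_derive1_powR b ltr01)).
Qed.

Lemma integrable_powR b : -1 < b -> mu.-integrable `]0, 1[ (EFin \o (fun t => t `^ b)).
Proof.
move=> b1; have b1' : 0 < b + 1 by lra.
apply: (@integrable_oo_ge0 _ _ (fun t => t `^ (b + 1) / (b + 1)) _ _ (b + 1)^-1) => //.
- by move=> x _; exact: powR_ge0.
- move=> x; rewrite in_itv/= => /andP[x0 _].
  exact: (is_derive_continuous (is_derive1_powR b x0)).
- move=> x; rewrite in_itv/= => /andP[x0 _].
  have := is_deriveM (is_derive1_powR (b + 1) x0) (is_derive_cst (b + 1)^-1 x 1).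
  move/is_derive_eq; apply; rewrite /GRing.scale/= mulr0 add0r addrK.
  by rewrite mulrA mulVf ?gt_eqF// mul1r.
- move=> x; rewrite in_itv/= => /andP[x0 x1].
  rewrite ger0_norm; last by rewrite divr_ge0 ?powR_ge0// ltW.
  rewrite ler_pdivrMr// mulVf ?gt_eqF//.
  by apply: powR_le1; lra.
Qed.

Lemma integrable_onem_powR a : -1 < a ->
  mu.-integrable `]0, 1[ (EFin \o (fun t => (1 - t) `^ a)).
Proof.
move=> a1; have a1' : 0 < a + 1 by lra.
apply: (@integrable_oo_ge0 _ _ (fun t => - ((1 - t) `^ (a + 1) / (a + 1))) _ _ (a + 1)^-1) => //.
- by move=> x _; exact: powR_ge0.
- move=> x; rewrite in_itv/= => /andP[_ x1].
  exact: (is_derive_continuous (is_derive_onem_powR a x1)).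
- move=> x; rewrite in_itv/= => /andP[_ x1].
  have := is_deriveN (is_deriveM (is_derive_onem_powR (a + 1) x1) (is_derive_cst (a + 1)^-1 x 1)).
  move/is_derive_eq; apply; rewrite /GRing.scale/= mulr0 add0r addrK.
  by rewrite mulrN opprK mulrA mulVf ?gt_eqF// mul1r.
- move=> x; rewrite in_itv/= => /andP[x0 x1].
  rewrite normrN ger0_norm; last by rewrite divr_ge0 ?powR_ge0// ltW.
  rewrite ler_pdivrMr// mulVf ?gt_eqF//.
  by apply: powR_le1; lra.
Qed.

Lemma measurable_weight a b : measurable_fun (`]0, 1[ : set R) (weight a b).
Proof.
apply: open_continuous_measurable_fun => // x; rewrite inE/= in_itv/= => /andP[? ?].
exact: continuous_weight.
Qed.

Lemma integrable_weight a b : -1 < a -> -1 < b ->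
  mu.-integrable `]0, 1[ (EFin \o weight a b).
Proof.
move=> a1 b1.
apply: (le_integrable _ _ _
  (integrableD _ (integrable_powR b1) (integrable_onem_powR a1))) => //.
  by apply/measurable_EFinP; exact: measurable_weight.
move=> x /=; rewrite in_itv/= => /andP[x0 x1].
have x1' : 0 < 1 - x by rewrite subr_gt0.
rewrite lee_fin !ger0_norm ?addr_ge0 ?powR_ge0//; last exact/ltW/weight_gt0.
(* Multiplying by 1 = (1 - x) + x leaves at most one singular endpoint in each term. *)
have -> : weight a b x = (1 - x) `^ (a + 1) * x `^ b + (1 - x) `^ a * x `^ (b + 1).
  rewrite /weight (powRB1 (a + 1) x1') (powRB1 (b + 1) x0) !addrK; ring.
by apply: lerD; [rewrite ler_piMl ?powR_ge0//|rewrite ler_piMr ?powR_ge0//];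
  apply: powR_le1; lra.
Qed.

Definition bdd f := measurable_fun (`]0, 1[ : set R) f /\
  exists M, forall x, 0 < x -> x < 1 -> `|f x| <= M.

Lemma bdd_continuous f : {within `[0, 1], continuous f} -> bdd f.
Proof.
move=> cf; split.
  have /continuous_within_itvP-/(_ ltr01)[co _ _] := cf.
  by apply: open_continuous_measurable_fun => // x; rewrite inE => /co.
have cI : compact (`[0, 1] : set R) by exact: segment_compact.
have [M [_ HM]] := compact_bounded (continuous_compact cf cI).
exists (M + 1) => x x0 x1; apply: (HM (M + 1)); first by rewrite ltrDl.
by exists x => //=; rewrite in_itv/= !ltW.
Qed.

Lemma within_continuous_horner p : {within `[0, 1], continuous (horner p)}.
Proof. by apply: continuous_subspaceT; exact: continuous_horner. Qed.

Lemma bdd_horner p : bdd (horner p).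
Proof. exact/bdd_continuous/within_continuous_horner. Qed.

Lemma bddD f g : bdd f -> bdd g -> bdd (fun x => f x + g x).
Proof.
move=> [mf [M fM]] [mg [N gN]]; split; first exact: measurable_funD.
exists (M + N) => x x0 x1; rewrite (le_trans (ler_normD _ _))//.
by rewrite lerD ?fM ?gN.
Qed.

Lemma bddM f g : bdd f -> bdd g -> bdd (fun x => f x * g x).
Proof.
move=> [mf [M fM]] [mg [N gN]]; split; first exact: measurable_funM.
by exists (M * N) => x x0 x1; rewrite normrM ler_pM ?fM ?gN.
Qed.

Lemma bdd_cst c : bdd (fun=> c).
Proof. by split => //; exists `|c|. Qed.

Lemma bddZ c f : bdd f -> bdd (fun x => c * f x).
Proof. by move=> bf; apply: bddM => //; exact: bdd_cst. Qed.


Definition wint a b f : R := \int[mu]_(t in `]0, 1[) (f t * weight a b t).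

Lemma eq_wint a b f g : (forall x, 0 < x -> x < 1 -> f x = g x) ->
  wint a b f = wint a b g.
Proof.
move=> fg; apply: eq_Rintegral => x; rewrite inE/= in_itv/= => /andP[? ?].
by rewrite fg.
Qed.

Lemma wint_ge0 a b f : (forall x, 0 < x -> x < 1 -> 0 <= f x) -> 0 <= wint a b f.
Proof.
move=> f0; apply: Rintegral_ge0 => x /=; rewrite in_itv/= => /andP[x0 x1].
by rewrite mulr_ge0 ?f0 ?ltW ?weight_gt0.
Qed.

Section integrable_weights.
Variables (a b : R).
Hypotheses (a1 : -1 < a) (b1 : -1 < b).

Lemma integrable_bdd f : bdd f ->
  mu.-integrable `]0, 1[ (EFin \o (fun t => f t * weight a b t)).
Proof.
move=> [mf [M fM]].
apply: (le_integrable _ _ _ (integrableZl _ M (integrable_weight a1 b1))) => //.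
  by apply/measurable_EFinP; apply: measurable_funM => //; exact: measurable_weight.
move=> x /=; rewrite in_itv/= => /andP[x0 x1].
rewrite lee_fin !normrM ler_wpM2r// (le_trans (fM _ x0 x1))//.
exact: ler_norm.
Qed.

Lemma wintD f g : bdd f -> bdd g ->
  wint a b (fun x => f x + g x) = wint a b f + wint a b g.
Proof.
move=> bf bg; rewrite /wint; under eq_Rintegral do rewrite mulrDl.
by rewrite RintegralD//; exact: integrable_bdd.
Qed.

Lemma wintZ c f : bdd f -> wint a b (fun x => c * f x) = c * wint a b f.
Proof.
move=> bf; rewrite /wint; under eq_Rintegral do rewrite -mulrA.
by rewrite RintegralZl//; exact: integrable_bdd.
Qed.


End integrable_weights.

Definition pint a b p : R := wint a b (horner p).

Section polynomial_integrals.
Variables (a b : R).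
Hypotheses (a1 : -1 < a) (b1 : -1 < b).

Lemma pintD p q : pint a b (p + q) = pint a b p + pint a b q.
Proof.
rewrite /pint -wintD//; try exact: bdd_horner.
by apply: eq_wint => x _ _; rewrite hornerD.
Qed.

Lemma pintZ c p : pint a b (c *: p) = c * pint a b p.
Proof.
rewrite /pint -wintZ//; try exact: bdd_horner.
by apply: eq_wint => x _ _; rewrite hornerZ.
Qed.

Lemma pintN p : pint a b (- p) = - pint a b p.
Proof. by rewrite -scaleN1r pintZ mulN1r. Qed.

Lemma pint0 : pint a b 0 = 0.
Proof. by rewrite -(scale0r 0) pintZ mul0r. Qed.

Lemma pint_sum (I : finType) (P : pred I) (F : I -> {poly R}) :
  pint a b (\sum_(i | P i) F i) = \sum_(i | P i) pint a b (F i).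
Proof. exact: (big_morph _ pintD pint0). Qed.

Lemma pint_sqr_ge0 p : 0 <= pint a b (p * p).
Proof. by apply: wint_ge0 => x _ _; rewrite hornerM -expr2 sqr_ge0. Qed.

(** The integrand is the derivative of q w_{a+1,b+1}, and the exponents a + 1, b + 1 are positive,
    so both boundary terms vanish. *)
Lemma pint_Dw q : pint a b (Dw (a + 1) (b + 1) q) = 0.
Proof.
have a2 : 0 < a + 1 by rewrite -ltrBlDr sub0r.
have b2 : 0 < b + 1 by rewrite -ltrBlDr sub0r.
pose F x := q.[x] * weight (a + 1) (b + 1) x.
transitivity (F 1 - F 0); last first.
  by rewrite /F /weight subrr !powR0 ?gt_eqF// !(mul0r, mulr0) subrr.
apply: Rintegral_oo_FTC => //.
- move=> x; rewrite in_itv/= => /andP[x0 x1].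
  apply: cvgM; [exact: continuous_horner|exact: continuous_weight].
- move=> x; rewrite in_itv/= => /andP[x0 x1].
  have := weightDw (a + 1) (b + 1) q x0 x1.
  by move/is_derive_eq; apply; rewrite !addrK.
- move=> x; apply: cvgM; first exact: within_continuous_horner.
  exact: within_continuous_weight.
- exact/integrable_bdd/bdd_horner.
Qed.

Lemma pint_weight11 p : pint a b ('X * (1 - 'X) * p) = pint (a + 1) (b + 1) p.
Proof.
apply: eq_Rintegral => x; rewrite inE/= in_itv/= => /andP[x0 x1].
rewrite -weightM// weight11// !(hornerM, hornerD, hornerN, hornerX, hornerC).
ring.
Qed.

(** [Dw] is a first-order operator, so Dw(p q) = Dw(p) q + X (1 - X) p q', and the left-hand side
    integrates to zero. *)
Lemma pint_parts p q :
  pint a b (Dw (a + 1) (b + 1) p * q) = - pint (a + 1) (b + 1) (p * q^`()).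
Proof.
apply/eqP; rewrite -subr_eq0 opprK -pint_weight11 -pintD -(pint_Dw (p * q)).
by apply/eqP; congr (pint _ _ _); rewrite /Dw derivM; ring.
Qed.

End polynomial_integrals.
End Weight.

(** * Orthogonal expansions and Gauss quadrature *)

Section Positivity.
Variable R : realType.
Notation mu := (@lebesgue_measure R).
Implicit Types (f : R -> R) (a b c d e : R).

Lemma Rintegral_subset (A B : set R) f : measurable A -> measurable B ->
  A `<=` B -> (forall x, B x -> 0 <= f x) -> mu.-integrable B (EFin \o f) ->
  \int[mu]_(x in A) f x <= \int[mu]_(x in B) f x.
Proof.
move=> mA mB AB f0 intf; apply: fine_le.
- by apply: integrable_fin_num => //; exact: integrableS intf.
- exact: integrable_fin_num.
- by apply: ge0_subset_integral => //; case/integrableP: intf.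
Qed.

Lemma Rintegral_cc_cst c d e : c <= d ->
  \int[mu]_(x in `[c, d]) (cst e x) = e * (d - c).
Proof.
move=> cd; rewrite Rintegral_cst//= lebesgue_measure_itv/= lte_fin.
by case: ltgtP cd => // -> _; rewrite subrr.
Qed.

(** The absolute values in the exponents make this a lower bound for the weight on [c, d] whatever
    the signs of a and b. *)
Lemma wint_ge_sub a b f c d e : -1 < a -> -1 < b -> bdd f ->
  (forall x, 0 < x -> x < 1 -> 0 <= f x) ->
  0 < c -> c <= d -> d < 1 -> 0 <= e -> (forall x, c <= x -> x <= d -> e <= f x) ->
  e * ((1 - d) `^ `|a| * c `^ `|b|) * (d - c) <= wint a b f.
Proof.
move=> a1 b1 bf f0 c0 cd d1 e0 fe.
have sub : `[c, d] `<=` `]0, 1[.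
  by move=> x /=; rewrite !in_itv/= => /andP[? ?]; rewrite (lt_le_trans c0)//= (le_lt_trans _ d1).
have intf := integrable_bdd a1 b1 bf.
apply: (@le_trans _ _ (\int[mu]_(x in `[c, d]) (f x * weight a b x))); last first.
  apply: Rintegral_subset => // x /=; rewrite in_itv/= => /andP[x0 x1].
  by rewrite mulr_ge0 ?f0// ltW// weight_gt0.
rewrite -(Rintegral_cc_cst _ cd); apply: le_Rintegral.
- exact: measurable_itv.
- apply: (@continuous_compact_integrable R (cst _)); first exact: segment_compact.
  by move=> x; exact: cvg_cst.
- by apply: integrableS intf.
move=> x /=; rewrite in_itv/= => /andP[cx xd].
have x1 : x < 1 by rewrite (le_lt_trans xd).
have x0 : 0 < x by rewrite (lt_le_trans c0).
have nn (u p : R) : 0 < u -> u <= 1 -> u `^ `|p| <= u `^ p.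
  by move=> u0 u1; apply: ger_powR; rewrite ?u0 ?ler_norm.
rewrite ler_pM ?fe ?mulr_ge0 ?powR_ge0// ler_pM ?powR_ge0//.
- apply: le_trans (nn _ _ _ _); [|lra..].
  by apply: ge0_ler_powR; rewrite ?nnegrE//; lra.
- apply: le_trans (nn _ _ _ _); [|lra..].
  by apply: ge0_ler_powR; rewrite ?nnegrE//; lra.
Qed.

Lemma wint1_gt0 a b : -1 < a -> -1 < b -> 0 < pint a b 1.
Proof.
move=> a1 b1; have h : (1 / 4 : R) <= 3 / 4 by lra.
apply: (@lt_le_trans _ _ (1 * ((1 - 3 / 4) `^ `|a| * (1 / 4) `^ `|b|) * (3 / 4 - 1 / 4))).
  by rewrite mul1r !mulr_gt0// ?powR_gt0//; lra.
apply: wint_ge_sub => //; try lra.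
- exact: bdd_horner.
- by move=> x _ _; rewrite hornerC.
- by move=> x _ _; rewrite hornerC.
Qed.

End Positivity.

Section Orthogonality.
Variable R : realType.
Implicit Types (a b : R) (p q : {poly R}) (n k : nat).

(** Induction on n: the raising relation writes J_{n+1} as a [Dw], and integration by parts moves a
    derivative onto q, which lowers its degree. *)
Lemma shifted_jacobi_orth a b n q : -1 < a -> -1 < b -> (size q <= n)%N ->
  pint a b (shifted_jacobi a b n * q) = 0.
Proof.
elim: n a b q => [|n IH] a b q a1 b1.
  by rewrite leqn0 size_poly_eq0 => /eqP ->; rewrite mulr0 pint0.
move=> sq; have : pint a b (- n.+1%:R *: shifted_jacobi a b n.+1 * q) = 0.
  rewrite -Dw_shifted_jacobi pint_parts// IH ?oppr0//; try lra.
  by rewrite size_deriv_realType; case: (size q) sq.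
rewrite -scalerAl pintZ// => /eqP; rewrite mulf_eq0 oppr_eq0 pnatr_eq0/=.
by move=> /eqP.
Qed.

Definition jacobi_norm a b n := pint a b (shifted_jacobi a b n * shifted_jacobi a b n).

(** The norm at (a, b, n + 1) is a positive multiple of the norm at (a + 1, b + 1, n), so everything
    reduces to the mass of a weight. *)
Lemma jacobi_norm_gt0 a b n : -1 < a -> -1 < b -> 0 < jacobi_norm a b n.
Proof.
elim: n a b => [|n IH] a b a1 b1.
  by rewrite /jacobi_norm shifted_jacobi0 mulr1 wint1_gt0.
have a2 : -1 < a + 1 by lra.
have b2 : -1 < b + 1 by lra.
have : n.+1%:R * jacobi_norm a b n.+1 =
    (n.+1%:R + a + b + 1) * jacobi_norm (a + 1) (b + 1) n.
  rewrite /jacobi_norm -[in LHS]pintZ// scalerAl.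
  rewrite -[in n.+1%:R *: _](opprK n.+1%:R) [in X in X * _]scaleNr -Dw_shifted_jacobi.
  rewrite mulNr pintN// pint_parts// opprK deriv_shifted_jacobi -scalerAr pintZ//.
have c0 : 0 < n.+1%:R + a + b + 1.
  by rewrite -natr1; have : 0 <= n%:R :> R by []; lra.
move=> E; rewrite -(pmulr_rgt0 _ (ltr0Sn R n)) E.
exact: mulr_gt0 c0 (IH _ _ a2 b2).
Qed.

Section basis.
Variables (a b : R).
Hypotheses (a1 : -1 < a) (b1 : -1 < b).
Local Notation J := (shifted_jacobi a b).
Local Notation h := (jacobi_norm a b).

Lemma shifted_jacobi_dot n k : pint a b (J n * J k) = (n == k)%:R * h n.
Proof.
have [->|nk] := eqVneq n k; first by rewrite mul1r.
rewrite mul0r; case: (ltngtP n k) nk => // nk _.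
  by rewrite mulrC shifted_jacobi_orth// size_shifted_jacobi.
by rewrite shifted_jacobi_orth// size_shifted_jacobi.
Qed.

(** If q had degree m, pairing with J_m would isolate its leading term, because J_m annihilates what
    remains after subtracting the right multiple of J_m. *)
Lemma jacobi_coef_eq0 n q : (size q <= n)%N ->
  (forall k, (k < n)%N -> pint a b (J k * q) = 0) -> q = 0.
Proof.
move=> sq H; apply/eqP; rewrite -size_poly_eq0; apply/negPn/negP => q0.
case E : (size q) q0 => [//|m] _.
have mn : (m < n)%N by rewrite -E.
pose c := lead_coef q / lead_coef (J m).
have sJ : size (J m) = m.+1 by exact: size_shifted_jacobi.
have lJ : lead_coef (J m) != 0 by rewrite lead_coef_eq0 -size_poly_eq0 sJ.
have lq : lead_coef q != 0 by rewrite lead_coef_eq0 -size_poly_eq0 E.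
have c0 : c != 0 by rewrite mulf_neq0 ?invr_eq0.
have sr : (size (q - c *: J m)%R <= m)%N.
  apply/leq_sizeP => j; rewrite leq_eqVlt => /predU1P[<-|mj].
    rewrite coefB coefZ /c (_ : q`_m = lead_coef q) ?lead_coefE ?E//.
    by rewrite [X in _ / X](_ : _ = (J m)`_m) ?lead_coefE ?sJ// mulfVK ?subrr//;
      move: lJ; rewrite lead_coefE sJ.
  rewrite coefB coefZ !nth_default ?mulr0 ?subr0// ?E ?sJ//.
have := H m mn.
rewrite -(subrK (c *: J m) q) mulrDr pintD// shifted_jacobi_orth// add0r.
rewrite -scalerAr pintZ// => /eqP; rewrite mulf_eq0 (negbTE c0)/=.
by rewrite gt_eqF// jacobi_norm_gt0.
Qed.

Definition jacobi_sum n (c : nat -> R) := \sum_(k < n) c k *: J k.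

Lemma size_jacobi_sum n c : (size (jacobi_sum n c) <= n)%N.
Proof.
apply: (leq_trans (size_sum _ _ _)); apply/bigmax_leqP => k _.
by rewrite (leq_trans (size_scale_leq _ _))// size_shifted_jacobi.
Qed.

Lemma jacobi_sum_dot n c k : (k < n)%N -> pint a b (J k * jacobi_sum n c) = c k * h k.
Proof.
move=> kn; rewrite /jacobi_sum mulr_sumr pint_sum// (bigD1 (Ordinal kn))//=.
rewrite big1 => [|i ik].
  by rewrite addr0 -scalerAr pintZ// shifted_jacobi_dot eqxx mul1r.
rewrite -scalerAr pintZ// shifted_jacobi_dot (_ : (k == i) = false) ?mul0r ?mulr0//.
by apply/negbTE; apply: contra ik => /eqP ki; apply/eqP/val_inj.
Qed.

Lemma jacobi_sum_dot2 n c d : pint a b (jacobi_sum n d * jacobi_sum n c) =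
  \sum_(k < n) d k * c k * h k.
Proof.
rewrite [X in X * _]/jacobi_sum mulr_suml pint_sum//; apply: eq_bigr => k _.
by rewrite -scalerAl pintZ// jacobi_sum_dot// mulrA.
Qed.

Lemma jacobi_expand n q : (size q <= n)%N ->
  q = jacobi_sum n (fun k => pint a b (J k * q) / h k).
Proof.
move=> sq; apply/eqP; rewrite -subr_eq0; apply/eqP.
apply: (@jacobi_coef_eq0 n).
  by rewrite (leq_trans (size_polyD _ _))// geq_max sq size_polyN size_jacobi_sum.
move=> k kn; rewrite mulrBr pintD// pintN// jacobi_sum_dot// divfK ?subrr//.
by rewrite gt_eqF// jacobi_norm_gt0.
Qed.

End basis.

Lemma pint_Dwn s a b p q : -1 < a -> -1 < b ->
  pint a b (Dwn s a b p * q) = (-1) ^+ s * pint (a + s%:R) (b + s%:R) (p * q^`(s)).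
Proof.
elim: s a b q => [|s IH] a b q a1 b1 /=; first by rewrite !addr0 mul1r.
rewrite pint_parts// IH; [|lra|lra].
by rewrite -derivSn exprS mulN1r mulNr -!addrA !nat1r.
Qed.

(** Up to sign [Dwn] is adjoint to the s-th derivative, and it sends J_k^(s) back to a multiple of
    J_k. Hence the J_k^(s) stay orthogonal for w_{a+s,b+s}, and no cross terms appear. *)
Lemma jacobi_sum_derivn s a b n c : -1 < a -> -1 < b ->
  pint (a + s%:R) (b + s%:R) ((jacobi_sum a b n c)^`(s) * (jacobi_sum a b n c)^`(s)) =
  \sum_(k < n) c k ^+ 2 * jacobi_norm a b k * eigenprod s a b k.
Proof.
move=> a1 b1; set E := jacobi_sum a b n c.
have ss : (-1) ^+ s * (-1) ^+ s = 1 :> R by rewrite -exprMn mulrNN mulr1 expr1n.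
have -> : pint (a + s%:R) (b + s%:R) (E^`(s) * E^`(s)) =
    (-1) ^+ s * pint a b (Dwn s a b E^`(s) * E).
  by rewrite pint_Dwn// mulrA ss mul1r.
have -> : Dwn s a b E^`(s) =
    (-1) ^+ s *: jacobi_sum a b n (fun k => c k * eigenprod s a b k).
  rewrite /E /jacobi_sum linear_sum/= (big_morph _ (DwnD s a b) (Dwn0 s a b)) scaler_sumr.
  apply: eq_bigr => k _; rewrite derivnZ DwnZ Dwn_derivn_shifted_jacobi !scalerA.
  by congr (_ *: _); ring.
rewrite -scalerAl pintZ// mulrA ss mul1r jacobi_sum_dot2//.
by apply: eq_bigr => k _; ring.
Qed.

Lemma eigenprod1 a b k : eigenprod 1 a b k = k%:R * (k%:R + a + b + 1).
Proof. by rewrite /eigenprod big_ord1 subn0 addr0. Qed.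

Lemma derivn1_pint a b q : pint (a + 1) (b + 1) (q^`() * q^`()) =
  pint (a + 1%:R) (b + 1%:R) (q^`(1) * q^`(1)).
Proof. by rewrite derivn1. Qed.

(** Markov's inequality with constant exactly n: a + b + 1 <= 0 bounds the eigenvalue k (k + a + b +
    1) by k^2. *)
Lemma pint_deriv_le a b n q : -1 < a -> a <= - 2^-1 -> -1 < b -> b <= - 2^-1 ->
  (size q <= n.+1)%N ->
  pint (a + 1) (b + 1) (q^`() * q^`()) <= n%:R ^+ 2 * pint a b (q * q).
Proof.
move=> a1 a2 b1 b2 sq; rewrite (jacobi_expand a1 b1 sq).
set c := fun k => _; rewrite derivn1_pint jacobi_sum_derivn// jacobi_sum_dot2//.
rewrite mulr_sumr; apply: ler_sum => k _; rewrite -expr2 eigenprod1 mulrC.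
have : 0 <= c k ^+ 2 * jacobi_norm a b k.
  by rewrite mulr_ge0 ?sqr_ge0// ltW// jacobi_norm_gt0.
move: (c k ^+ 2 * _) => {c}w w0; rewrite ler_wpM2r//.
have kn : k%:R <= n%:R :> R by rewrite ler_nat -ltnS.
have k0 : 0 <= k%:R :> R by [].
rewrite (@le_trans _ _ (k%:R ^+ 2))//; last by rewrite lerXn2r// nnegrE.
by rewrite expr2 ler_wpM2l//; lra.
Qed.

End Orthogonality.

(** * Lagrange interpolation and Gauss quadrature at the Jacobi zeros *)

Section GaussQuadrature.
Variable R : realType.
Implicit Types (a b : R) (p q : {poly R}) (n : nat).

Definition lagr n (y : 'I_n -> R) j : {poly R} :=
  \prod_(i < n | i != j) ((y j - y i)^-1 *: ('X - (y i)%:P)).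

Definition linterp n (y : 'I_n -> R) (f : R -> R) : {poly R} :=
  \sum_(j < n) f (y j) *: lagr y j.

Lemma size_lagr n (y : 'I_n -> R) j : (size (lagr y j) <= n)%N.
Proof.
rewrite /lagr; apply: (leq_trans (size_poly_prod_leq _ _)).
rewrite (@leq_trans ((\sum_(i < n | i != j) 2).+1 - #|[pred i | i != j]|))%N//.
  rewrite leq_sub2r// ltnS leq_sum// => i _.
  by rewrite (leq_trans (size_scale_leq _ _))// size_XsubC.
rewrite sum_nat_const.
have cE : #|predC1 j| = n.-1 by rewrite cardC1 card_ord.
rewrite -/(predC1 j) [X in (X * 2)%N](_ : _ = #|predC1 j|)// cE.
by have := ltn_ord j; lia.
Qed.

Lemma size_linterp n (y : 'I_n -> R) f : (size (linterp y f) <= n)%N.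
Proof.
apply: (leq_trans (size_sum _ _ _)); apply/bigmax_leqP => j _.
by rewrite (leq_trans (size_scale_leq _ _))// size_lagr.
Qed.

Section nodes.
Variables (n : nat) (y : 'I_n -> R).
Hypothesis yinj : injective y.

Lemma lagr_node i j : (lagr y j).[y i] = (i == j)%:R.
Proof.
rewrite /lagr horner_prod; have [->|ij] := eqVneq i j.
  apply: big1 => k kj; rewrite hornerZ hornerXsubC mulVf// subr_eq0.
  by apply: contra kj => /eqP/yinj ->.
by rewrite (bigD1 i)//= hornerZ hornerXsubC subrr mulr0 mul0r.
Qed.

Lemma linterp_node f i : (linterp y f).[y i] = f (y i).
Proof.
rewrite /linterp horner_sum (bigD1 i)//= hornerZ lagr_node eqxx mulr1 big1 ?addr0//.
by move=> j ji; rewrite hornerZ lagr_node eq_sym (negbTE ji) mulr0.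
Qed.

Let rs := [seq y i | i <- enum 'I_n].

Lemma uniq_nodes : uniq rs.
Proof. by rewrite map_inj_uniq ?enum_uniq. Qed.

Lemma linterp_id q : (size q <= n)%N -> linterp y (horner q) = q.
Proof.
move=> sq; apply/eqP; rewrite -subr_eq0; apply/negPn/negP => r0.
have := @max_poly_roots _ _ rs r0.
rewrite size_map size_enum_ord uniq_nodes => /(_ _ isT).
have -> : all (root (linterp y (horner q) - q)) rs.
  apply/allP => _ /mapP[i _ ->]; rewrite /root hornerD hornerN linterp_node.
  by rewrite subrr.
move=> /(_ isT); rewrite ltnNge (leq_trans (size_polyD _ _))//.
by rewrite geq_max size_linterp size_polyN sq.
Qed.

Section quadrature.
Variables (a b : R).
Hypotheses (a1 : -1 < a) (b1 : -1 < b).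
Hypothesis yroot : forall i, root (shifted_jacobi a b n) (y i).

Definition gauss_weight j := pint a b (lagr y j).

(** The difference of q and its interpolant vanishes at all zeros of J_n, hence is J_n times a
    polynomial of degree below n, to which J_n is orthogonal. *)
Lemma gauss_quadrature q : (size q <= n + n)%N ->
  pint a b q = \sum_(j < n) gauss_weight j * q.[y j].
Proof.
move=> sq; set p := linterp y (horner q).
have pE : pint a b p = \sum_(j < n) gauss_weight j * q.[y j].
  rewrite /p /linterp pint_sum//; apply: eq_bigr => j _.
  by rewrite pintZ// mulrC.
rewrite -pE; apply/eqP; rewrite -subr_eq0 -pintN// -pintD//; apply/eqP.
set J := shifted_jacobi a b n.
have sJ : size J = n.+1 by exact: size_shifted_jacobi.
have urs : uniq_roots rs by rewrite uniq_rootsE uniq_nodes.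
have JE : J = lead_coef J *: \prod_(z <- rs) ('X - z%:P).
  apply: all_roots_prod_XsubC => //; first by rewrite sJ size_map size_enum_ord.
  by apply/allP => _ /mapP[i _ ->]; exact: yroot.
have lJ : lead_coef J != 0 by rewrite lead_coef_eq0 -size_poly_eq0 sJ.
have [u uE] : exists u, q - p = u * \prod_(z <- rs) ('X - z%:P).
  apply: uniq_roots_prod_XsubC => //; apply/allP => _ /mapP[i _ ->].
  by rewrite /root hornerD hornerN linterp_node subrr.
have {}uE : q - p = J * ((lead_coef J)^-1 *: u).
  have -> : J * ((lead_coef J)^-1 *: u) = u * ((lead_coef J)^-1 *: J).
    by rewrite -scalerAr -scalerAr mulrC.
  by rewrite uE [X in _ = _ * (_ *: X)]JE scalerA mulVf// scale1r.
rewrite uE shifted_jacobi_orth//.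
have [->|u0] := eqVneq u 0; first by rewrite scaler0 size_poly0.
have v0 : (lead_coef J)^-1 *: u != 0 by rewrite scaler_eq0 invr_eq0 negb_or lJ.
have := size_mul (_ : J != 0) v0; rewrite -size_poly_eq0 sJ => /(_ isT).
rewrite -uE addSn/= => sE.
have : (size (q - p)%R <= n + n)%N.
  rewrite (leq_trans (size_polyD _ _))// geq_max sq size_polyN.
  by rewrite (leq_trans (size_linterp _ _))// leq_addr.
by rewrite sE leq_add2l.
Qed.

(** The square of [lagr y j] is within the range of exactness, and its Gauss sum is the single
    weight j. *)
Lemma gauss_weight_ge0 j : 0 <= gauss_weight j.
Proof.
have sz : (size (lagr y j * lagr y j)%R <= n + n)%N.
  rewrite (leq_trans (size_polyMleq _ _))//.
  by have := size_lagr y j; lia.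
have := gauss_quadrature sz; rewrite (bigD1 j)//= big1 => [|i ij].
  by rewrite hornerM lagr_node eqxx !mulr1 addr0 => <-; exact: pint_sqr_ge0.
by rewrite hornerM lagr_node (negbTE ij) !mulr0.
Qed.

Lemma pint_linterp_sqr f : pint a b (linterp y f * linterp y f) =
  \sum_(j < n) gauss_weight j * f (y j) ^+ 2.
Proof.
rewrite gauss_quadrature; last first.
  rewrite (leq_trans (size_polyMleq _ _))//.
  by have := size_linterp y f; lia.
by apply: eq_bigr => j _; rewrite hornerM linterp_node expr2.
Qed.

End quadrature.
End nodes.
End GaussQuadrature.

(** * Sampling and sup norm inequalities *)

Section Intervals.
Variable R : realType.
Notation mu := (@lebesgue_measure R).
Implicit Types (f : R -> R) (a b c d s t x y : R) (e : {poly R}).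

Lemma integrable_bdd01 f : bdd f -> mu.-integrable `]0, 1[ (EFin \o f).
Proof.
move=> bf; have z1 : -1 < 0 :> R by rewrite ltrN10.
apply: eq_integrable (integrable_bdd z1 z1 bf) => // x _.
by rewrite /= /weight !powRr0 !mulr1.
Qed.

Lemma subset_oo01 c d : 0 <= c -> d <= 1 ->
  (`]c, d[ : set R) `<=` (`]0, 1[ : set R).
Proof. by move=> c0 d1; apply: subset_itvW. Qed.

Lemma Rintegral_oo_split f c d r : c <= r -> r <= d ->
  mu.-integrable `]c, d[ (EFin \o f) ->
  \int[mu]_(x in `]c, d[) f x =
  \int[mu]_(x in `]c, r[) f x + \int[mu]_(x in `]r, d[) f x.
Proof.
move=> cr; rewrite le_eqVlt => /predU1P[-> _|rd intf].
  by rewrite [X in _ + X](_ : _ = 0) ?addr0// set_itvoo0 Rintegral_set0.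
rewrite (@Rintegral_itv_bndo_bndc _ _ r); last first.
  apply: integrableS intf => //; apply: subset_itvl.
  by rewrite bnd_simp ltW.
by rewrite -(@Rintegral_itvB _ f (BRight c) (BLeft d) r intf)// addrC subrK.
Qed.

(* A value of [e] exceeds its mean by at most the total variation. *)
Lemma sample_le e c d x : 0 <= c -> c < d -> d <= 1 -> c <= x -> x <= d ->
  e.[x] * (d - c) <= \int[mu]_(t in `]c, d[) e.[t] +
    (d - c) * \int[mu]_(t in `]c, d[) `|e^`().[t]|.
Proof.
move=> c0 cd d1 cx xd.
set B := \int[mu]_(t in `]c, d[) `|e^`().[t]|.
have sub (p q : R) : 0 <= p -> q <= 1 -> forall f, bdd f ->
    mu.-integrable `]p, q[ (EFin \o f).
  move=> p0 q1 f bf; apply: integrableS (integrable_bdd01 bf) => //.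
  exact: subset_oo01.
have FTC (p q : R) : 0 <= p -> p < q -> q <= 1 ->
    \int[mu]_(t in `]p, q[) e^`().[t] = e.[q] - e.[p].
  move=> p0 pq q1; apply: Rintegral_oo_FTC => //.
  - by move=> t _; exact: continuous_horner.
  - by apply: continuous_subspaceT; exact: continuous_horner.
  - by apply: sub => //; exact: bdd_horner.
have bd := bdd_horner e^`().
have var (p q : R) : c <= p -> p < q -> q <= d -> `|e.[q] - e.[p]| <= B.
  move=> cp pq qd.
  have p0 : 0 <= p := le_trans c0 cp.
  have q1 : q <= 1 := le_trans qd d1.
  rewrite -FTC//.
  have intb := sub _ _ p0 q1 _ bd.
  apply: (le_trans (le_normr_Rintegral _ intb)) => //.
  apply: Rintegral_subset => //; first by apply: subset_itvW.
  exact: (integrable_norm (sub _ _ c0 d1 _ bd)).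
have var' t : c <= t -> t <= d -> e.[x] <= e.[t] + B.
  move=> ct td; rewrite addrC -lerBlDr.
  case: (ltgtP t x) => [tx|xt|->].
  - by rewrite (le_trans (ler_norm _))// var.
  - by rewrite (le_trans (ler_norm _))// distrC var.
  - by rewrite subrr; apply: Rintegral_ge0 => ? _; exact: normr_ge0.
have intc (k : R) : mu.-integrable `]c, d[ (EFin \o cst k).
  by apply: sub => //; exact: bdd_cst.
have cstE (k : R) : \int[mu]_(t in `]c, d[) (cst k t) = k * (d - c).
  by rewrite Rintegral_cst//= lebesgue_measure_itv/= lte_fin cd.
have inte := sub _ _ c0 d1 _ (bdd_horner e).
rewrite -cstE (mulrC (d - c)) -cstE -RintegralD//.
apply: le_Rintegral => //; first exact: (integrableD _ inte (intc B)).
move=> t /=; rewrite in_itv/= => /andP[ct td].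
by apply: var'; exact: ltW.
Qed.

End Intervals.

(** * Pointwise values bounded by weighted energies *)

Section EnergyBounds.
Variable R : realType.
Notation mu := (@lebesgue_measure R).
Implicit Types (a b c d t x m A B : R) (e : {poly R}).

(* With [k = w_{a+1/2,b+1/2}] one has [k ^ 2 = w_{a,b} w_{a+1,b+1}]. *)
Lemma deriv_sqr_amgm a b m e t : 0 < m -> 0 < t -> t < 1 ->
  `|(e * e)^`().[t]| * weight (a + 2^-1) (b + 2^-1) t <=
  m * ((e * e).[t] * weight a b t) +
  m^-1 * ((e^`() * e^`()).[t] * weight (a + 1) (b + 1) t).
Proof.
move=> m0 t0 t1.
have W0 := weight_gt0 a b t0 t1.
have k0 := weight_gt0 (a + 2^-1) (b + 2^-1) t0 t1.
have kk : weight (a + 2^-1) (b + 2^-1) t ^+ 2 = weight a b t * weight (a + 1) (b + 1) t.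
  by rewrite expr2 !weightM//; congr (weight _ _ _); field.
rewrite derivM hornerD !hornerM.
move: (weight (a + 2^-1) (b + 2^-1) t) (weight (a + 1) (b + 1) t) (weight a b t)
  k0 kk W0 => k W1 W k0 kk W0.
have WE : W1 = k ^+ 2 / W by rewrite kk mulrAC divff ?mul1r ?gt_eqF.
move: (e.[t]) (e^`().[t]) => u v.
have -> : `|v * u + u * v| = 2 * (`|u| * `|v|).
  by rewrite [v * u]mulrC -mulr2n normrMn normrM mulr_natl.
rewrite -[u * u]/(u ^+ 2) -[v * v]/(v ^+ 2) -(real_normK (num_real u)).
rewrite -(real_normK (num_real v)) -subr_ge0 WE.
have -> : m * (`|u| ^+ 2 * W) + m^-1 * (`|v| ^+ 2 * (k ^+ 2 / W)) -
    2 * (`|u| * `|v|) * k = (m * W * `|u| - k * `|v|) ^+ 2 / (m * W).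
  by field; rewrite !gt_eqF.
by rewrite divr_ge0 ?sqr_ge0// mulr_ge0// ltW.
Qed.

(** This is [sample_le] for e^2: the mean is compared with the w_{a,b} integral through A, the
    variation passes through [deriv_sqr_amgm] and B. The free parameter m is later set to the
    degree. *)
Lemma sample_sqr_le a b e c d x m A B : -1 < a -> -1 < b -> 0 < m ->
  0 <= c -> c < d -> d <= 1 -> c <= x -> x <= d -> 0 <= A -> 0 <= B ->
  (forall t, c < t -> t < d -> 1 <= A * weight a b t) ->
  (forall t, c < t -> t < d -> 1 <= B * weight (a + 2^-1) (b + 2^-1) t) ->
  e.[x] ^+ 2 * (d - c) <=
    (A + (d - c) * B * m) *
      \int[mu]_(t in `]c, d[) ((e * e).[t] * weight a b t) +
    (d - c) * B * m^-1 *
      \int[mu]_(t in `]c, d[) ((e^`() * e^`()).[t] * weight (a + 1) (b + 1) t).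
Proof.
move=> a1 b1 m0 c0 cd d1 cx xd A0 B0 hA hB.
have a2 : -1 < a + 1 by lra.
have b2 : -1 < b + 1 by lra.
have sub01 : (`]c, d[ : set R) `<=` (`]0, 1[ : set R) by exact: subset_oo01.
have in01 t : c < t -> t < d -> 0 < t /\ t < 1.
  by move=> ct td; split; [exact: le_lt_trans ct|exact: lt_le_trans d1].
have sub f : bdd f -> mu.-integrable `]c, d[ (EFin \o f).
  by move=> bf; apply: integrableS (integrable_bdd01 bf).
have subw a' b' p : -1 < a' -> -1 < b' ->
    mu.-integrable `]c, d[ (EFin \o (fun t => p.[t] * weight a' b' t)).
  move=> ha hb.
  by apply: integrableS (integrable_bdd ha hb (bdd_horner p)).
have dc : 0 <= d - c by lra.
rewrite expr2 -hornerM; apply: (le_trans (sample_le (e * e) c0 cd d1 cx xd)).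
set I0 := (X in (A + _) * X); set I1 := (X in _ + _ * _ * m^-1 * X).
rewrite [(A + _) * _]mulrDl -addrA; apply: lerD.
  rewrite /I0 -RintegralZl//; last exact: subw.
  apply: le_Rintegral => //.
  - exact/sub/bdd_horner.
  - by apply: (integrableZl _ A (subw _ _ _ a1 b1)) => //.
  - move=> t /=; rewrite in_itv/= => /andP[ct td].
    rewrite mulrCA ler_peMr//; last exact: hA.
    by rewrite hornerM -expr2 sqr_ge0.
rewrite -!mulrA -mulrDr ler_wpM2l// -mulrDr.
have -> : m * I0 = \int[mu]_(t in `]c, d[) (m * ((e * e).[t] * weight a b t)).
  by rewrite RintegralZl//; exact: subw.
have -> : m^-1 * I1 = \int[mu]_(t in `]c, d[)
    (m^-1 * ((e^`() * e^`()).[t] * weight (a + 1) (b + 1) t)).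
  by rewrite RintegralZl//; exact: subw.
have iG : mu.-integrable `]c, d[ (EFin \o (fun t =>
    m * ((e * e).[t] * weight a b t) +
    m^-1 * ((e^`() * e^`()).[t] * weight (a + 1) (b + 1) t))).
  apply: (integrableD _ (integrableZl _ m (subw _ _ _ a1 b1))
     (integrableZl _ m^-1 (subw _ _ _ a2 b2))) => //.
rewrite -RintegralD//; last 2 first.
- by apply: (integrableZl _ m (subw _ _ _ a1 b1)).
- by apply: (integrableZl _ m^-1 (subw _ _ _ a2 b2)).
rewrite -RintegralZl//; apply: le_Rintegral => //.
- by apply: integrable_norm => //; exact/sub/bdd_horner.
- by apply: (integrableZl _ B iG).
move=> t /=; rewrite in_itv/= => /andP[ct td].
have [t0 t1] := in01 _ ct td.
apply: (le_trans _ (ler_wpM2l B0 (deriv_sqr_amgm a b e m0 t0 t1))).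
by rewrite mulrCA ler_peMr// hB.
Qed.

Lemma sup_sqr_le a b e x m : -1 < a -> a <= - 2^-1 -> -1 < b -> b <= - 2^-1 ->
  0 < m -> 0 <= x -> x <= 1 ->
  e.[x] ^+ 2 <= (1 + m) * pint a b (e * e) +
    m^-1 * pint (a + 1) (b + 1) (e^`() * e^`()).
Proof.
move=> a1 a2 b1 b2 m0 x0 x1.
have ge1 a' b' t : a' <= 0 -> b' <= 0 -> 0 < t -> t < 1 -> 1 <= 1 * weight a' b' t.
  move=> ha hb t0 t1; rewrite mul1r -[leLHS]mulr1 ler_pM//.
    by apply: powR_ge1 => //; lra.
  by apply: powR_ge1 => //; lra.
have := @sample_sqr_le a b e 0 1 x m 1 1 a1 b1 m0 (lexx _) ltr01 (lexx _) x0 x1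
  ler01 ler01.
rewrite !subr0 !mulr1 !mul1r; apply.
- by move=> t t0 t1; apply: ge1 => //; lra.
- by move=> t t0 t1; apply: ge1 => //; lra.
Qed.

End EnergyBounds.

(** * Chebyshev peaks *)

Section Trigonometry.
Variable R : realType.
Implicit Types (u v x y th ph : R).

Lemma sinB_le u v : `|sin u - sin v| <= `|u - v|.
Proof.
wlog uv : u v / u < v => [H|].
  case: (ltgtP u v) => [/H//|/H|->]; first by rewrite distrC (distrC u).
  by rewrite !subrr.
have dsin x : x \in `]u, v[ -> is_derive x 1 sin (cos x) by move=> _; exact: is_derive_sin.
have csin : {within `[u, v], continuous (@sin R)}.
  by apply: continuous_subspaceT; exact: continuous_sin.
have [c _ E] := MVT uv dsin csin.
by rewrite distrC E (distrC u) normrM ler_piMl// cos_max.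
Qed.

Lemma normr_sin_le x : `|sin x| <= `|x|.
Proof. by have := sinB_le x 0; rewrite sin0 !subr0. Qed.

(** By the mean value theorem sin u >= u cos u, so with u = x/2, sin x = 2 sin u cos u >= x
    cos(u)^2, and 2 cos(u)^2 = 1 + cos x >= 1. *)
Lemma sin_ge_half x : 0 <= x -> x <= pi / 2 -> x / 2 <= sin x.
Proof.
rewrite le_eqVlt => /predU1P[<- _|x0 xpi]; first by rewrite mul0r sin0.
have p0 := pi_gt0 R.
pose u := x / 2; have u0 : 0 < u by rewrite /u; lra.
have dsin t : t \in `]0, u[ -> is_derive t 1 sin (cos t) by move=> _; exact: is_derive_sin.
have csin : {within `[0, u], continuous (@sin R)}.
  by apply: continuous_subspaceT; exact: continuous_sin.
have [c cu E] := MVT u0 dsin csin.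
have cos_u : cos u <= cos c.
  move: cu; rewrite in_itv/= => /andP[c0 cu].
  by rewrite ltW// ltr_cos// in_itv/=; rewrite /u in cu *; lra.
have sin_u : u * cos u <= sin u.
  by move: E; rewrite sin0 !subr0 => ->; rewrite mulrC ler_wpM2r// ltW.
have cu0 : 0 <= cos u by apply: cos_ge0_pihalf; rewrite /u; lra.
have cx0 : 0 <= cos x by apply: cos_ge0_pihalf; lra.
have xE : x = u *+ 2 by rewrite /u; field.
have -> : sin x = 2 * (cos u * sin u) by rewrite xE sin_mulr2n mulr_natl.
have ccu : 1 <= 2 * cos u ^+ 2.
  by move: cx0; rewrite xE cos_mulr2n; lra.
apply: (@le_trans _ _ (2 * (cos u * (u * cos u)))); last first.
  by rewrite ler_pM2l// ler_wpM2l.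
rewrite -/u (_ : 2 * _ = u * (2 * cos u ^+ 2)); last by ring.
by rewrite ler_peMr// ltW.
Qed.

Lemma sin_cos_ge1 x : 0 <= x -> x <= pi / 2 -> 1 <= sin x + cos x.
Proof.
move=> x0 xpi; have p0 := pi_gt0 R.
have s0 : 0 <= sin x by apply: sin_ge0_pi; lra.
have c0 : 0 <= cos x by apply: cos_ge0_pihalf; lra.
have E := cos2Dsin2 x; have := cos_le1 x; have := sin_le1 x; nra.
Qed.

Lemma sin_double u : sin u = 2 * sin (u / 2) * cos (u / 2).
Proof.
rewrite [in LHS](_ : u = (u / 2) *+ 2); last by field.
by rewrite sin_mulr2n -mulr_natl; ring.
Qed.

(** With s, c for th/2 and s', c' for ph/2: sin ph = 2 s' c' <= 2 (s + c) s' c' <= 2 (s c' + c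
    s'). *)
Lemma sin_le_mid th ph : 0 <= th -> th <= pi -> 0 <= ph -> ph <= pi ->
  sin ph <= 2 * sin ((th + ph) / 2).
Proof.
move=> t0 tpi p0 ppi.
rewrite sin_double (_ : (th + ph) / 2 = th / 2 + ph / 2) ?mulrDl// sinD.
have P := pi_gt0 R.
have h1 : 1 <= sin (th / 2) + cos (th / 2) by apply: sin_cos_ge1; lra.
have s1 : 0 <= sin (th / 2) by apply: sin_ge0_pi; lra.
have c1 : 0 <= cos (th / 2) by apply: cos_ge0_pihalf; lra.
have s2 : 0 <= sin (ph / 2) by apply: sin_ge0_pi; lra.
have c2 : 0 <= cos (ph / 2) by apply: cos_ge0_pihalf; lra.
have := sin_le1 (ph / 2); have := cos_le1 (ph / 2).
move: (sin (th / 2)) (cos (th / 2)) (sin (ph / 2)) (cos (ph / 2)) h1 s1 c1 s2 c2.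
move=> s c s' c' h1 s0 c0 s0' c0' cl sl.
have : s' * c' <= (s + c) * (s' * c') by rewrite ler_peMl// mulr_ge0.
have : s * (s' * c') <= s * c' by rewrite ler_wpM2l// ler_piMl.
have : c * (s' * c') <= c * s' by rewrite ler_wpM2l// ler_piMr.
lra.
Qed.

Lemma cos_diff th ph : cos ph - cos th = 2 * sin ((th + ph) / 2) * sin ((th - ph) / 2).
Proof.
set u := (th + ph) / 2; set v := (th - ph) / 2.
have -> : cos ph = cos (u - v) by congr cos; rewrite /u /v; field.
have -> : cos th = cos (u + v) by congr cos; rewrite /u /v; field.
by rewrite cosB cosD; ring.
Qed.

End Trigonometry.

(** * Chebyshev cells and the peak polynomial of a cell *)

Section Chebyshev.
Variable R : realType.
Implicit Types (u v x y t th ph : R) (m k : nat).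

Fixpoint cheb2 m : {poly R} * {poly R} :=
  if m is m'.+1 then
    let: (p, q) := cheb2 m' in (q, 2 *: ((1 - 2 *: 'X) * q) - p)
  else (1, 1 - 2 *: 'X).

(* The Chebyshev polynomial in the variable [t = (1 - cos th) / 2]. *)
Definition cheb m := (cheb2 m).1.

Lemma cheb2E m : cheb2 m = (cheb m, cheb m.+1).
Proof. by rewrite /cheb /=; case: (cheb2 m). Qed.

Lemma chebSS m : cheb m.+2 = 2 *: ((1 - 2 *: 'X) * cheb m.+1) - cheb m.
Proof. by rewrite [in LHS]/cheb /= cheb2E. Qed.

Lemma cheb_cos m th : (cheb m).[(1 - cos th) / 2] = cos (m%:R * th).
Proof.
suff : (cheb m).[(1 - cos th) / 2] = cos (m%:R * th) /\
       (cheb m.+1).[(1 - cos th) / 2] = cos (m.+1%:R * th) by case.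
elim: m => [|m [IH0 IH1]].
  rewrite /cheb/= mul0r mul1r cos0 hornerC; split => //.
  by rewrite !(hornerD, hornerN, hornerZ, hornerX, hornerC); field.
split => //; rewrite chebSS !(hornerD, hornerN, hornerZ, hornerM, hornerX, hornerC).
rewrite IH0 IH1 (_ : m.+2%:R * th = m.+1%:R * th + th); last by rewrite -[m.+2%:R]natr1; ring.
rewrite (_ : m%:R * th = m.+1%:R * th - th); last by rewrite -[m.+1%:R]natr1; ring.
by rewrite cosB cosD; field.
Qed.

Lemma size_cheb m : (size (cheb m) <= m.+1)%N.
Proof.
have s1 : (size (1 - 2 *: 'X : {poly R})%R <= 2)%N.
  rewrite (leq_trans (size_polyD _ _))// geq_max size_poly1 size_polyN.
  by rewrite (leq_trans (size_scale_leq _ _))// size_polyX.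
suff : (size (cheb m) <= m.+1)%N /\ (size (cheb m.+1) <= m.+2)%N by case.
elim: m => [|m [IH0 IH1]]; first by rewrite /cheb/= size_poly1.
split => //; rewrite chebSS (leq_trans (size_polyD _ _))// geq_max size_polyN.
rewrite (leq_trans IH0) ?andbT; last by lia.
rewrite (leq_trans (size_scale_leq _ _))// (leq_trans (size_polyMleq _ _))//.
by lia.
Qed.

(** In the angle variable the cells are equal arcs of length pi/m between consecutive extrema of
    T_m, and each zero sits at the midpoint of its arc. *)
Definition cheb_angle m k : R := (k%:R + 2^-1) * (pi / m%:R).
Definition cheb_node m k : R := (1 - cos (cheb_angle m k)) / 2.
Definition cheb_end m k : R := (1 - cos (k%:R * (pi / m%:R))) / 2.

Lemma cos_half_odd k : cos ((k%:R + 2^-1) * pi) = 0 :> R.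
Proof.
elim: k => [|k IH]; first by rewrite add0r mulrC cos_pihalf.
by rewrite -natr1 (_ : _ * pi = (k%:R + 2^-1) * pi + pi) ?cosDpi ?IH ?oppr0//; ring.
Qed.

(** Measured from a zero, |T_m| is the absolute sine of m times the angular distance, so its linear
    growth near that zero can be read off. *)
Lemma normr_cos_cheb m k th : (0 < m)%N ->
  `|cos (m%:R * th)| = `|sin (m%:R * (th - cheb_angle m k))|.
Proof.
move=> m0; have m0' : m%:R != 0 :> R by rewrite pnatr_eq0 -lt0n.
have -> : m%:R * th = m%:R * (th - cheb_angle m k) + (k%:R + 2^-1) * pi.
  by rewrite /cheb_angle; field.
have c0 := cos_half_odd k.
have s1 : `|sin ((k%:R + 2^-1) * pi)| = 1 :> R by apply/eqP; rewrite norm_sin_eq1 c0.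
by rewrite cosD c0 mulr0 sub0r normrN normrM s1 mulr1.
Qed.

(** Fills in the point t = y of bounds on T_m(t)/(t - y), which are first obtained after division by
    t - y. *)
Lemma horner_ge0_punctured (p : {poly R}) y d : y < d ->
  (forall t, y < t -> t < d -> 0 <= p.[t]) -> 0 <= p.[y].
Proof.
move=> yd H; have cp : p.[t] @[t --> y^'+] --> p.[y].
  by apply: cvg_at_right_filter; exact: continuous_horner.
apply: (cvgr_to_ge cp); near=> t; apply: H; last by near: t; exact: nbhs_right_lt.
by near: t; exact: nbhs_right_gt.
Unshelve. all: by end_near. Qed.

Section cell.
Variables (m k : nat).
Hypotheses (m0 : (0 < m)%N) (km : (k < m)%N).
Let ph := cheb_angle m k.
Let y := cheb_node m k.
(** The length scale of the cell: m h is the square root of y (1 - y), see [cheb_h_sqr], and the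
    cell has length at least h. *)
Let h := sin ph / (2 * m%:R).
Let dl : R := pi / m%:R.

Let pi0 : (0 : R) < pi. Proof. exact: pi_gt0. Qed.
Let pi2 : (2 : R) <= pi. Proof. exact: pi_ge2. Qed.
Let m0' : (0 : R) < m%:R. Proof. by rewrite ltr0n. Qed.
Let dl0 : 0 < dl. Proof. exact: divr_gt0. Qed.
Let dlm : m%:R * dl = pi. Proof. by rewrite /dl mulrC divfK// gt_eqF. Qed.
Let k0 : (0 : R) <= k%:R. Proof. exact: ler0n. Qed.
Let k1 : k%:R + 1 <= m%:R :> R. Proof. by rewrite natr1 ler_nat. Qed.

Lemma cheb_angle_bounds : dl / 2 <= ph /\ ph <= pi - dl / 2.
Proof.
have P := pi0; have D := dl0.
have e1 : 0 <= k%:R * dl by rewrite mulr_ge0// ltW.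
have e2 : (k%:R + 1) * dl <= m%:R * dl by rewrite ler_wpM2r// ltW.
by rewrite /ph /cheb_angle -/dl; move: e2; rewrite dlm; lra.
Qed.

Lemma sin_cheb_angle : dl / 4 <= sin ph.
Proof.
have P := pi0; have D := dl0.
have [p1 p2] := cheb_angle_bounds.
case: (leP ph (pi / 2)) => [p3|/ltW p3].
  apply: (@le_trans _ _ (ph / 2)); first by lra.
  by apply: sin_ge_half; lra.
have -> : sin ph = sin (pi - ph) by rewrite sinB sinpi cospi; ring.
apply: (@le_trans _ _ ((pi - ph) / 2)); first by lra.
by apply: sin_ge_half; lra.
Qed.

Lemma cheb_h_gt0 : 0 < h.
Proof.
rewrite /h divr_gt0 ?mulr_gt0//; apply: lt_le_trans sin_cheb_angle.
by rewrite divr_gt0.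
Qed.

Lemma cheb_angle_ph : 0 <= ph <= pi.
Proof. by have [] := cheb_angle_bounds; have := dl0; lra. Qed.

Lemma acos_halfE t : 0 <= t -> t <= 1 ->
  exists2 th, 0 <= th <= pi & t = (1 - cos th) / 2.
Proof.
move=> t0 t1; have h2 : -1 <= 1 - 2 * t <= 1 by lra.
exists (acos (1 - 2 * t)); first by rewrite acos_ge0// acos_lepi.
by rewrite acosK ?in_itv//=; field.
Qed.

Lemma cheb_dist th : 0 <= th <= pi ->
  `|(1 - cos th) / 2 - y| = sin ((th + ph) / 2) * `|sin ((th - ph) / 2)|.
Proof.
move=> /andP[t0 t1]; have /andP[p0 p1] := cheb_angle_ph.
have -> : (1 - cos th) / 2 - y = (cos ph - cos th) / 2.
  by rewrite /y /cheb_node -/ph; field.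
rewrite cos_diff !normrM [`|2^-1|]gtr0_norm// [`|2|]gtr0_norm//.
rewrite (@ger0_norm _ (sin ((th + ph) / 2))); last by apply: sin_ge0_pi; lra.
by field.
Qed.

(** In the product formula [cheb_dist] the first sine is at least sin ph / 2 by [sin_le_mid], and
    the second is at least |th - ph| / 4. *)
Lemma cheb_dist_ge th : 0 <= th <= pi ->
  `|th - ph| * sin ph <= 8 * `|(1 - cos th) / 2 - y|.
Proof.
move=> tpi; rewrite cheb_dist//; case/andP: tpi => t0 t1.
have /andP[p0 p1] := cheb_angle_ph.
have s1 := sin_le_mid t0 t1 p0 p1.
have s0 : 0 <= sin ph by apply: sin_ge0_pi; lra.
have s2 : `|th - ph| / 4 <= `|sin ((th - ph) / 2)|.
  wlog tp : / 0 <= (th - ph) / 2 => [H|].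
    have [|/ltW tp] := leP 0 ((th - ph) / 2); first exact: H.
    have -> : `|sin ((th - ph) / 2)| = sin (- ((th - ph) / 2)).
      rewrite sinN ler0_norm// -oppr_ge0 -sinN; apply: sin_ge0_pi; lra.
    rewrite ler0_norm; last by lra.
    by apply: le_trans (sin_ge_half _ _); lra.
  rewrite ger0_norm; last by lra.
  rewrite (le_trans _ (ler_norm _))//.
  by apply: le_trans (sin_ge_half _ _); lra.
have n0 : 0 <= `|th - ph| by [].
move: (`|th - ph|) (`|sin ((th - ph) / 2)|) s2 n0 => A B s2 n0.
move: (sin ((th + ph) / 2)) (sin ph) s1 s0 => S T s1 s0.
have : A * T <= (4 * B) * (2 * S) by apply: ler_pM => //; lra.
lra.
Qed.

Lemma cheb_dist_le th : 0 <= th <= pi -> `|th - ph| <= dl / 2 ->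
  `|(1 - cos th) / 2 - y| <= `|th - ph| * sin ph.
Proof.
move=> tpi tph; rewrite cheb_dist//; case/andP: tpi => t0 t1.
have s1 : `|sin ((th - ph) / 2)| <= `|th - ph| / 2.
  by rewrite (le_trans (normr_sin_le _))// normrM [`|2^-1|]gtr0_norm.
have s2 : sin ((th + ph) / 2) <= 2 * sin ph.
  have := sinB_le ((th + ph) / 2) ph.
  rewrite (_ : (th + ph) / 2 - ph = (th - ph) / 2); last by field.
  rewrite normrM [`|2^-1|]gtr0_norm// => /(le_trans (ler_norm _)).
  by have := sin_cheb_angle; lra.
have s0 : 0 <= sin ((th + ph) / 2).
  by have /andP[p0 p1] := cheb_angle_ph; apply: sin_ge0_pi; lra.
have -> : `|th - ph| * sin ph = (2 * sin ph) * (`|th - ph| / 2) by field.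
by rewrite ler_pM.
Qed.

Lemma cheb_node_bounds : 0 < y < 1.
Proof.
have s0 : 0 < sin ph by apply: lt_le_trans sin_cheb_angle; rewrite divr_gt0.
have := cos2Dsin2 ph; have : 0 < sin ph ^+ 2 by rewrite exprn_gt0.
rewrite /y /cheb_node -/ph; move: (cos ph) (sin ph ^+ 2) => c s.
nra.
Qed.

Lemma cheb_cell_angle t : cheb_end m k <= t -> t <= cheb_end m k.+1 ->
  exists th, [/\ 0 <= th <= pi, t = (1 - cos th) / 2 & `|th - ph| <= dl / 2].
Proof.
rewrite /cheb_end -/dl => t0 t1.
have P := pi0; have D := dl0.
have kd : 0 <= k%:R * dl by rewrite mulr_ge0// ltW.
have kd1 : k%:R * dl + dl <= pi.
  by rewrite -dlm -[X in _ + X]mul1r -mulrDl ler_wpM2r// ltW.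
have kS : k.+1%:R * dl = k%:R * dl + dl by rewrite -natr1; ring.
have c1 := cos_le1 (k%:R * dl); have c2 := cos_geN1 (k.+1%:R * dl).
have [|//|th /andP[th0 th1] tE] := @acos_halfE t; [lra|lra|].
exists th; split => //; first by rewrite th0.
have i1 : k%:R * dl \in `[0, pi] by rewrite in_itv/=; lra.
have i2 : k.+1%:R * dl \in `[0, pi] by rewrite in_itv/= kS; lra.
have i3 : th \in `[0, pi] by rewrite in_itv/= th0.
have lo : k%:R * dl <= th by rewrite leNgt -(ltr_cos i3 i1) -leNgt; lra.
have hi : th <= k.+1%:R * dl by rewrite leNgt -(ltr_cos i2 i3) -leNgt; lra.
rewrite /ph /cheb_angle -/dl ler_norml; move: hi; rewrite kS => hi.
by apply/andP; split; lra.
Qed.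

Lemma cheb_end_gt_node : y < cheb_end m k.+1.
Proof.
have P := pi0; have D := dl0.
have kd : 0 <= k%:R * dl by rewrite mulr_ge0// ltW.
have kd1 : k%:R * dl + dl <= pi.
  by rewrite -dlm -[X in _ + X]mul1r -mulrDl ler_wpM2r// ltW.
have kS : k.+1%:R * dl = k%:R * dl + dl by rewrite -natr1; ring.
rewrite /y /cheb_node /cheb_end -/dl -/ph.
suff : cos (k.+1%:R * dl) < cos ph by lra.
have [p1 p2] := cheb_angle_bounds.
rewrite ltr_cos ?in_itv/= ?kS.
- by rewrite /ph /cheb_angle -/dl; lra.
- by apply/andP; split; lra.
- by apply/andP; split; lra.
Qed.

(** The witness is L = h T_m(t)/(t - y). The bound |T_m| <= 1 gives the decay, |sin x| <= |x| with
    [cheb_dist_ge] gives |L| <= 4, and sin x >= x/2 with [cheb_dist_le] gives |L| >= 1/4 on the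
    cell. *)
Lemma cheb_peak : exists L : {poly R}, [/\ (size L <= m)%N,
  (forall t, 0 < t -> t < 1 -> L.[t] ^+ 2 * (t - y) ^+ 2 <= h ^+ 2),
  (forall t, 0 < t -> t < 1 -> L.[t] ^+ 2 <= 16) &
  (forall t, cheb_end m k <= t -> t <= cheb_end m k.+1 -> 1 <= 16 * L.[t] ^+ 2)].
Proof.
have ch t : 0 <= t -> t <= 1 -> exists th, [/\ 0 <= th <= pi, t = (1 - cos th) / 2 &
    (cheb m).[t] = cos (m%:R * th)].
  move=> t0 t1; have [th tpi tE] := acos_halfE t0 t1.
  by exists th; split => //; rewrite tE cheb_cos.
have /factor_theorem[Q QE] : root (cheb m) y.
  rewrite /root /y /cheb_node cheb_cos -/ph /ph /cheb_angle.
  rewrite (_ : _ * (_ * (_ / _)) = (k%:R + 2^-1) * pi) ?cos_half_odd//.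
  by field; rewrite gt_eqF.
have h0 := cheb_h_gt0; have /andP[y0 y1] := cheb_node_bounds.
have M0 := m0'.
have hE : sin ph = 2 * m%:R * h by rewrite /h mulrC divfK// gt_eqF// mulr_gt0.
exists (h *: Q).
have LE t : (h *: Q).[t] * (t - y) = h * (cheb m).[t].
  by rewrite QE hornerZ hornerM hornerXsubC mulrA.
have sQ : (size (h *: Q) <= m)%N.
  rewrite (leq_trans (size_scale_leq _ _))//; have := size_cheb m.
  have [->|Q0] := eqVneq Q 0; first by rewrite size_poly0.
  by rewrite QE size_Mmonic ?monicXsubC// size_XsubC addn2.
move: (h *: Q) LE sQ => {Q QE}L LE sL.
have nLE t : `|L.[t]| * `|t - y| = h * `|(cheb m).[t]|.
  by rewrite -normrM LE normrM gtr0_norm.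
have P2 t : 0 < t -> t < 1 -> t != y -> L.[t] ^+ 2 <= 16.
  move=> t0 t1 ty; have [th [thpi tE cE]] := ch _ (ltW t0) (ltW t1).
  have := cheb_dist_ge thpi; rewrite -tE hE => d1.
  have := nLE t; rewrite cE (normr_cos_cheb k _ m0) -/ph => E.
  have d2 := normr_sin_le (m%:R * (th - ph)).
  rewrite normrM [`|m%:R|]gtr0_norm// in d2.
  have ty0 : 0 < `|t - y| by rewrite normr_gt0 subr_eq0.
  have L4 : `|L.[t]| <= 4.
    rewrite -(ler_pM2r ty0) E.
    have : h * `|sin (m%:R * (th - ph))| <= h * (m%:R * `|th - ph|).
      by rewrite ler_wpM2l// ltW.
    lra.
  rewrite -(real_normK (num_real L.[t])) (_ : 16 = 4 ^+ 2); last by ring.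
  by rewrite lerXn2r// nnegrE.
have P3 t : cheb_end m k <= t -> t <= cheb_end m k.+1 -> t != y ->
    1 <= 16 * L.[t] ^+ 2.
  move=> t0 t1 ty; have [th [thpi tE thd]] := cheb_cell_angle t0 t1.
  have := cheb_dist_le thpi thd; rewrite -tE hE => d1.
  have := nLE t; rewrite tE cheb_cos -tE (normr_cos_cheb k _ m0) -/ph => E.
  have d2 : m%:R * `|th - ph| / 2 <= `|sin (m%:R * (th - ph))|.
    have -> : `|sin (m%:R * (th - ph))| = `|sin (m%:R * `|th - ph|)|.
      have [h'|h'] := leP 0 (th - ph); first by rewrite [`|th - ph|]ger0_norm.
      by rewrite [`|th - ph|]ltr0_norm// mulrN sinN normrN.
    apply: (le_trans _ (ler_norm _)); apply: sin_ge_half.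
      by rewrite mulr_ge0// ltW.
    by rewrite -dlm -mulrA ler_wpM2l// ltW.
  have ty0 : 0 < `|t - y| by rewrite normr_gt0 subr_eq0.
  have L4 : 1 <= 4 * `|L.[t]|.
    rewrite -(ler_pM2r ty0) -mulrA E mul1r.
    have : h * (m%:R * `|th - ph| / 2) <= h * `|sin (m%:R * (th - ph))|.
      by rewrite ler_wpM2l// ltW.
    lra.
  rewrite -(real_normK (num_real L.[t])).
  have : 1 ^+ 2 <= (4 * `|L.[t]|) ^+ 2 by rewrite lerXn2r// nnegrE//; lra.
  rewrite exprMn; lra.
split => //.
- move=> t t0 t1; have [th [_ tE cE]] := ch _ (ltW t0) (ltW t1).
  rewrite -exprMn LE exprMn ler_piMr ?sqr_ge0// cE.
  by rewrite -(real_normK (num_real (cos _))) exprn_ile1 ?cos_max.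
- move=> t t0 t1; have [ty|] := eqVneq t y; last exact: P2.
  have := @horner_ge0_punctured (16%:P - L ^+ 2) t 1 t1.
  rewrite !(hornerD, hornerN, horner_exp, hornerC) subr_ge0; apply=> u tu u1.
  rewrite !(hornerD, hornerN, horner_exp, hornerC) subr_ge0.
  by apply: P2 => //; [exact: lt_trans tu|rewrite -ty gt_eqF].
- move=> t t0 t1; have [ty|] := eqVneq t y; last exact: P3.
  have yk : t < cheb_end m k.+1 by rewrite ty cheb_end_gt_node.
  have := @horner_ge0_punctured (16%:P * L ^+ 2 - 1%:P) t _ yk.
  rewrite !(hornerD, hornerN, hornerM, horner_exp, hornerC) subr_ge0; apply=> u tu u1.
  rewrite !(hornerD, hornerN, hornerM, horner_exp, hornerC) subr_ge0.
  by apply: P3; [exact: le_trans (ltW tu)|exact: ltW|rewrite -ty gt_eqF].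
Qed.

Let sn := sin (ph / 2).
Let cs := cos (ph / 2).

Lemma half_angle u : (1 - cos u) / 2 = sin (u / 2) ^+ 2.
Proof.
rewrite [in cos u](_ : u = (u / 2) *+ 2); last by field.
by rewrite cos_mulr2n sin2cos2; field.
Qed.

Lemma cheb_half_bounds : dl / 8 <= sn /\ dl / 8 <= cs.
Proof.
have P := pi0; have D := dl0; have [p1 p2] := cheb_angle_bounds.
split; first by apply: (le_trans _ (sin_ge_half _ _)); lra.
have -> : cs = sin ((pi - ph) / 2).
  by rewrite mulrBl sinB sin_pihalf cos_pihalf -/cs; ring.
by apply: (le_trans _ (sin_ge_half _ _)); lra.
Qed.

Lemma cheb_nodeE : y = sn ^+ 2 /\ 1 - y = cs ^+ 2.
Proof. by rewrite /y /cheb_node -/ph half_angle -/sn [in 1 - _]sin2cos2 subKr. Qed.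

Lemma cheb_h_sqr : (m%:R * h) ^+ 2 = y * (1 - y).
Proof.
have [-> ->] := cheb_nodeE; rewrite /h sin_double -/sn -/cs.
by field; rewrite gt_eqF.
Qed.

(** From pi >= 2 and the half-angle bounds, 1/m <= 4 sn and 1/m <= 4 cs, so h = sn cs / m is at most
    4 sn^2 = 4 y and 4 cs^2 = 4 (1 - y). *)
Lemma cheb_h_le : h <= 4 * y /\ h <= 4 * (1 - y).
Proof.
have [-> ->] := cheb_nodeE; have [h1 h2] := cheb_half_bounds.
have D := dl0.
have s1 : sn <= 1 by exact: sin_le1.
have c1 : cs <= 1 by exact: cos_le1.
have M : m%:R^-1 <= 4 * (dl / 8).
  rewrite -(ler_pM2l m0') mulfV ?gt_eqF//.
  by have := pi2; rewrite -dlm; lra.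
have hE : h = sn * cs * m%:R^-1.
  by rewrite /h sin_double -/sn -/cs; field; rewrite gt_eqF.
have Mi : 0 <= m%:R^-1 :> R by rewrite invr_ge0 ltW.
have sc : sn * cs * m%:R^-1 <= sn * cs * (4 * (dl / 8)).
  by rewrite ler_wpM2l// mulr_ge0//; lra.
have D8 : 0 <= dl / 8 by lra.
have s0 : 0 <= sn by lra.
have c0 : 0 <= cs by lra.
have e1 : cs * (dl / 8) <= 1 * sn by apply: ler_pM.
have e2 : sn * (dl / 8) <= 1 * cs by apply: ler_pM.
have := ler_wpM2l s0 e1; have := ler_wpM2l c0 e2.
by rewrite hE; split; lra.
Qed.

(** The square root of t is sin(th/2); from the node to a point of the cell it changes by at most
    dl/4 <= 2 sn, so it is at most 3 sn, and squaring gives 9. The cosine is treated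
    symmetrically. *)
Lemma cheb_cell_le t : cheb_end m k <= t -> t <= cheb_end m k.+1 ->
  t <= 9 * y /\ 1 - t <= 9 * (1 - y).
Proof.
move=> t0 t1; have [th [/andP[th0 th1] tE thd]] := cheb_cell_angle t0 t1.
have P := pi0; have D := dl0.
have [-> ->] := cheb_nodeE; have [h1 h2] := cheb_half_bounds.
have half u v : `|u - v| <= dl / 2 -> `|u / 2 - v / 2| <= dl / 4.
  by rewrite -mulrBl normrM [`|2^-1|]gtr0_norm//; lra.
have q1 : sin (th / 2) <= 3 * sn.
  have := le_trans (ler_norm _) (le_trans (sinB_le (th / 2) (ph / 2)) (half _ _ thd)).
  by rewrite -/sn; lra.
have cE u : cos (u / 2) = sin ((pi - u) / 2).
  by rewrite mulrBl sinB sin_pihalf cos_pihalf; ring.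
have q2 : cos (th / 2) <= 3 * cs.
  have thd' : `|(pi - th) - (pi - ph)| <= dl / 2.
    by rewrite distrC (_ : _ - _ = th - ph)//; ring.
  have := le_trans (ler_norm _) (le_trans (sinB_le ((pi - th) / 2) ((pi - ph) / 2)) (half _ _ thd')).
  by rewrite -!cE -/cs; lra.
have r1 : 0 <= sin (th / 2) by apply: sin_ge0_pi; lra.
have r2 : 0 <= cos (th / 2) by apply: cos_ge0_pihalf; lra.
rewrite tE half_angle; split.
  rewrite (_ : 9 * _ = (3 * sn) ^+ 2); last by ring.
  by rewrite lerXn2r// nnegrE//; lra.
rewrite sin2cos2 subKr (_ : 9 * _ = (3 * cs) ^+ 2); last by ring.
by rewrite lerXn2r// nnegrE//; lra.
Qed.

Lemma cheb_cell_length : h <= cheb_end m k.+1 - cheb_end m k.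
Proof.
have P := pi0; have D := dl0; have M := m0'.
rewrite /cheb_end -/dl.
have -> : (1 - cos (k.+1%:R * dl)) / 2 - (1 - cos (k%:R * dl)) / 2 =
    sin ph * sin (dl / 2).
  rewrite (_ : _ - _ = (cos (k%:R * dl) - cos (k.+1%:R * dl)) / 2); last by field.
  rewrite cos_diff (_ : (k.+1%:R * dl + k%:R * dl) / 2 = ph); last first.
    by rewrite /ph /cheb_angle -/dl -natr1; field.
  rewrite (_ : (k.+1%:R * dl - k%:R * dl) / 2 = dl / 2); last first.
    by rewrite -natr1; field.
  by field.
have s0 : 0 <= sin ph by apply: le_trans sin_cheb_angle; rewrite divr_ge0// ltW.
have m1 : 1 <= m%:R :> R by rewrite ler1n.
have dp : dl <= pi by rewrite -dlm ler_peMl// ltW.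
rewrite /h ler_wpM2l//; apply: (le_trans _ (sin_ge_half _ _)); [|lra..].
rewrite -(ler_pM2l M) invfM mulrCA mulfV ?gt_eqF// mulr1.
have -> : m%:R * (dl / 2 / 2) = pi / 4 by rewrite -dlm; field.
by have := pi2; lra.
Qed.

End cell.

Lemma cheb_end0 m : cheb_end m 0 = 0.
Proof. by rewrite /cheb_end mul0r cos0 subrr mul0r. Qed.

Lemma cheb_endm m : (0 < m)%N -> cheb_end m m = 1.
Proof.
move=> m0; rewrite /cheb_end mulrCA divff ?pnatr_eq0 -?lt0n// mulr1 cospi.
by rewrite opprK divff.
Qed.

End Chebyshev.

(** * The weighted integral of a squared peak *)

Section PeakIntegral.
Variable R : realType.
Notation mu := (@lebesgue_measure R).
Implicit Types (a b c d h t u x y : R) (L : {poly R}).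

(** For an exponent in [-1, 0] the power C^(-b) is at most C, so a dilation of the argument costs at
    most its own factor. *)
Lemma powR_le_dilate (C : R) u t b : 1 <= C -> 0 < u -> 0 < t -> u <= C * t ->
  -1 <= b -> b <= 0 -> t `^ b <= C * u `^ b.
Proof.
move=> C1 u0 t0 ut b1 b0; have C0 : 0 < C by lra.
have H : u `^ (- b) <= C * t `^ (- b).
  apply: (@le_trans _ _ ((C * t) `^ (- b))).
    by apply: ge0_ler_powR; rewrite ?nnegrE ?mulr_ge0//; lra.
  rewrite (powRM _ (ltW C0) (ltW t0)) ler_wpM2r ?powR_ge0//.
  rewrite -[leRHS](powRr1 (ltW C0)); apply: ler_powR => //; lra.
have p1 : 0 < u `^ b by exact: powR_gt0.
have p2 : 0 < t `^ b by exact: powR_gt0.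
move: H; rewrite !powRN -(ler_pM2r p1) mulVf ?gt_eqF// mulrAC ler_pdivlMr// mul1r.
by [].
Qed.

Lemma within_continuous_powR p c : 0 < p -> 0 < c ->
  {within `[0, c], continuous (fun t => t `^ p)}.
Proof.
move=> p0 c0; apply/continuous_within_itvP => //; split.
- move=> x; rewrite in_itv/= => /andP[x0 _].
  exact: (is_derive_continuous (is_derive1_powR p x0)).
- by rewrite powR0 ?gt_eqF//; exact: powR_cvg0.
- by apply: cvg_at_left_filter; exact: (is_derive_continuous (is_derive1_powR p c0)).
Qed.

Lemma Rintegral_powR b c : -1 < b -> 0 < c -> c <= 1 ->
  \int[mu]_(t in `]0, c[) (t `^ b) = c `^ (b + 1) / (b + 1).
Proof.
move=> b1 c0 c1; have b2 : 0 < b + 1 by lra.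
pose F t := t `^ (b + 1) / (b + 1).
transitivity (F c - F 0); last by rewrite /F powR0 ?gt_eqF// mul0r subr0.
apply: Rintegral_oo_FTC => //.
- move=> x; rewrite in_itv/= => /andP[x0 _].
  exact: (is_derive_continuous (is_derive1_powR b x0)).
- move=> x; rewrite in_itv/= => /andP[x0 _].
  have := is_deriveM (is_derive1_powR (b + 1) x0) (is_derive_cst (b + 1)^-1 x 1).
  move/is_derive_eq; apply; rewrite /GRing.scale/= mulr0 add0r addrK.
  by rewrite mulrA mulVf ?gt_eqF// mul1r.
- move=> x; apply: cvgM; [exact: within_continuous_powR|exact: cvg_cst].
- by apply: integrableS (integrable_powR b1) => //; exact: subset_oo01.
Qed.

Lemma Rintegral_onem_powR a c : -1 < a -> 0 < c -> c <= 1 ->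
  \int[mu]_(t in `]1 - c, 1[) ((1 - t) `^ a) = c `^ (a + 1) / (a + 1).
Proof.
move=> a1 c0 c1; have a2 : 0 < a + 1 by lra.
have d1 : 1 - c < 1 by lra.
pose F t := - ((1 - t) `^ (a + 1) / (a + 1)).
transitivity (F 1 - F (1 - c)); last first.
  by rewrite /F subrr powR0 ?gt_eqF// mul0r oppr0 sub0r opprK subKr.
apply: Rintegral_oo_FTC => //.
- move=> x; rewrite in_itv/= => /andP[_ x1].
  exact: (is_derive_continuous (is_derive_onem_powR a x1)).
- move=> x; rewrite in_itv/= => /andP[_ x1].
  have := is_deriveN (is_deriveM (is_derive_onem_powR (a + 1) x1) (is_derive_cst (a + 1)^-1 x 1)).
  move/is_derive_eq; apply; rewrite /GRing.scale/= mulr0 add0r addrK.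
  by rewrite mulrN opprK mulrA mulVf ?gt_eqF// mul1r.
- move=> x; apply: cvgN; apply: cvgM; last exact: cvg_cst.
  move: x; apply/continuous_within_itvP => //; split.
  + move=> x; rewrite in_itv/= => /andP[_ x1].
    exact: (is_derive_continuous (is_derive_onem_powR _ x1)).
  + apply: cvg_at_right_filter.
    exact: (is_derive_continuous (is_derive_onem_powR _ d1)).
  + rewrite subrr powR0 ?gt_eqF//.
    exact: cvg_comp (@onem_cvg_at_left R) (powR_cvg0 a2).
- apply: integrableS (integrable_onem_powR a1) => //; apply: subset_oo01 => //; lra.
Qed.

(** An antiderivative is atan((t - y)/h), which is why the bound depends neither on the scale nor on
    the interval. *)
Lemma Rintegral_cauchy_kernel_le h y c d : 0 < h -> c < d ->
  mu.-integrable `]c, d[ (EFin \o (fun t => h / (h ^+ 2 + (t - y) ^+ 2))) /\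
  \int[mu]_(t in `]c, d[) (h / (h ^+ 2 + (t - y) ^+ 2)) <= pi.
Proof.
move=> h0 cd.
pose F t := atan ((t - y) / h).
pose f t := h / (h ^+ 2 + (t - y) ^+ 2).
have den t : 0 < h ^+ 2 + (t - y) ^+ 2 by rewrite ltr_wpDr ?sqr_ge0// exprn_gt0.
have dF t : is_derive t 1 F (f t).
  have dl : is_derive t 1 (fun t => (t - y) / h) (h^-1 : R).
    have : is_derive t 1 ((id - cst y) * cst h^-1) ((t - y) *: 0 + h^-1 *: (1 - 0) : R).
      by apply: is_deriveM.
    by rewrite scaler0 add0r subr0 /GRing.scale/= mulr1.
  have := @is_derive1_comp R atan (fun t => (t - y) / h) t _ _
    (is_derive1_atan ((t - y) / h)) dl.
  by move/is_derive_eq; apply; rewrite /f; field; rewrite !gt_eqF.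
have cf t : {for t, continuous f}.
  apply: cvgM; first exact: cvg_cst.
  apply: cvgV; first by rewrite gt_eqF.
  apply: cvgD; first exact: cvg_cst.
  apply: cvgM; apply: cvgB; (exact: cvg_id || exact: cvg_cst).
have cF : {within `[c, d], continuous F}.
  by apply: continuous_subspaceT => t; exact: is_derive_continuous (dF t).
have intf : mu.-integrable `]c, d[ (EFin \o f).
  apply: (@integrable_oo_ge0 R f F c d (pi / 2) cd) => //.
  - by move=> t _; rewrite divr_ge0// ltW.
  - move=> t _; rewrite ler_norml !ltW// ?atan_gtNpi2 ?atan_ltpi2//.
split=> //; have -> : \int[mu]_(t in `]c, d[) f t = F d - F c.
  by apply: Rintegral_oo_FTC.
have := atan_gtNpi2 ((c - y) / h); have := atan_ltpi2 ((d - y) / h); rewrite /F; lra.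
Qed.

Lemma le_Rintegral_scale (K c d : R) (f g : R -> R) :
  mu.-integrable `]c, d[ (EFin \o f) -> mu.-integrable `]c, d[ (EFin \o g) ->
  (forall t, c < t -> t < d -> f t <= K * g t) ->
  \int[mu]_(t in `]c, d[) f t <= K * \int[mu]_(t in `]c, d[) g t.
Proof.
move=> intf intg H; rewrite -RintegralZl//; apply: le_Rintegral => //.
  by apply: (integrableZl _ K intg).
by move=> t /=; rewrite in_itv/= => /andP[]; exact: H.
Qed.

Lemma powRN1_le t a : 3 / 4 <= t -> t <= 1 -> -1 <= a -> a <= 0 -> t `^ a <= 4 / 3.
Proof.
move=> t0 t1 a1 a0; have tp : 0 < t by lra.
apply: (@le_trans _ _ (t `^ (-1))); first by apply: ger_powR; rewrite ?tp.
by rewrite (powR_inv1 (ltW tp)) -(ler_pM2l tp) mulfV ?gt_eqF//; lra.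
Qed.

Lemma peak_far h y t (l : R) : 0 < y -> 3 / 4 * y <= `|t - y| ->
  l * (t - y) ^+ 2 <= h ^+ 2 -> l <= 16 / 9 * (h ^+ 2 / y ^+ 2).
Proof.
move=> y0 ty H; have [l0|l0] := leP 0 l; last first.
  by rewrite (le_trans (ltW l0))// mulr_ge0// divr_ge0 ?sqr_ge0.
have y2 : 0 < y ^+ 2 by rewrite exprn_gt0.
rewrite mulrA ler_pdivlMr//.
have d2 : 9 / 16 * y ^+ 2 <= (t - y) ^+ 2.
  rewrite -(real_normK (num_real (t - y))) (_ : 9 / 16 * _ = (3 / 4 * y) ^+ 2); last by field.
  by rewrite lerXn2r// nnegrE mulr_ge0// ltW.
have := ler_wpM2l l0 d2; lra.
Qed.

(** The factors on the left are L^2 at distance at least 3y/4 from y, the bounded factor of the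
    weight, and the mass of t^b on ]0, y/4[. Their product is at most 64/27 (h/y) h y^b / (b + 1),
    and h <= 4y turns the constant into 256/27 < 10. *)
Lemma far_mass_le h y b (c : R) : -1 < b -> b <= 0 -> 0 < y -> 0 < h -> h <= 4 * y ->
  c = y / 4 -> 16 / 9 * (h ^+ 2 / y ^+ 2) * (4 / 3) * (c `^ (b + 1) / (b + 1)) <=
  10 / (b + 1) * (h * y `^ b).
Proof.
move=> b1 b0 y0 h0 hy ->; have b2 : 0 < b + 1 by lra.
have q : (y / 4) `^ (b + 1) <= y * y `^ b.
  apply: (@le_trans _ _ (y `^ (b + 1))).
    by apply: ge0_ler_powR; rewrite ?nnegrE; lra.
  by rewrite (powRB1 (b + 1) y0) addrK.
have p0 : 0 < y `^ b by exact: powR_gt0.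
have -> : 10 / (b + 1) * (h * y `^ b) = 10 * (h * y `^ b) / (b + 1).
  by rewrite mulrAC.
rewrite [leLHS]mulrA; apply: ler_wpM2r; first by rewrite invr_ge0 ltW.
have K0 : 0 <= 16 / 9 * (h ^+ 2 / y ^+ 2) * (4 / 3).
  by have := divr_ge0 (sqr_ge0 h) (sqr_ge0 y); lra.
apply: (le_trans (ler_wpM2l K0 q)).
have -> : 16 / 9 * (h ^+ 2 / y ^+ 2) * (4 / 3) * (y * y `^ b) =
    64 / 27 * (h * y `^ b) * (h / y) by field; rewrite gt_eqF.
have hy4 : h / y <= 4 by rewrite ler_pdivrMr.
have hp : 0 <= 64 / 27 * (h * y `^ b) by rewrite mulr_ge0// mulr_ge0 ?ltW.
have := ler_wpM2l hp hy4; have : 0 <= h * y `^ b by rewrite mulr_ge0 ?ltW.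
lra.
Qed.

(** The two bounds on l add up to l (h^2 + (t - y)^2) <= 17 h^2, and the dilation by 4 at each
    endpoint costs a factor 4 in the weight. *)
Lemma peak_near a b y h t (l : R) : -1 < a -> a <= 0 -> -1 < b -> b <= 0 ->
  0 < y -> y < 1 -> 0 < h -> 0 < t -> t < 1 -> y <= 4 * t -> 1 - y <= 4 * (1 - t) ->
  0 <= l -> l * (t - y) ^+ 2 <= h ^+ 2 -> l <= 16 ->
  l * weight a b t <= 272 * (h * weight a b y) * (h / (h ^+ 2 + (t - y) ^+ 2)).
Proof.
move=> a1 a0 b1 b0 y0 y1 h0 t0 t1 yt yt' l0 H1 H2.
have den : 0 < h ^+ 2 + (t - y) ^+ 2 by rewrite ltr_wpDr ?sqr_ge0// exprn_gt0.
have e1 : l <= 17 * h * (h / (h ^+ 2 + (t - y) ^+ 2)).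
  rewrite mulrA ler_pdivlMr// mulrDr.
  by have := ler_wpM2r (sqr_ge0 h) H2; move: H1; rewrite !expr2; lra.
have e2 : weight a b t <= 16 * weight a b y.
  have f1 : t `^ b <= 4 * y `^ b by apply: powR_le_dilate => //; [lra|exact: ltW].
  have f2 : (1 - t) `^ a <= 4 * (1 - y) `^ a.
    by apply: powR_le_dilate => //; [lra|rewrite subr_gt0..|exact: ltW].
  apply: (le_trans (ler_pM (powR_ge0 _ _) (powR_ge0 _ _) f2 f1)).
  by rewrite /weight le_eqVlt; apply/orP; left; apply/eqP; ring.
apply: (le_trans (ler_pM l0 (ltW (weight_gt0 a b t0 t1)) e1 e2)).
by rewrite le_eqVlt; apply/orP; left; apply/eqP; ring.
Qed.

(* On the middle part [L ^ 2 <= 17 h ^ 2 / (h ^ 2 + (t - y) ^ 2)] and the weight is at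
   most [16] times its value at [y], whence [272 * pi]; the other two terms come
   from [t < y / 4] and [1 - t < (1 - y) / 4]. *)
Lemma peak_pint_le a b y h L : -1 < a -> a <= 0 -> -1 < b -> b <= 0 ->
  0 < y -> y < 1 -> 0 < h -> h <= 4 * y -> h <= 4 * (1 - y) ->
  (forall t, 0 < t -> t < 1 -> L.[t] ^+ 2 * (t - y) ^+ 2 <= h ^+ 2) ->
  (forall t, 0 < t -> t < 1 -> L.[t] ^+ 2 <= 16) ->
  pint a b (L * L) <=
    (272 * pi + 10 / (a + 1) + 10 / (b + 1)) * (h * weight a b y).
Proof.
move=> a1 a0 b1 b0 y0 y1 h0 hy hy' H1 H2.
have y1' : 0 < 1 - y by lra.
pose c := y / 4; pose d := 1 - (1 - y) / 4.
have intL := integrable_bdd a1 b1 (bdd_horner (L * L)).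
have c01 : 0 <= c /\ c <= 1 by rewrite /c; lra.
have cd : c < d by rewrite /c /d; lra.
have d01 : 0 <= d /\ d < 1 by rewrite /d; lra.
have w0 := weight_gt0 a b y0 y1.
have wa : (1 - y) `^ a <= weight a b y.
  by rewrite /weight ler_peMr ?powR_ge0//; apply: powR_ge1 => //; lra.
have wb : y `^ b <= weight a b y.
  by rewrite /weight ler_peMl ?powR_ge0//; apply: powR_ge1 => //; lra.
have sub p q : 0 <= p -> q <= 1 -> mu.-integrable `]p, q[
    (EFin \o (fun t => (L * L).[t] * weight a b t)).
  by move=> p0 q1; apply: integrableS intL => //; exact: subset_oo01.
have LL t : (L * L).[t] = L.[t] ^+ 2 by rewrite hornerM expr2.
have hw : 0 <= h * weight a b y by rewrite mulr_ge0 ?ltW.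
have left : \int[mu]_(t in `]0, c[) ((L * L).[t] * weight a b t) <=
    10 / (b + 1) * (h * weight a b y).
  apply: (@le_trans _ _ (10 / (b + 1) * (h * y `^ b))); last first.
    by rewrite ler_wpM2l ?divr_ge0 ?ler_wpM2l ?(ltW h0)//; lra.
  apply: le_trans (far_mass_le b1 b0 y0 h0 hy (erefl c)).
  have cp : 0 < c by rewrite divr_gt0.
  rewrite -(Rintegral_powR b1 cp c01.2); apply: le_Rintegral_scale.
  - exact: sub (lexx _) c01.2.
  - apply: integrableS (integrable_powR b1) => //; apply: subset_oo01 => //.
    exact: c01.2.
  move=> t t0; rewrite /c => tc; have t1 : t < 1 by lra.
  rewrite LL /weight mulrA -mulrA -[leRHS]mulrA.
  apply: ler_pM; rewrite ?sqr_ge0 ?mulr_ge0 ?powR_ge0//.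
    apply: (@peak_far h y t _ y0 _ (H1 t t0 t1)).
    by rewrite ltr0_norm; lra.
  by rewrite ler_wpM2r ?powR_ge0//; apply: powRN1_le; lra.
have right : \int[mu]_(t in `]d, 1[) ((L * L).[t] * weight a b t) <=
    10 / (a + 1) * (h * weight a b y).
  apply: (@le_trans _ _ (10 / (a + 1) * (h * (1 - y) `^ a))); last first.
    by rewrite ler_wpM2l ?divr_ge0 ?ler_wpM2l ?(ltW h0)//; lra.
  pose c' := (1 - y) / 4.
  apply: le_trans (far_mass_le a1 a0 y1' h0 hy' (erefl c')).
  have cp : 0 < c' by rewrite divr_gt0.
  have c1' : c' <= 1 by rewrite /c'; lra.
  rewrite -(Rintegral_onem_powR a1 cp c1'); apply: le_Rintegral_scale.
  - exact: sub d01.1 (lexx _).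
  - apply: integrableS (integrable_onem_powR a1) => //.
    by apply: subset_oo01 => //; exact: d01.1.
  move=> {left} t; rewrite /d => td t1; have t0 : 0 < t by lra.
  rewrite LL /weight -[leRHS]mulrA.
  apply: ler_pM; rewrite ?sqr_ge0 ?mulr_ge0 ?powR_ge0//.
    apply: (@peak_far h (1 - y) (1 - t) _ y1').
      by rewrite ltr0_norm; lra.
    rewrite (_ : 1 - t - (1 - y) = - (t - y)); last by ring.
    by rewrite sqrrN H1.
  by rewrite mulrC ler_wpM2r ?powR_ge0//; apply: powRN1_le; lra.
have mid : \int[mu]_(t in `]c, d[) ((L * L).[t] * weight a b t) <=
    272 * pi * (h * weight a b y).
  have [intk kle] := Rintegral_cauchy_kernel_le y h0 cd.
  have -> : 272 * pi * (h * weight a b y) = 272 * (h * weight a b y) * pi by ring.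
  have K0 : 0 <= 272 * (h * weight a b y) by rewrite mulr_ge0 ?ler0n.
  apply: le_trans (ler_wpM2l K0 kle); apply: le_Rintegral_scale => //.
    by apply: sub; [exact: c01.1|exact/ltW/d01.2].
  move=> {left right intk kle K0} t; rewrite /c /d => ct td.
  have t0 : 0 < t by lra.
  have t1 : t < 1 by lra.
  rewrite LL; apply: peak_near; rewrite ?sqr_ge0 ?H1 ?H2//; lra.
have D1 : d <= 1 by exact/ltW/d01.2.
rewrite /pint /wint (Rintegral_oo_split c01.1 c01.2 intL).
rewrite (Rintegral_oo_split (ltW cd) D1 (sub _ _ c01.1 (lexx _))).
have -> : (272 * pi + 10 / (a + 1) + 10 / (b + 1)) * (h * weight a b y) =
    10 / (b + 1) * (h * weight a b y) + (272 * pi * (h * weight a b y) +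
    10 / (a + 1) * (h * weight a b y)) by ring.
by apply: lerD => //; apply: lerD.
Qed.

End PeakIntegral.

(** * Gauss sums of squares bounded by integrals, cell by cell *)

Section GaussSampling.
Variable R : realType.
Notation mu := (@lebesgue_measure R).
Implicit Types (a b x y h : R) (e : {poly R}) (m k : nat) (s : nat -> R).

Lemma partition_le s m : (forall k, (k < m)%N -> s k <= s k.+1) ->
  forall i j, (i <= j)%N -> (j <= m)%N -> s i <= s j.
Proof.
move=> H i j; elim: j => [|j IH]; first by rewrite leqn0 => /eqP ->.
rewrite leq_eqVlt => /predU1P[->//|]; rewrite ltnS => ij jm.
by rewrite (le_trans (IH ij (ltnW jm)))// H.
Qed.

Lemma Rintegral_partition f s m : s 0%N = 0 -> s m = 1 ->
  (forall k, (k < m)%N -> s k <= s k.+1) -> mu.-integrable `]0, 1[ (EFin \o f) ->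
  \sum_(k < m) \int[mu]_(t in `]s k, s k.+1[) f t = \int[mu]_(t in `]0, 1[) f t.
Proof.
move=> s0 s1 sS intf; have sle := partition_le sS.
suff H j : (j <= m)%N -> \sum_(k < j) \int[mu]_(t in `]s k, s k.+1[) f t =
    \int[mu]_(t in `]0, s j[) f t by rewrite H// s1.
elim: j => [_|j IH jm]; first by rewrite big_ord0 s0 set_itvoo0 Rintegral_set0.
rewrite big_ord_recr/= IH ?(ltnW jm)//.
rewrite -(@Rintegral_oo_split R f 0 (s j.+1) (s j))//.
- by rewrite -s0 sle// ltnW.
- exact: sS.
- apply: integrableS intf => //; apply: subset_oo01 => //.
  by rewrite -s1 sle.
Qed.

Lemma partition_cell s m x : (0 < m)%N -> s 0%N <= x -> x <= s m ->
  exists2 k, (k < m)%N & s k <= x <= s k.+1.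
Proof.
move=> + s0; elim: m => // m IH _ xm.
have [mx|xm'] := leP (s m) x; first by exists m; rewrite ?mx.
have m0 : (0 < m)%N by case: m xm' {IH xm} => //; rewrite ltNge s0.
by have [k km H] := IH m0 (ltW xm'); exists k => //; exact: ltnW.
Qed.

Lemma weight_dilate a b x y : -1 <= a -> a <= 0 -> -1 <= b -> b <= 0 ->
  0 < x -> x < 1 -> 0 < y -> y < 1 -> x <= 9 * y -> 1 - x <= 9 * (1 - y) ->
  weight a b y <= 81 * weight a b x.
Proof.
move=> a1 a0 b1 b0 x0 x1 y0 y1 h1 h2.
have f1 : y `^ b <= 9 * x `^ b by apply: powR_le_dilate => //; rewrite ler1n.
have f2 : (1 - y) `^ a <= 9 * (1 - x) `^ a.
  by apply: powR_le_dilate => //; rewrite ?subr_gt0// ler1n.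
apply: (le_trans (ler_pM (powR_ge0 _ _) (powR_ge0 _ _) f2 f1)).
by rewrite /weight le_eqVlt; apply/orP; left; apply/eqP; ring.
Qed.

(** By [cheb_cell_le] the weights on the cell are at least 1/81 of their values at y, and
    w_{a+1/2,b+1/2}(y) = m h w_{a,b}(y). With A and B chosen accordingly in [sample_sqr_le], the
    values at y cancel and only h <= d - c is left to use. *)
Lemma cell_energy a b e m k x : -1 < a -> a <= - 2^-1 -> -1 < b -> b <= - 2^-1 ->
  (0 < m)%N -> (k < m)%N -> cheb_end R m k <= x -> x <= cheb_end R m k.+1 ->
  sin (cheb_angle R m k) / (2 * m%:R) * weight a b (cheb_node R m k) * e.[x] ^+ 2 <=
  81 * (2 * \int[mu]_(t in `]cheb_end R m k, cheb_end R m k.+1[)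
              ((e * e).[t] * weight a b t) +
        m%:R ^- 2 * \int[mu]_(t in `]cheb_end R m k, cheb_end R m k.+1[)
              ((e^`() * e^`()).[t] * weight (a + 1) (b + 1) t)).
Proof.
move=> a1 a2 b1 b2 m0 km kx xk.
set h := sin _ / _; set y := cheb_node R m k.
set I0 := \int[mu]_(t in _) (_ * weight a b t).
set I1 := \int[mu]_(t in _) (_ * weight (a + 1) (b + 1) t).
have h0 : 0 < h by exact: cheb_h_gt0.
have /andP[y0 y1] : 0 < y < 1 := cheb_node_bounds R m0 km.
have len : h <= cheb_end R m k.+1 - cheb_end R m k by exact: cheb_cell_length.
have M0 : 0 < m%:R :> R by rewrite ltr0n.
have cell t : cheb_end R m k <= t -> t <= cheb_end R m k.+1 ->
    t <= 9 * y /\ 1 - t <= 9 * (1 - y) by exact: cheb_cell_le.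
have e01 j : 0 <= cheb_end R m j <= 1.
  by rewrite /cheb_end; have := cos_le1 (j%:R * (pi / m%:R) : R);
    have := cos_geN1 (j%:R * (pi / m%:R) : R); lra.
have /andP[c0 _] := e01 k; have /andP[_ d1] := e01 k.+1.
have w0 : 0 < weight a b y by exact: weight_gt0.
have kE : weight (a + 2^-1) (b + 2^-1) y = m%:R * h * weight a b y.
  rewrite -weightM// mulrC; congr (_ * _).
  have -> : weight 2^-1 2^-1 y = ((1 - y) * y) `^ 2^-1.
    by rewrite powRM// ?subr_ge0 ltW.
  rewrite mulrC -(cheb_h_sqr R k m0) powR12_sqrt ?sqr_ge0//.
  by rewrite sqrtr_sqr ger0_norm// mulr_ge0 ?ltW.
have I00 : 0 <= I0.
  apply: Rintegral_ge0 => t _; rewrite hornerM -expr2 mulr_ge0 ?sqr_ge0//.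
  by rewrite mulr_ge0 ?powR_ge0.
have I10 : 0 <= I1.
  apply: Rintegral_ge0 => t _; rewrite hornerM -expr2 mulr_ge0 ?sqr_ge0//.
  by rewrite mulr_ge0 ?powR_ge0.
move: (cheb_end R m k) (cheb_end R m k.+1) len c0 d1 cell kx xk @I0 @I1 I00 I10.
move=> c d len c0 d1 cell kx xk I0 I1 I00 I10.
clearbody h y.
have cd : c < d by rewrite -subr_gt0 (lt_le_trans h0).
have A0 : 0 <= 81 / weight a b y by rewrite divr_ge0 ?ler0n// ltW.
have q0 : 0 < m%:R * h * weight a b y by exact: mulr_gt0 (mulr_gt0 M0 h0) w0.
have B0 : 0 <= 81 / (m%:R * h * weight a b y) by rewrite divr_ge0 ?ler0n// ltW.
have in01 t : c < t -> t < d -> [/\ 0 < t, t < 1, t <= 9 * y & 1 - t <= 9 * (1 - y)].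
  move=> ct td; have [h1 h2] := cell t (ltW ct) (ltW td).
  by split => //; [exact: le_lt_trans ct|exact: lt_le_trans d1].
have hA t : c < t -> t < d -> 1 <= 81 / weight a b y * weight a b t.
  move=> ct td; have [t0 t1 h1 h2] := in01 t ct td.
  rewrite mulrAC ler_pdivlMr// mul1r.
  by apply: weight_dilate => //; [exact: ltW|lra|exact: ltW|lra].
have hB t : c < t -> t < d ->
    1 <= 81 / (m%:R * h * weight a b y) * weight (a + 2^-1) (b + 2^-1) t.
  move=> ct td; have [t0 t1 h1 h2] := in01 t ct td.
  rewrite mulrAC ler_pdivlMr// mul1r -kE.
  by apply: weight_dilate => //; lra.
have H := @sample_sqr_le R a b e c d x m%:R _ _ a1 b1 M0 c0 cd d1 kx xk A0 B0 hA hB.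
have dc : 0 < d - c by rewrite subr_gt0.
rewrite -/I0 -/I1 in H; rewrite -(ler_pM2r dc) -[leLHS]mulrA.
apply: (le_trans (ler_wpM2l (ltW (mulr_gt0 h0 w0)) H)).
have -> : h * weight a b y *
  ((81 / weight a b y + (d - c) * (81 / (m%:R * h * weight a b y)) * m%:R) * I0 +
    (d - c) * (81 / (m%:R * h * weight a b y)) / m%:R * I1) =
  81 * (h * I0 + (d - c) * I0 + (d - c) * (m%:R ^- 2 * I1)).
  by field; rewrite !gt_eqF.
rewrite -[leRHS]mulrA ler_wpM2l ?ler0n//.
have -> : (2 * I0 + m%:R ^- 2 * I1) * (d - c) =
   (d - c) * I0 + (d - c) * I0 + (d - c) * (m%:R ^- 2 * I1) by ring.
exact: lerD (lerD (ler_wpM2r I00 len) (lexx _)) (lexx _).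
Qed.

Lemma size_sqr_le (p : {poly R}) n : (size p <= n)%N -> (size (p * p)%R <= n + n)%N.
Proof. by move=> sp; rewrite (leq_trans (size_polyMleq _ _))//; lia. Qed.

Definition peak_const a b : R := 272 * pi + 10 / (a + 1) + 10 / (b + 1).

Lemma peak_const_ge0 a b : -1 < a -> -1 < b -> 0 <= peak_const a b.
Proof.
move=> a1 b1; have a2 : 0 <= (a + 1)^-1 by rewrite invr_ge0; lra.
have b2 : 0 <= (b + 1)^-1 by rewrite invr_ge0; lra.
by have := pi_ge0 R; rewrite /peak_const; lra.
Qed.

Lemma gauss_sampling a b n (y : 'I_n -> R) e :
  -1 < a -> a <= - 2^-1 -> -1 < b -> b <= - 2^-1 -> (0 < n)%N -> injective y ->
  (forall i, 0 < y i < 1) -> (forall i, root (shifted_jacobi a b n) (y i)) ->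
  \sum_(j < n) gauss_weight y a b j * e.[y j] ^+ 2 <=
  16 * peak_const a b * 81 * 2 * (pint a b (e * e) +
    n%:R ^- 2 * pint (a + 1) (b + 1) (e^`() * e^`())).
Proof.
move=> a1 a2 b1 b2 n0 yinj y01 yr.
have w0 j : 0 <= gauss_weight y a b j by exact: gauss_weight_ge0.
pose s := cheb_end R n.
have sS k : (k < n)%N -> s k <= s k.+1.
  move=> kn; rewrite -subr_ge0; apply: le_trans (cheb_cell_length R n0 kn).
  exact/ltW/cheb_h_gt0.
have Q0 := peak_const_ge0 a1 b1.
pose I0 k := \int[mu]_(t in `]s k, s k.+1[) ((e * e).[t] * weight a b t).
pose I1 k := \int[mu]_(t in `]s k, s k.+1[)
  ((e^`() * e^`()).[t] * weight (a + 1) (b + 1) t).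
(* A node on a common end of two cells is counted in both, which only increases a sum of nonnegative
   terms. *)
pose c k j := (s k <= y j) && (y j <= s k.+1).
have step1 : \sum_(j < n) gauss_weight y a b j * e.[y j] ^+ 2 <=
    \sum_(k < n) \sum_(j < n | c k j) gauss_weight y a b j * e.[y j] ^+ 2.
  under [leRHS]eq_bigr do rewrite big_mkcond/=.
  rewrite exchange_big/=; apply: ler_sum => j _.
  have /andP[yj0 yj1] := y01 j.
  have [||k kn ck] := @partition_cell s n (y j) n0.
  - by rewrite /s cheb_end0 ltW.
  - by rewrite /s cheb_endm// ltW.
  rewrite (bigD1 (Ordinal kn))//= /c ck lerDl sumr_ge0// => i _.
  by case: ifP => // _; rewrite mulr_ge0 ?sqr_ge0.
apply: (le_trans step1).
have step2 (k : 'I_n) : \sum_(j < n | c k j) gauss_weight y a b j * e.[y j] ^+ 2 <=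
    16 * peak_const a b * 81 * (2 * I0 k + n%:R ^- 2 * I1 k).
  have kn := ltn_ord k; have [L [sL L1 L2 L3]] := cheb_peak R n0 kn.
  set h := sin _ / _ in L1; set v := cheb_node R n k in L1.
  have h0 : 0 < h by exact: cheb_h_gt0.
  have /andP[v0 v1] : 0 < v < 1 := cheb_node_bounds R n0 kn.
  have [hv hv'] : h <= 4 * v /\ h <= 4 * (1 - v) by exact: cheb_h_le.
  have wv0 : 0 < weight a b v by exact: weight_gt0.
  have hw0 : 0 < h * weight a b v by exact: mulr_gt0.
  have a3 : a <= 0 by lra.
  have b3 : b <= 0 by lra.
  have LI := peak_pint_le a1 a3 b1 b3 v0 v1 h0 hv hv' L1 L2.
  rewrite (gauss_quadrature yinj a1 b1 yr (size_sqr_le sL)) -/(peak_const a b) in LI.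
  have EE j := cell_energy (x := y j) e a1 a2 b1 b2 n0 kn.
  rewrite -/h -/v -/(I0 k) -/(I1 k) in EE.
  clearbody h v; move: (peak_const a b) Q0 LI => Q Q0 LI.
  rewrite -(ler_pM2l hw0) mulr_sumr.
  (* Each term of the cell may be multiplied by 16 L^2 >= 1; extending the sum to all nodes then
     produces the Gauss sum bounded in [LI]. *)
  apply: (@le_trans _ _ (\sum_(j < n | c k j) gauss_weight y a b j *
    (16 * (L * L).[y j]) * (81 * (2 * I0 k + n%:R ^- 2 * I1 k)))).
    apply: ler_sum => j /andP[c1 c2].
    have E := EE j c1 c2.
    rewrite mulrCA -mulrA ler_wpM2l//.
    apply: (le_trans E); rewrite ler_peMl//.
      by apply: le_trans E; rewrite mulr_ge0 ?sqr_ge0// ltW.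
    by rewrite hornerM -expr2; exact: L3.
  rewrite -mulr_suml.
  have P0 : 0 <= 81 * (2 * I0 k + n%:R ^- 2 * I1 k).
    rewrite mulr_ge0 ?ler0n// addr_ge0// mulr_ge0 ?invr_ge0 ?exprn_ge0 ?ler0n//.
      apply: Rintegral_ge0 => t _; rewrite hornerM -expr2 mulr_ge0 ?sqr_ge0//.
      by rewrite mulr_ge0 ?powR_ge0.
    apply: Rintegral_ge0 => t _; rewrite hornerM -expr2 mulr_ge0 ?sqr_ge0//.
    by rewrite mulr_ge0 ?powR_ge0.
  have -> : h * weight a b v * (16 * Q * 81 * (2 * I0 k + n%:R ^- 2 * I1 k)) =
    16 * (Q * (h * weight a b v)) * (81 * (2 * I0 k + n%:R ^- 2 * I1 k)) by ring.
  apply: (ler_wpM2r P0); apply: (le_trans _ (ler_wpM2l (ler0n _ 16) LI)).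
  rewrite mulr_sumr big_mkcond/=; apply: ler_sum => j _; case: ifP => _.
    by rewrite mulrCA.
  by rewrite !mulr_ge0 ?ler0n// hornerM -expr2 sqr_ge0.
apply: (@le_trans _ _ (\sum_(k < n) 16 * peak_const a b * 81 *
    (2 * I0 k + n%:R ^- 2 * I1 k))).
  by apply: ler_sum => k _; exact: step2.
have S0 : \sum_(k < n) I0 k = pint a b (e * e).
  apply: Rintegral_partition => //; [exact: cheb_end0|exact: cheb_endm|].
  exact/integrable_bdd/bdd_horner.
have S1 : \sum_(k < n) I1 k = pint (a + 1) (b + 1) (e^`() * e^`()).
  apply: Rintegral_partition => //; [exact: cheb_end0|exact: cheb_endm|].
  by apply: integrable_bdd (bdd_horner _); lra.
rewrite -mulr_sumr big_split -!mulr_sumr S0 S1.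
move: (peak_const a b) Q0 => Q Q0.
rewrite -[X in _ <= X]mulrA ler_wpM2l ?mulr_ge0 ?ler0n//.
rewrite mulrDr lerD2l ler_peMl// ?ler1n//.
rewrite mulr_ge0 ?invr_ge0 ?exprn_ge0 ?ler0n//.
by apply: pint_sqr_ge0.
Qed.

End GaussSampling.

(** * Interpolation error of polynomials *)

Section InterpolationError.
Variable R : realType.
Notation mu := (@lebesgue_measure R).
Implicit Types (a b x y h : R) (e : {poly R}) (m k s N : nat).

(** With K the constant of [gauss_sampling], the square of the polynomial contributes 2 and that of
    its interpolant 3 K (2 from the sup bound, 1 from Markov's inequality); (u - v)^2 <= 2 u^2 + 2
    v^2 doubles both. *)
Definition interp_const a b : R := 4 + 6 * (16 * peak_const a b * 81 * 2).

Lemma interp_error_sqr a b N (y : 'I_N.+1 -> R) e x :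
  -1 < a -> a <= - 2^-1 -> -1 < b -> b <= - 2^-1 -> (0 < N)%N -> injective y ->
  (forall i, 0 < y i < 1) -> (forall i, root (shifted_jacobi a b N.+1) (y i)) ->
  0 <= x -> x <= 1 ->
  (e.[x] - (linterp y (horner e)).[x]) ^+ 2 <= interp_const a b *
    (N%:R * pint a b (e * e) + N%:R^-1 * pint (a + 1) (b + 1) (e^`() * e^`())).
Proof.
move=> a1 a2 b1 b2 N0 yinj y01 yr x0 x1.
have NR : 0 < N%:R :> R by rewrite ltr0n.
have N1 : 1 <= N%:R :> R by rewrite ler1n.
have a3 : -1 < a + 1 by lra.
have b3 : -1 < b + 1 by lra.
have U := sup_sqr_le e a1 a2 b1 b2 NR x0 x1.
have V := sup_sqr_le (linterp y (horner e)) a1 a2 b1 b2 NR x0 x1.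
have M := pint_deriv_le a1 a2 b1 b2 (size_linterp y (horner e)).
have G := gauss_sampling e a1 a2 b1 b2 (ltn0Sn N) yinj y01 yr.
have q0 : 0 <= pint a b (linterp y (horner e) * linterp y (horner e)) by exact: pint_sqr_ge0.
have A0 : 0 <= pint a b (e * e) by exact: pint_sqr_ge0.
have B0 : 0 <= pint (a + 1) (b + 1) (e^`() * e^`()) by exact: pint_sqr_ge0.
rewrite -(pint_linterp_sqr yinj a1 b1 yr (horner e)) in G.
rewrite /interp_const.
have K0 : 0 <= 16 * peak_const a b * 81 * 2.
  by rewrite !mulr_ge0 ?ler0n ?peak_const_ge0.
move: (16 * peak_const a b * 81 * 2) K0 G => K K0 G.
move: (e.[x]) (linterp y (horner e)).[x] (pint a b (e * e))
  (pint (a + 1) (b + 1) (e^`() * e^`()))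
  (pint a b (linterp y (horner e) * linterp y (horner e)))
  (pint (a + 1) (b + 1) ((linterp y (horner e))^`() * (linterp y (horner e))^`()))
  U V M G q0 A0 B0 => u v A B q2 q1 U V M G q0 A0 B0.
have Ni : 0 < N%:R^-1 :> R by rewrite invr_gt0.
(* The sampling bound has the number N + 1 of nodes in the denominator; it is weakened to the degree
   N. *)
have G' : q2 <= K * (A + N%:R ^- 2 * B).
  apply: (le_trans G); rewrite ler_wpM2l// lerD2l ler_wpM2r//.
  rewrite lef_pV2 ?posrE ?exprn_gt0 ?ltr0n// lerXn2r ?nnegrE ?ler0n//.
  by rewrite ler_nat.
have V' : v ^+ 2 <= 3 * K * (N%:R * A + N%:R^-1 * B).
  have e1 : N%:R^-1 * q1 <= N%:R * q2.
    have := ler_wpM2l (ltW Ni) M; rewrite expr2 !mulrA mulVf ?gt_eqF// mul1r.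
    by [].
  have e2 : q2 <= N%:R * q2 by rewrite ler_peMl.
  have e3 : N%:R * q2 <= K * (N%:R * A + N%:R^-1 * B).
    have := ler_wpM2l (ltW NR) G'; congr (_ <= _).
    by field; rewrite gt_eqF.
  lra.
have U' : u ^+ 2 <= 2 * (N%:R * A + N%:R^-1 * B).
  have : A <= N%:R * A by rewrite ler_peMl.
  have : 0 <= N%:R^-1 * B by rewrite mulr_ge0// ltW.
  lra.
have : (u - v) ^+ 2 <= 2 * u ^+ 2 + 2 * v ^+ 2.
  have := sqr_ge0 (u + v); rewrite !expr2; lra.
by move=> /le_trans; apply; lra.
Qed.

(** Since m <= s - 1, (k - m) s >= (k - s + 1) s = k + (s - 1)(k - s) >= k. This keeps the bound
    useful even when k is close to s and k - m is small. *)
Lemma natr_bound s N k m : (0 < s)%N -> (N < k)%N -> (s <= k)%N -> (m < s)%N ->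
  (N <= (k - m) * s)%N.
Proof. by move=> s0 Nk sk ms; nia. Qed.

Lemma eigenprod_factor a b s N k m : -1 < a -> -1 < b -> (0 < s)%N ->
  (N < k)%N -> (s <= k)%N -> (m < s)%N ->
  N%:R ^+ 2 / s%:R <= (k - m)%:R * (k%:R + m%:R + a + b + 1) :> R.
Proof.
move=> a1 b1 s0 Nk sk ms.
have s1 : 0 < s%:R :> R by rewrite ltr0n.
rewrite ler_pdivrMr// mulrAC -natrM expr2; apply: ler_pM => //.
  by rewrite ler_nat natr_bound.
have : N%:R + 1 <= k%:R :> R by rewrite natr1 ler_nat.
have : 0 <= m%:R :> R by []; lra.
Qed.

(** The factor m = 0 is kept as the eigenvalue of the first derivative, so that the energy of E' can
    be compared with that of E^(s). *)
Lemma eigenprod_ge1 a b s N k : -1 < a -> -1 < b ->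
  (N < k)%N -> (s.+1 <= k)%N ->
  eigenprod 1 a b k * (N%:R ^+ 2 / s.+1%:R) ^+ s <= eigenprod s.+1 a b k :> R.
Proof.
move=> a1 b1 Nk sk; rewrite eigenprod1 /eigenprod big_ord_recl/= subn0 addr0.
rewrite ler_wpM2l//.
  rewrite mulr_ge0//; have : 1 <= k%:R :> R by rewrite ler1n; exact: leq_trans sk.
  lra.
rewrite -[X in _ ^+ X](card_ord s) -prodr_const; apply: ler_prod => m _.
rewrite divr_ge0 ?exprn_ge0 ?ler0n//=.
by apply: (@eigenprod_factor a b s.+1) => //; rewrite /bump/= add1n ltnS.
Qed.

(** All energies are diagonal in the Jacobi basis, so the inequality is checked for each k > N. Each
    energy on the left costs at most s^s, and s <= N + 1 keeps the eigenvalue factors from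
    vanishing. *)
Lemma tail_energy_le a b s N n (c : nat -> R) E : -1 < a -> -1 < b ->
  (0 < s)%N -> (0 < N)%N -> (s <= N.+1)%N -> (forall k, (k <= N)%N -> c k = 0) ->
  E = jacobi_sum a b n c ->
  N%:R * pint a b (E * E) + N%:R^-1 * pint (a + 1) (b + 1) (E^`() * E^`()) <=
  2 * s%:R ^+ s * (N%:R / N%:R ^+ (2 * s)) *
    pint (a + s%:R) (b + s%:R) (E^`(s) * E^`(s)).
Proof.
move=> a1 b1 s0 N0 sN c0 ->.
have NR : 0 < N%:R :> R by rewrite ltr0n.
have sR : 1 <= s%:R :> R by rewrite ler1n.
rewrite derivn1_pint !jacobi_sum_derivn// jacobi_sum_dot2//.
rewrite !mulr_sumr -big_split/=; apply: ler_sum => k _.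
have [kN|Nk] := leqP k N; first by rewrite c0// expr0n/= !mul0r !mulr0 addr0.
have w0 : 0 <= c k ^+ 2 * jacobi_norm a b k.
  by rewrite mulr_ge0 ?sqr_ge0// ltW// jacobi_norm_gt0.
rewrite -expr2; move: (c k ^+ 2 * _) w0 => w w0.
have sk : (s <= k)%N by exact: leq_trans sN Nk.
have nn0 : 0 <= N%:R ^+ 2 / s%:R :> R by rewrite divr_ge0 ?exprn_ge0.
have e0 : (N%:R ^+ 2 / s%:R) ^+ s <= eigenprod s a b k.
  by apply: eigenprod_ge => // m ms; exact: eigenprod_factor.
have e1 : eigenprod 1 a b k * (N%:R ^+ 2 / s%:R) ^+ s.-1 <= eigenprod s a b k.
  by case: s s0 sk {sN sR nn0 e0} => // s _ sk; exact: eigenprod_ge1.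
have EE : (N%:R ^+ 2 / s%:R) ^+ s = N%:R ^+ (2 * s) / s%:R ^+ s :> R.
  by rewrite expr_div_n exprM.
have N2 : 0 < N%:R ^+ (2 * s) :> R by rewrite exprn_gt0.
have ss : 0 < s%:R ^+ s :> R by rewrite exprn_gt0// ltr0n.
have f0 : N%:R * w <= s%:R ^+ s * (N%:R / N%:R ^+ (2 * s)) * (w * eigenprod s a b k).
  have -> : N%:R * w = s%:R ^+ s * (N%:R / N%:R ^+ (2 * s)) *
      (w * (N%:R ^+ 2 / s%:R) ^+ s) by rewrite EE; field; rewrite !gt_eqF.
  by rewrite !ler_wpM2l// mulr_ge0 ?divr_ge0 ?ltW.
have f1 : N%:R^-1 * (w * eigenprod 1 a b k) <=
    s%:R ^+ s * (N%:R / N%:R ^+ (2 * s)) * (w * eigenprod s a b k).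
  have t0 : 0 <= s%:R ^+ s * (N%:R / N%:R ^+ (2 * s)) :> R.
    by rewrite mulr_ge0 ?divr_ge0 ?ltW.
  apply: (le_trans _ (ler_wpM2l t0 (ler_wpM2l w0 e1))).
  have -> : s%:R ^+ s * (N%:R / N%:R ^+ (2 * s)) *
      (w * (eigenprod 1 a b k * (N%:R ^+ 2 / s%:R) ^+ s.-1)) =
      s%:R * (N%:R^-1 * (w * eigenprod 1 a b k)).
    case: s s0 {sN sk e0 e1 EE t0 f0} sR nn0 N2 ss => // s _ sR nn0 N2 ss.
    rewrite /= expr_div_n -exprM !mulnS exprD exprS.
    by field; rewrite !gt_eqF ?exprn_gt0 ?ltr0n.
  rewrite ler_peMl// mulr_ge0 ?invr_ge0 ?(ltW NR)// mulr_ge0//.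
  rewrite eigenprod1 mulr_ge0//; have : 1 <= k%:R :> R by rewrite ler1n (leq_trans _ sk).
  lra.
apply: (le_trans (lerD f0 f1)).
by rewrite le_eqVlt; apply/orP; left; apply/eqP; ring.
Qed.

Lemma bddN (f : R -> R) : bdd f -> bdd (fun x => - f x).
Proof. by move=> bf; under eq_fun do rewrite -mulN1r; exact: bddZ. Qed.

Lemma bernoulli_le (u : R) k : 0 <= u -> 1 + k%:R * u <= (1 + u) ^+ k.
Proof.
move=> u0; elim: k => [|k IH]; first by rewrite mul0r addr0 expr0.
have k0 : 0 <= k%:R * u * u by rewrite !mulr_ge0.
have u1 : 0 <= 1 + u by lra.
by have := ler_wpM2l u1 IH; rewrite exprS -natr1; lra.
Qed.

(* Powers of the bump [1 + d^2/2 - (t - z)^2] detect positivity at [z]. *)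
Lemma wint_bump_le0 a b (phi : R -> R) (F : nat -> R -> R) :
  -1 < a -> -1 < b -> {within `[0, 1], continuous phi} -> (forall k, bdd (F k)) ->
  (forall k t, 0 < t -> t < 1 -> phi t <= F k t) ->
  (forall k (B : {poly R}), (size B <= 3)%N ->
     wint a b (fun t => F k t * (B ^+ k).[t]) = 0) ->
  forall z, 0 < z -> z < 1 -> phi z <= 0.
Proof.
move=> a1 b1 cphi bF phiF F0 z z0 z1; rewrite leNgt; apply/negP => phiz.
have [_ [M0 M0P]] := bdd_continuous cphi.
pose M := Num.max M0 0.
have M_ge0 : 0 <= M by rewrite /M le_max lexx orbT.
have MP t : 0 < t -> t < 1 -> - M <= phi t.
  move=> t0 t1; rewrite lerNl (le_trans _ (_ : M0 <= M))//; last first.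
    by rewrite /M le_max lexx.
  by apply: le_trans (M0P t t0 t1); rewrite -normrN ler_norm.
have cz : {for z, continuous phi}.
  have /continuous_within_itvP-/(_ ltr01)[co _ _] := cphi.
  by apply: co; rewrite in_itv/= z0.
have [d [d0 dz d1 dP]] : exists d, [/\ 0 < d, d < z, d < 1 - z &
    forall t, `|t - z| <= d -> phi z / 2 <= phi t].
  have e0 : 0 < phi z / 2 by rewrite divr_gt0.
  move: cz => /cvgrPdist_le/(_ _ e0)[r /= r0 rP].
  exists (Num.min (r / 2) (Num.min (z / 2) ((1 - z) / 2))).
  have r2 : 0 < r / 2 by rewrite divr_gt0.
  split.
  - by rewrite !lt_min r2 /=; apply/andP; split; lra.
  - by rewrite !gt_min; apply/orP; right; apply/orP; left; lra.
  - by rewrite !gt_min; apply/orP; right; apply/orP; right; lra.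
  move=> t; rewrite !le_min => /andP[tr _].
  have : `|phi z - phi t| <= phi z / 2.
    by apply: rP; rewrite /ball/= distrC (le_lt_trans tr)//; lra.
  by rewrite ler_norml => /andP[_]; lra.
have d_lt1 : d < 1 by lra.
have d2 : 0 < d ^+ 2 by rewrite exprn_gt0.
have d2' : d ^+ 2 <= 1 by rewrite exprn_ile1// ltW.
(* B is at least 1 + d^2/4 for |t - z| <= d/2, nonnegative for |t - z| <= d, and between 0 and 1
   elsewhere in the interval. Adding M to F k B^k thus makes the integrand nonnegative, while its
   part near z grows like (1 + d^2/4)^k. *)
pose B : {poly R} := (1 + d ^+ 2 / 2)%:P - ('X - z%:P) ^+ 2.
have BE t : B.[t] = 1 + d ^+ 2 / 2 - (t - z) ^+ 2.
  by rewrite !hornerE.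
have sB : (size B <= 3)%N.
  rewrite (leq_trans (size_polyD _ _))// geq_max size_polyN size_exp_XsubC leqnn andbT.
  by rewrite size_polyC; case: eqP.
have Bk k : wint a b (fun t => F k t * (B ^+ k).[t]) = 0 by exact: F0.
have lower k : phi z / 2 * (1 + d ^+ 2 / 4) ^+ k *
    ((1 - (z + d / 2)) `^ `|a| * (z - d / 2) `^ `|b|) * ((z + d / 2) - (z - d / 2)) <=
    M * pint a b 1.
  have bM : bdd (fun t => F k t * (B ^+ k).[t] + M).
    by apply: bddD; [apply: bddM; [exact: bF|exact: bdd_horner]|exact: bdd_cst].
  have -> : M * pint a b 1 = wint a b (fun t => F k t * (B ^+ k).[t] + M).
    rewrite wintD//; [|by apply: bddM; [exact: bF|exact: bdd_horner]|exact: bdd_cst].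
    rewrite Bk add0r -wintZ//; last exact: bdd_horner.
    by apply: eq_wint => t _ _; rewrite hornerC mulr1.
  have near t : `|t - z| <= d -> 0 < t /\ t < 1 /\ 0 <= B.[t].
    rewrite ler_norml => /andP[t1 t2]; split; [lra|split; [lra|]].
    have : (t - z) ^+ 2 <= d ^+ 2.
      rewrite -(real_normK (num_real (t - z))) lerXn2r// ?nnegrE//; first exact: ltW.
      by rewrite ler_norml t1.
    by rewrite BE; lra.
  apply: wint_ge_sub => //; try lra.
  - move=> t t0 t1; have [td|dt] := leP `|t - z| d.
      have [_ [_ Bt]] := near t td; rewrite addr_ge0// mulr_ge0//.
        by apply: le_trans (phiF k t t0 t1); apply: le_trans (dP t td); lra.
      by rewrite horner_exp exprn_ge0.
    have Bt : 0 <= B.[t] <= 1.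
      have : (t - z) ^+ 2 <= 1.
        rewrite -(real_normK (num_real (t - z))) exprn_ile1// ler_norml; lra.
      have : d ^+ 2 <= (t - z) ^+ 2.
        rewrite -(real_normK (num_real (t - z))) lerXn2r// ?nnegrE//; exact: ltW.
      by rewrite BE; lra.
    have /andP[Bt0 Bt1] := Bt.
    have Bk1 : 0 <= (B ^+ k).[t] <= 1 by rewrite horner_exp exprn_ge0//= exprn_ile1.
    have /andP[p0 p1] := Bk1.
    have l1 : - M <= F k t by rewrite (le_trans (MP t t0 t1)) ?phiF.
    have := ler_wpM2r p0 l1; have := ler_wpM2l M_ge0 p1; lra.
  - rewrite mulr_ge0 ?exprn_ge0//; lra.
  move=> t tl tr; have td : `|t - z| <= d by rewrite ler_norml; lra.
  have [t0 [t1 _]] := near t td.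
  have Bt : 1 + d ^+ 2 / 4 <= B.[t].
    have : (t - z) ^+ 2 <= (d / 2) ^+ 2.
      rewrite -(real_normK (num_real (t - z))) lerXn2r// ?nnegrE//; first by lra.
      by rewrite ler_norml; lra.
    by rewrite BE expr_div_n; lra.
  apply: (@le_trans _ _ (F k t * (B ^+ k).[t])); last by rewrite lerDl.
  apply: ler_pM; [lra|rewrite exprn_ge0//; lra| |].
    by apply: le_trans (phiF k t t0 t1); exact: dP.
  by rewrite horner_exp lerXn2r// nnegrE; lra.
set K := ((1 - (z + d / 2)) `^ `|a| * (z - d / 2) `^ `|b|) in lower.
have K0 : 0 < K by rewrite mulr_gt0// powR_gt0//; lra.
clearbody K.
have bern k : 1 + k%:R * (d ^+ 2 / 4) <= (1 + d ^+ 2 / 4) ^+ k.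
  by apply: bernoulli_le; lra.
pose C := phi z / 2 * (d ^+ 2 / 4) * K * d.
have C0 : 0 < C.
  by apply: mulr_gt0 => //; apply: mulr_gt0 => //; apply: mulr_gt0; lra.
have big k : k%:R * C <= M * pint a b 1.
  apply: le_trans (lower k).
  have -> : z + d / 2 - (z - d / 2) = d by field.
  have -> : k%:R * C = (phi z / 2 * (k%:R * (d ^+ 2 / 4))) * K * d by rewrite /C; ring.
  rewrite ler_wpM2r ?(ltW d0)// ler_wpM2r ?(ltW K0)// ler_wpM2l//; first by lra.
  by apply: le_trans (bern k); rewrite lerDr.
have := big (Num.truncn (M * pint a b 1 / C)).+1; apply/negP; rewrite -ltNge.
by rewrite -ltr_pdivrMr// truncnS_gt.
Qed.

End InterpolationError.

(** * Smooth cutoffs *)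

Section Smooth.
Variable R : realType.
Implicit Types (f g : R -> R) (x u c d : R) (n : nat) (p q : {poly R}).

Definition smooth f := forall n x, derivable (derive1n n f) x 1.

(** Reduces smoothness to finding a class of derivable functions stable under differentiation,
    without formulas for higher derivatives. *)
Lemma smooth_class (S : (R -> R) -> Prop) :
  (forall f, S f -> (forall x, derivable f x 1) /\ S (derive1 f)) ->
  forall f, S f -> smooth f.
Proof.
move=> HS f Sf n.
have Sn : S (derive1n n f) by elim: n => // n IH; case: (HS _ IH).
by have [] := HS _ Sn.
Qed.

Lemma smooth_derivable f x : smooth f -> derivable f x 1.
Proof. by move=> sf; exact: (sf 0%N x). Qed.

Lemma smooth_is_derive f x : smooth f -> is_derive x 1 f (derive1 f x).
Proof.
by move=> sf; rewrite derive1E; apply: derivableP; exact: smooth_derivable.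
Qed.

Lemma smooth_derive1 f : smooth f -> smooth (derive1 f).
Proof. by move=> sf n x; rewrite -derive1Sn; exact: sf. Qed.

Lemma smooth_derive1n f n : smooth f -> smooth (derive1n n f).
Proof.
by move=> sf; elim: n => [|n IH]; [exact: sf|rewrite derive1nS; exact: smooth_derive1].
Qed.

Lemma derive1_funext f (df : R -> R) : (forall x, is_derive x 1 f (df x)) ->
  derive1 f = df.
Proof. by move=> H; apply/funext => x; rewrite derive1E; have [_] := H x. Qed.

(* Sums, products and inverses of smooth functions form a class closed under differentiation. *)
Inductive smooth_ring : (R -> R) -> Prop :=
| SmoothBase f : smooth f -> smooth_ring f
| SmoothAdd f g : smooth_ring f -> smooth_ring g -> smooth_ring (f + g)
| SmoothMul f g : smooth_ring f -> smooth_ring g -> smooth_ring (f * g)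
| SmoothInv f : smooth_ring f -> (forall x, f x != 0) ->
    smooth_ring (fun x => (f x)^-1).

Lemma smooth_cst c : smooth (cst c).
Proof.
apply: (smooth_class (S := fun f => exists c, f = cst c)); last by exists c.
move=> _ [c' ->]; split=> [x|]; first exact: derivable_cst.
by exists 0; apply: derive1_funext => x; exact: is_derive_cst.
Qed.

Lemma smooth_ringP f : smooth_ring f -> smooth f.
Proof.
apply: smooth_class => {}f; elim=> {f} [f sf|f g Sf [df Sdf] Sg [dg Sdg]|
  f g Sf [df Sdf] Sg [dg Sdg]|f Sf [df Sdf] f0].
- split; first by move=> x; exact: smooth_derivable.
  exact/SmoothBase/smooth_derive1.
- split; first by move=> x; apply: derivableD.
  have -> : derive1 (f + g) = derive1 f + derive1 g.
    apply: derive1_funext => x; rewrite !fctE !derive1E.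
    by apply: is_deriveD; apply: derivableP.
  exact: SmoothAdd.
- split; first by move=> x; apply: derivableM.
  have -> : derive1 (f * g) = f * derive1 g + g * derive1 f.
    apply: derive1_funext => x; rewrite !fctE !derive1E.
    by apply: is_deriveM; apply: derivableP.
  by apply: SmoothAdd; apply: SmoothMul.
- have dV x : is_derive x 1 (fun x => (f x)^-1) (- (f x) ^- 2 *: derive1 f x).
    by apply: is_deriveV => //; rewrite derive1E; apply: derivableP.
  split; first by move=> x; have [] := dV x.
  have -> : derive1 (fun x => (f x)^-1) = cst (-1) * (((fun x => (f x)^-1) *
      (fun x => (f x)^-1)) * derive1 f).
    apply: derive1_funext => x; apply: is_derive_eq (dV x) _.
    by rewrite !fctE /GRing.scale/= expr2 invfM; ring.
  apply: SmoothMul; first exact/SmoothBase/smooth_cst.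
  by apply: SmoothMul => //; apply: SmoothMul; apply: SmoothInv.
Qed.

Lemma smoothD f g : smooth f -> smooth g -> smooth (f + g).
Proof. by move=> sf sg; apply: smooth_ringP; apply: SmoothAdd; apply: SmoothBase. Qed.

Lemma smoothM f g : smooth f -> smooth g -> smooth (f * g).
Proof. by move=> sf sg; apply: smooth_ringP; apply: SmoothMul; apply: SmoothBase. Qed.

Lemma smoothV f : smooth f -> (forall x, f x != 0) -> smooth (fun x => (f x)^-1).
Proof. by move=> sf f0; apply: smooth_ringP; apply: SmoothInv => //; apply: SmoothBase. Qed.

Lemma is_derive_affine f c d x (df : R) : is_derive (c * x + d) 1 f df ->
  is_derive x 1 (fun t => f (c * t + d)) (c * df).
Proof.
move=> H.
have da : is_derive x 1 (fun t => c * t + d) c.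
  have := is_derive_poly (c *: 'X + d%:P) x.
  rewrite derivD derivZ derivX derivC addr0 hornerZ hornerC mulr1.
  by rewrite (_ : horner _ = fun t => c * t + d)//; apply/funext => t; rewrite !hornerE.
have := @is_derive1_comp R f (fun t => c * t + d) x _ _ H da.
by rewrite mulrC.
Qed.

Lemma derive1n_affine f c d n : smooth f ->
  derive1n n (fun t => f (c * t + d)) = (fun t => c ^+ n * derive1n n f (c * t + d)).
Proof.
move=> sf; elim: n => [|n IH]; first by apply/funext => t; rewrite mul1r.
rewrite derive1nS IH; apply: derive1_funext => x.
have := is_derive_affine (smooth_is_derive (c * x + d) (smooth_derive1n (n := n) sf)).
move=> H; have := is_deriveM (is_derive_cst (c ^+ n) x 1) H.
by move/is_derive_eq; apply; rewrite /GRing.scale/= mulr0 addr0 exprSr mulrA.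
Qed.

Lemma smooth_affine f c d : smooth f -> smooth (fun t => f (c * t + d)).
Proof.
move=> sf n x; rewrite derive1n_affine//.
have := is_derive_affine (smooth_is_derive (c * x + d) (smooth_derive1n (n := n) sf)).
by move=> H; have [] := is_deriveM (is_derive_cst (c ^+ n) x 1) H.
Qed.

Lemma derive1nD f g n : smooth f -> smooth g ->
  derive1n n (f + g) = derive1n n f + derive1n n g.
Proof.
move=> sf sg; elim: n => // n IH; rewrite !derive1nS IH.
apply: derive1_funext => x; rewrite !fctE.
by apply: is_deriveD; apply: smooth_is_derive; exact: smooth_derive1n.
Qed.

Lemma derive1n_locally_cst f c (A : set R) n : open A -> (forall x, A x -> f x = c) ->
  forall x, A x -> derive1n n.+1 f x = 0.
Proof.
move=> oA fA; have H g c' x : (forall x, A x -> g x = c') -> A x -> derive1 g x = 0.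
  move=> gA Ax; rewrite derive1E.
  have [|_ ->//] := @near_eq_is_derive _ _ _ (cst c') g x 1 0 _ (is_derive_cst c' x 1).
  by apply: filterS (open_nbhs_nbhs (conj oA Ax)) => z /gA.
elim: n => [|n IH] x Ax; first exact: H fA Ax.
by rewrite derive1nS; apply: (H _ 0) => // z; exact: IH.
Qed.

(** With z = 1/u this is what makes [flat] vanish to all orders at 0. Monomials are absorbed through
    e^z = (e^(z/n))^n >= (z/n)^n. *)
Lemma poly_expR_bdd q : exists C : R, forall z, 0 < z -> `|q.[z]| * expR (- z) <= C.
Proof.
have mono n : exists C : R, forall z, 0 < z -> z ^+ n * expR (- z) <= C.
  case: n => [|n].
    by exists 1 => z z0; rewrite mul1r -expR0 ler_expR oppr_le0 ltW.
  exists (n.+1%:R ^+ n.+1) => z z0.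
  have n0 : 0 < n.+1%:R :> R by rewrite ltr0n.
  have h : (z / n.+1%:R) ^+ n.+1 <= expR z.
    have -> : expR z = expR (z / n.+1%:R) ^+ n.+1.
      by rewrite -expRM_natr divfK// gt_eqF.
    rewrite lerXn2r ?nnegrE ?expR_ge0 ?divr_ge0 ?ltW//.
    by apply: lt_le_trans (expR_ge1Dx _); rewrite ltrDr.
  rewrite expRN ler_pdivrMr ?expR_gt0//.
  by move: h; rewrite expr_div_n ler_pdivrMr ?exprn_gt0// mulrC.
elim/poly_ind: q => [|q c [C HC]].
  by exists 0 => z _; rewrite horner0 normr0 mul0r.
have [D HD] : exists D : R, forall z, 0 < z -> `|(q * 'X).[z]| * expR (- z) <= D.
  clear C HC c.
  have : exists D : R, forall z, 0 < z ->
      \sum_(i < size (q * 'X)) (`|(q * 'X)`_i| * (z ^+ i * expR (- z))) <= D.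
    elim: (size _) => [|n [D HD]].
      by exists 0 => z _; rewrite big_ord0.
    have [E HE] := mono n.
    exists (D + `|(q * 'X)`_n| * E) => z z0; rewrite big_ord_recr/=.
    by rewrite lerD ?HD// ler_wpM2l// HE.
  move=> [D HD]; exists D => z z0; apply: le_trans (HD z z0).
  rewrite horner_coef; apply: (le_trans (ler_wpM2r (expR_ge0 _) (ler_norm_sum _ _ _))).
  rewrite mulr_suml; apply: ler_sum => i _; rewrite normrM mulrA.
  by rewrite [`|z ^+ i|]ger0_norm// exprn_ge0// ltW.
exists (D + `|c|) => z z0; rewrite hornerD hornerC.
apply: (le_trans (ler_wpM2r (expR_ge0 _) (ler_normD _ _))).
rewrite mulrDl lerD ?HD// ler_piMr// -expR0 ler_expR oppr_le0 ltW//.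
Qed.

(** An arbitrary p makes the family stable under differentiation, which acts as p -> X^2 (p - p');
    the case p = 1 is the classical flat function. *)
Definition flat p u : R := if 0 < u then p.[u^-1] * expR (- u^-1) else 0.

Lemma is_derive_sqr_le f x C : (forall h, `|f (h + x) - f x| <= C * h ^+ 2) ->
  is_derive x 1 f 0.
Proof.
move=> H; have C0 : 0 <= C.
  by have := le_trans (normr_ge0 _) (H 1); rewrite expr1n mulr1.
have lim : (fun h => h^-1 *: ((f \o shift x) (h *: 1) - f x)) @ 0^' --> (0 : R).
  apply/cvgrPdist_le => e e0; near=> h.
  have h0 : h != 0 by near: h; exact: nbhs_dnbhs_neq.
  rewrite sub0r normrN /= /GRing.scale/= mulr1 normrM normfV.
  rewrite mulrC ler_pdivrMr ?normr_gt0//; apply: (le_trans (H h)).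
  rewrite -(real_normK (num_real h)) expr2 mulrA ler_wpM2r//.
  have hC : `|h| <= e / (C + 1).
    near: h; apply: nbhs_dnbhs; apply/nbhs_ballP.
    exists (e / (C + 1)) => /=; first by rewrite divr_gt0//; lra.
    by move=> z; rewrite /ball/= sub0r normrN => /ltW.
  rewrite ler_pdivlMr in hC; last by lra.
  have := normr_ge0 h; lra.
split; first by apply/cvg_ex; exists 0.
exact: cvg_lim lim.
Unshelve. all: by end_near. Qed.

Lemma is_derive_flat p u : is_derive u 1 (flat p) (flat ('X ^+ 2 * (p - p^`())) u).
Proof.
case: (ltgtP u 0) => [u0|u0|->].
- rewrite [flat ('X ^+ 2 * _) u]/flat ltNge (ltW u0)/=.
  apply: near_eq_is_derive (is_derive_cst 0 u 1).
  near=> z; rewrite /flat ltNge (_ : z <= 0)//.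
  by apply: ltW; near: z; exact: lt_nbhsl.
- rewrite [flat ('X ^+ 2 * _) u]/flat u0.
  have dV : is_derive u 1 (fun t => t^-1) (- u ^- 2 *: 1 : R).
    by apply: is_deriveV; rewrite gt_eqF.
  have dp := @is_derive1_comp R (horner p) (fun t => t^-1) u _ _ (is_derive_poly p u^-1) dV.
  have dN := is_deriveN dV.
  have de := @is_derive1_comp R expR (- (fun t => t^-1)) u _ _ (is_derive_expR (- u^-1)) dN.
  have := is_deriveM dp de => H.
  apply: (@near_eq_is_derive _ _ _ _ (flat p) u 1 _ _ (is_derive_eq H _)).
    near=> z; rewrite /flat (_ : 0 < z)//.
    by near: z; exact: lt_nbhsr.
  rewrite /= !fctE !(hornerM, hornerX, hornerD, hornerN, horner_exp) /GRing.scale/=.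
  by field; rewrite gt_eqF.
- rewrite [flat ('X ^+ 2 * _) 0]/flat ltxx.
  (* The extra factor X^2 yields |flat p h| <= C h^2, so the derivative at 0 is zero. *)
  have [C HC] := poly_expR_bdd ('X ^+ 2 * p).
  apply: (@is_derive_sqr_le _ _ (Num.max C 0)) => h; rewrite addr0.
  rewrite {2}/flat ltxx subr0 /flat; case: ifP => [h0|_]; last first.
    by rewrite normr0 mulr_ge0 ?sqr_ge0// le_max lexx orbT.
  rewrite normrM (ger0_norm (expR_ge0 _)).
  have hi : 0 < h^-1 by rewrite invr_gt0.
  have := HC h^-1 hi; rewrite hornerM horner_exp hornerX normrM.
  have -> : `|h^-1 ^+ 2| = (h ^+ 2)^-1.
    by rewrite -exprVn ger0_norm// sqr_ge0.
  rewrite -mulrA mulrC ler_pdivrMr ?exprn_gt0// => /le_trans; apply.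
  by rewrite ler_wpM2r ?sqr_ge0// le_max lexx.
Unshelve. all: by end_near. Qed.

Lemma smooth_flat p : smooth (flat p).
Proof.
apply: (smooth_class (S := fun f => exists p, f = flat p)); last by exists p.
move=> _ [q ->]; split=> [x|]; first by have [] := is_derive_flat q x.
by exists ('X ^+ 2 * (q - q^`())); apply: derive1_funext; exact: is_derive_flat.
Qed.

Lemma flat1_ge0 u : 0 <= flat 1 u.
Proof. by rewrite /flat; case: ifP => // _; rewrite hornerC mul1r expR_ge0. Qed.

Lemma flat1_gt0 u : 0 < u -> 0 < flat 1 u.
Proof. by move=> u0; rewrite /flat u0 hornerC mul1r expR_gt0. Qed.

Lemma flat1_eq0 u : u <= 0 -> flat 1 u = 0.
Proof. by move=> u0; rewrite /flat ltNge u0. Qed.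

(** A smooth transition from 0 on u <= 1 to 1 on u >= 2; the arguments have the form c * u + d to
    fit [smooth_affine]. *)
Definition step u : R := flat 1 (1 * u + -1) / (flat 1 (1 * u + -1) + flat 1 (-1 * u + 2)).

Lemma step_den_gt0 u : 0 < flat 1 (1 * u + -1) + flat 1 (-1 * u + 2).
Proof.
have [u1|u1] := ltP u 2.
  by rewrite ltr_wpDl ?flat1_ge0// flat1_gt0//; lra.
by rewrite ltr_pwDl ?flat1_ge0// flat1_gt0//; lra.
Qed.

Lemma smooth_step : smooth step.
Proof.
have s1 := @smooth_affine (flat 1) 1 (-1) (@smooth_flat 1).
have s2 := @smooth_affine (flat 1) (-1) 2 (@smooth_flat 1).
apply: (smoothM s1); apply: (smoothV (smoothD s1 s2)) => x.
by rewrite gt_eqF// step_den_gt0.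
Qed.

Lemma step_le1 u : u <= 1 -> step u = 0.
Proof. by move=> u1; rewrite /step flat1_eq0 ?mul0r//; lra. Qed.

Lemma step_ge2 u : 2 <= u -> step u = 1.
Proof.
move=> u2; rewrite /step (@flat1_eq0 (-1 * u + 2)); last by lra.
by rewrite addr0 divff// gt_eqF// flat1_gt0//; lra.
Qed.

Lemma step_bounds u : 0 <= step u <= 1.
Proof.
apply/andP; split; first by rewrite divr_ge0 ?addr_ge0 ?flat1_ge0.
by rewrite (ler_pdivrMr _ _ (step_den_gt0 u)) [leRHS]mul1r lerDl flat1_ge0.
Qed.

(** For i > 0 the i-th derivative lives on [1, 2], where u^i is bounded. The product with u^i is
    invariant under the rescaling u = (k + 3) t. *)
Lemma step_derive_bdd i : exists C : R, forall u, 0 <= u ->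
  u ^+ i * `|derive1n i step u| <= C.
Proof.
case: i => [|i].
  exists 1 => u _; rewrite mul1r /= ger0_norm; by have /andP[] := step_bounds u.
have [C HC] : exists C : R, forall u, 1 <= u -> u <= 2 -> `|derive1n i.+1 step u| <= C.
  have cI : compact (`[1, 2] : set R) by exact: segment_compact.
  have cd : {within `[1, 2], continuous (derive1n i.+1 step)}.
    apply: continuous_subspaceT => x.
    have := smooth_is_derive x (smooth_derive1n (n := i.+1) smooth_step).
    exact: is_derive_continuous.
  have [M [_ HM]] := compact_bounded (continuous_compact cd cI).
  exists (M + 1) => u u1 u2; apply: (HM (M + 1)); first by rewrite ltrDl.
  by exists u => //=; rewrite in_itv/= u1.
exists (2 ^+ i.+1 * Num.max C 0) => u u0.
have K0 : 0 <= 2 ^+ i.+1 * Num.max C 0 by rewrite mulr_ge0 ?exprn_ge0// le_max lexx orbT.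
have [u1|u1] := ltP u 1.
  rewrite (@derive1n_locally_cst step 0 [set z | z < 1])//.
  - by rewrite normr0 mulr0.
  - by move=> z /= /ltW; exact: step_le1.
have [u2|u2] := ltP 2 u.
  rewrite (@derive1n_locally_cst step 1 [set z | 2 < z])//.
  - by rewrite normr0 mulr0.
  - by move=> z /= /ltW; exact: step_ge2.
apply: ler_pM; rewrite ?exprn_ge0//.
  by rewrite lerXn2r// nnegrE.
by rewrite le_max HC.
Qed.

(** A sum of two steps minus 1, instead of a product, so that derivatives split without Leibniz'
    rule. The scale is at least 3, so where one step vanishes near an endpoint the other equals
    1. *)
Definition cutoff k t : R := step (k.+3%:R * t + 0) + (step (- k.+3%:R * t + k.+3%:R) + -1).

Lemma smooth_cutoff k : smooth (cutoff k).
Proof.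
have s1 := @smooth_affine step k.+3%:R 0 smooth_step.
have s2 := @smooth_affine step (- k.+3%:R) k.+3%:R smooth_step.
exact: smoothD s1 (smoothD s2 (@smooth_cst (-1))).
Qed.

End Smooth.

(** * Test functions and weak derivatives *)

Section TestFunctions.
Variable R : realType.
Notation mu := (@lebesgue_measure R).
Implicit Types (f g psi : R -> R) (a b c d t x : R) (n k i : nat) (p q r : {poly R}).

Lemma derive1n_cutoff i k t : derive1n i (cutoff (R := R) k) t =
  k.+3%:R ^+ i * derive1n i (@step R) (k.+3%:R * t + 0) +
  ((- k.+3%:R) ^+ i * derive1n i (@step R) (- k.+3%:R * t + k.+3%:R) +
   derive1n i (cst (-1 : R)) t).
Proof.
have s0 := @smooth_step R.
have s1 := @smooth_affine R (@step R) k.+3%:R 0 s0.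
have s2 := @smooth_affine R (@step R) (- k.+3%:R) k.+3%:R s0.
rewrite [cutoff k](_ : _ = (fun t : R => step (k.+3%:R * t + 0)) +
  ((fun t : R => step (- k.+3%:R * t + k.+3%:R)) + cst (-1)))//.
have s3 := @smooth_cst R (-1).
rewrite (derive1nD i s1 (smoothD s2 s3)) (derive1nD i s2 s3).
by rewrite (derive1n_affine _ _ i s0) (derive1n_affine _ _ i s0).
Qed.

(** The i-th derivative is of size k^i near the ends; the factor (t (1 - t))^i absorbs it, giving a
    bound independent of k. *)
Lemma cutoff_derive_bdd i : exists C : R, forall k t, 0 < t -> t < 1 ->
  ((1 - t) * t) ^+ i * `|derive1n i (cutoff (R := R) k) t| <= C.
Proof.
have [C HC] := step_derive_bdd R i; exists (C + (C + 1)) => k t t0 t1.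
have t1' : 0 < 1 - t by lra.
have P0 : 0 <= ((1 - t) * t) ^+ i by rewrite exprn_ge0// mulr_ge0 ?ltW.
have le1 (u : R) : 0 < u -> u < 1 -> u ^+ i <= 1.
  by move=> u0 u1; rewrite exprn_ile1 ?ltW.
have K0 : 0 <= k.+3%:R :> R by [].
rewrite derive1n_cutoff.
apply: (le_trans (ler_wpM2l P0 (ler_normD _ _))); rewrite mulrDr; apply: lerD.
  rewrite normrM addr0 exprMn normrX [`|k.+3%:R|]ger0_norm//.
  have := HC (k.+3%:R * t) (mulr_ge0 K0 (ltW t0)); rewrite exprMn => H.
  have -> : (1 - t) ^+ i * t ^+ i * (k.+3%:R ^+ i * `|derive1n i (@step R) (k.+3%:R * t)|) =
    (1 - t) ^+ i * (k.+3%:R ^+ i * t ^+ i * `|derive1n i (@step R) (k.+3%:R * t)|) by ring.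
  apply: le_trans H; apply: ler_piMl; last by apply: le1; lra.
  by rewrite !mulr_ge0 ?exprn_ge0// ltW.
apply: (le_trans (ler_wpM2l P0 (ler_normD _ _))); rewrite mulrDr; apply: lerD.
  rewrite normrM exprMn normrX normrN [`|k.+3%:R|]ger0_norm//.
  have -> : - k.+3%:R * t + k.+3%:R = k.+3%:R * (1 - t) by ring.
  have := HC (k.+3%:R * (1 - t)) (mulr_ge0 K0 (ltW t1')); rewrite exprMn => H.
  have -> : (1 - t) ^+ i * t ^+ i * (k.+3%:R ^+ i * `|derive1n i (@step R) (k.+3%:R * (1 - t))|) =
    t ^+ i * (k.+3%:R ^+ i * (1 - t) ^+ i * `|derive1n i (@step R) (k.+3%:R * (1 - t))|) by ring.
  apply: le_trans H; apply: ler_piMl; last by apply: le1; lra.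
  by rewrite !mulr_ge0 ?exprn_ge0// ltW.
case: i {C HC P0 le1} => [|i].
  by rewrite mul1r /= normrN1.
rewrite (@derive1n_locally_cst R (cst (-1)) (-1) setT)//; last exact: openT.
by rewrite normr0 mulr0.
Qed.

Lemma cutoff_supp k t : ~ (k.+3%:R^-1 <= t <= 1 - k.+3%:R^-1) -> cutoff (R := R) k t = 0.
Proof.
have K0 : 0 < k.+3%:R :> R by rewrite ltr0n.
have K3 : 3 <= k.+3%:R :> R by rewrite ler_nat.
have Ki : k.+3%:R * k.+3%:R^-1 = 1 :> R by rewrite mulfV ?gt_eqF.
move=> /negP; rewrite negb_and -!ltNge => /orP[h|h]; rewrite /cutoff.
  have : k.+3%:R * t < 1 by rewrite -[ltRHS]Ki ltr_pM2l.
  move=> h'; rewrite step_le1; last by lra.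
  by rewrite step_ge2; [ring|lra].
have : k.+3%:R * (1 - t) < 1 by rewrite -[ltRHS]Ki ltr_pM2l// ltrBlDr -ltrBlDl.
move=> h'; rewrite step_ge2; last by lra.
by rewrite step_le1; [ring|lra].
Qed.

(** One threshold on k serves all i, because the cutoff is then constantly 1 on a neighbourhood of
    t. *)
Lemma cutoff_cvg t : 0 < t -> t < 1 ->
  \forall k \near \oo, forall i, derive1n i (cutoff (R := R) k) t = (i == 0%N)%:R.
Proof.
move=> t0 t1.
have m0 : 0 < Num.min t (1 - t) by rewrite lt_min t0/=; lra.
exists (Num.truncn (2 / Num.min t (1 - t))).+1 => //= k kP.
have K0 : 0 < k.+3%:R :> R by rewrite ltr0n.
have hk : 2 / Num.min t (1 - t) < k.+3%:R.
  apply: lt_le_trans (truncnS_gt _) _; rewrite ler_nat.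
  by rewrite (leq_trans kP)// -addn3 leq_addr.
rewrite ltr_pdivrMr// mulrC -ltr_pdivrMr// lt_min in hk.
have /andP[h1 h2] := hk.
pose A : set R := `]2 / k.+3%:R, 1 - 2 / k.+3%:R[%classic.
have c1 z : A z -> cutoff (R := R) k z = 1.
  rewrite /A/= in_itv/= => /andP[z1 z2].
  have z1' : 2 < k.+3%:R * z by rewrite mulrC -ltr_pdivrMr.
  have z2' : 2 < k.+3%:R * (1 - z) by rewrite mulrC -ltr_pdivrMr// ltrBrDl -ltrBrDr.
  by rewrite /cutoff !step_ge2; [ring|lra|lra].
have At : A t by rewrite /A/= in_itv/= h1/= ltrBrDl -ltrBrDr.
case=> [|i]; first exact: c1.
by apply: derive1n_locally_cst c1 _ At; exact: interval_open.
Qed.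

Definition supported_in d psi := forall t, ~ (d <= t <= 1 - d) -> psi t = 0.

Lemma open_outside d : open [set t : R | ~ (d <= t <= 1 - d)].
Proof.
have -> : [set t : R | ~ (d <= t <= 1 - d)] = ~` `[d, 1 - d]%classic.
  by apply/seteqP; split => t /=; rewrite in_itv.
exact/closed_openC/interval_closed.
Qed.

Lemma supported_derive1n d psi n : supported_in d psi -> supported_in d (derive1n n psi).
Proof.
move=> sp; case: n => // n t td.
exact: (derive1n_locally_cst n (@open_outside d) sp).
Qed.

(** Outside the support the weight need not be differentiable, but there the product is locally zero
    and so is the right-hand side. *)
Lemma is_derive_weight_cutoff q a b psi d t : smooth psi -> 0 < d ->
  supported_in d psi ->
  is_derive t 1 (fun t => q.[t] * weight a b t * psi t)
    ((Dw a b q).[t] * weight (a - 1) (b - 1) t * psi t +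
     q.[t] * weight a b t * derive1 psi t).
Proof.
move=> sp d0 supp; have [td|td] := pselect (d <= t <= 1 - d).
  have t0 : 0 < t by case/andP: td; lra.
  have t1 : t < 1 by case/andP: td; lra.
  have := is_deriveM (weightDw a b q t0 t1) (smooth_is_derive t sp).
  by move/is_derive_eq; apply; rewrite /GRing.scale/=; ring.
rewrite (supp t td) (_ : derive1 psi t = 0); last exact: (supported_derive1n 1 supp).
rewrite !mulr0 addr0; apply: near_eq_is_derive (is_derive_cst 0 t 1).
apply: filterS (open_nbhs_nbhs (conj (@open_outside d) td)) => z /= zd.
by rewrite supp// mulr0.
Qed.

Lemma is_derive_weight_sum (Q : nat -> {poly R}) n a b psi d t : smooth psi -> 0 < d ->
  supported_in d psi ->
  is_derive t 1 (fun t => \sum_(i < n)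
     (Q i).[t] * weight (a + i%:R) (b + i%:R) t * derive1n i psi t)
    (\sum_(i < n) ((Dw (a + i%:R) (b + i%:R) (Q i)).[t] *
       weight (a + i%:R - 1) (b + i%:R - 1) t * derive1n i psi t +
     (Q i).[t] * weight (a + i%:R) (b + i%:R) t * derive1n i.+1 psi t)).
Proof.
move=> sp d0 supp.
have H (i : 'I_n) : is_derive t 1
    (fun t => (Q i).[t] * weight (a + i%:R) (b + i%:R) t * derive1n i psi t)
    ((Dw (a + i%:R) (b + i%:R) (Q i)).[t] *
       weight (a + i%:R - 1) (b + i%:R - 1) t * derive1n i psi t +
     (Q i).[t] * weight (a + i%:R) (b + i%:R) t * derive1n i.+1 psi t).
  rewrite derive1nS.
  exact: is_derive_weight_cutoff (smooth_derive1n (n := i) sp) d0 (supported_derive1n i supp).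
have := is_derive_sum H.
rewrite (_ : \sum_(i < n) _ = fun t => \sum_(i < n) (Q i).[t] *
    weight (a + i%:R) (b + i%:R) t * derive1n i psi t)//.
by apply/funext => z; rewrite fct_sumE.
Qed.

(** Leibniz' rule sorted by derivatives of psi. The term with psi^(i) carries i more powers of t (1
    - t) than the term i = 0, which is exactly what [cutoff_derive_bdd] requires. *)
Lemma test_expand n r a b : exists2 Q : nat -> {poly R},
  Q 0%N = Dwn n (a - n%:R) (b - n%:R) r &
  forall psi d, smooth psi -> 0 < d -> supported_in d psi ->
   derive1n n (fun t => r.[t] * weight a b t * psi t) =
   fun t => \sum_(i < n.+1)
     (Q i).[t] * weight (a - n%:R + i%:R) (b - n%:R + i%:R) t * derive1n i psi t.
Proof.
elim: n => [|n [Q Q0 HQ]].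
  exists (fun=> r) => // psi d sp d0 supp.
  by apply/funext => t; rewrite big_ord1 !subr0 !addr0.
(* The values of [Q] beyond n are unspecified, hence the case distinction. *)
pose Q' i := (if (i <= n)%N then Dw (a - n%:R + i%:R) (b - n%:R + i%:R) (Q i) else 0) +
  (if i is i'.+1 then Q i' else 0).
exists Q'.
  by rewrite /Q'/= addr0 Q0 !addr0 -natr1 !opprD !addrA !subrK.
move=> psi d sp d0 supp; rewrite derive1nS (HQ psi d sp d0 supp).
apply: derive1_funext => t.
apply: is_derive_eq (is_derive_weight_sum Q n.+1 _ _ t sp d0 supp) _.
rewrite big_split/= [in RHS]/Q'.
under [RHS]eq_bigr do rewrite hornerD !mulrDl.
rewrite [RHS]big_split/=; congr (_ + _).
  rewrite [RHS]big_ord_recr/= ltnn hornerC !mul0r addr0; apply: eq_bigr => i _.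
  rewrite -ltnS ltn_ord; congr (_ * weight _ _ t * _); rewrite -natr1; ring.
rewrite [RHS]big_ord_recl/= hornerC !mul0r add0r; apply: eq_bigr => i _.
by rewrite /bump/= add1n; congr (_ * weight _ _ t * _); rewrite -!natr1; ring.
Qed.

Lemma smooth_weight_cutoff r a b psi d : smooth psi -> 0 < d -> supported_in d psi ->
  smooth (fun t => r.[t] * weight a b t * psi t).
Proof.
move=> sp d0 supp n t; have [Q _ /(_ psi d sp d0 supp) ->] := test_expand n r a b.
by have [] := is_derive_weight_sum Q n.+1 (a - n%:R) (b - n%:R) t sp d0 supp.
Qed.

Lemma test_function_weight_cutoff r a b k :
  test_function (fun t => r.[t] * weight a b t * cutoff (R := R) k t).
Proof.
have K0 : 0 < k.+3%:R^-1 :> R by rewrite invr_gt0 ltr0n.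
split; first exact: smooth_weight_cutoff (@smooth_cutoff R k) K0 (@cutoff_supp k).
exists `[k.+3%:R^-1, 1 - k.+3%:R^-1]%classic; split.
- exact: segment_compact.
- move=> t /=; rewrite !in_itv/= => /andP[t0 t1]; rewrite (lt_le_trans K0 t0)/=.
  by apply: le_lt_trans t1 _; rewrite gtrBl.
- by move=> t; rewrite /= in_itv/= => /cutoff_supp ->; rewrite mulr0.
Qed.

End TestFunctions.

(** * Weak derivatives tested against weighted polynomials *)

Section WeakDerivative.
Variable R : realType.
Notation mu := (@lebesgue_measure R).
Implicit Types (f g v psi : R -> R) (a b c d t x : R) (n k i : nat) (p q r : {poly R}).

Lemma cvg_Rintegral (F : nat -> R -> R) f (h : R -> R) :
  (forall k, measurable_fun (`]0, 1[ : set R) (F k)) ->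
  measurable_fun (`]0, 1[ : set R) f ->
  mu.-integrable `]0, 1[ (EFin \o h) ->
  (forall k t, 0 < t -> t < 1 -> `|F k t| <= h t) ->
  (forall t, 0 < t -> t < 1 -> F ^~ t @ \oo --> f t) ->
  \int[mu]_(t in `]0, 1[) F k t @[k --> \oo] --> \int[mu]_(t in `]0, 1[) f t.
Proof.
move=> mF mf ih Fh Ff.
have [] := @dominated_convergence _ _ _ mu `]0, 1[%classic (measurable_itv _)
  (fun k t => (F k t)%:E) (EFin \o f) (EFin \o h).
- by move=> k; apply/measurable_EFinP; exact: mF.
- exact/measurable_EFinP.
- apply: aeW => t /=; rewrite in_itv/= => /andP[t0 t1].
  by apply: cvg_EFin; [exact: nearW | exact: Ff].
- exact: ih.
- by apply: aeW => t k /=; rewrite in_itv/= => /andP[t0 t1]; rewrite lee_fin Fh.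
move=> intf _ /= H; apply: fine_cvg; rewrite fineK//.
exact: integrable_fin_num.
Qed.

Lemma bdd_family_sum (h : nat -> nat -> R -> R) n :
  (forall i, exists C, forall k t, 0 < t -> t < 1 -> `|h i k t| <= C) ->
  exists C, forall k t, 0 < t -> t < 1 -> `|\sum_(i < n) h i k t| <= C.
Proof.
move=> /choice[C HC]; exists (\sum_(i < n) C i) => k t t0 t1.
by apply: (le_trans (ler_norm_sum _ _ _)); apply: ler_sum => i _; exact: HC.
Qed.

(** The function r w_{a+s,b+s} is not compactly supported in ]0, 1[, so it is multiplied by cutoffs.
    The terms i >= 1 of [test_expand] are bounded by a constant times w_{a,b} and eventually vanish
    at each point; dominated convergence leaves the term i = 0, which is [Dwn]. *)
Lemma weak_derivative_wint s g v a b r : -1 < a -> -1 < b -> bdd g ->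
  is_weak_derivative s g v ->
  mu.-integrable `]0, 1[ (EFin \o (fun t => v t * weight (a + s%:R) (b + s%:R) t)) ->
  wint (a + s%:R) (b + s%:R) (fun t => v t * r.[t]) =
  (-1) ^+ s * wint a b (fun t => g t * (Dwn s a b r).[t]).
Proof.
move=> a1 b1 bg [_ lv H] iv.
have [mv _ _] := lv; have [mg [G HG]] := bg.
have [Q Q0 HQ] := test_expand s r (a + s%:R) (b + s%:R); rewrite !addrK in Q0 HQ.
pose w := weight (a + s%:R) (b + s%:R).
pose phi k t := r.[t] * w t * cutoff (R := R) k t.
have K0 k : 0 < k.+3%:R^-1 :> R by rewrite invr_gt0 ltr0n.
pose h i k t := (Q i).[t] * (((1 - t) * t) ^+ i * derive1n i (cutoff (R := R) k) t).
have phiE k t : 0 < t -> t < 1 -> derive1n s (phi k) t =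
    (\sum_(i < s.+1) h i k t) * weight a b t.
  move=> t0 t1; rewrite (HQ _ _ (@smooth_cutoff R k) (K0 k) (@cutoff_supp R k)).
  rewrite mulr_suml; apply: eq_bigr => i _.
  by rewrite /h -weightM// weight_natr//; ring.
have tphi k : test_function (phi k) by exact: test_function_weight_cutoff.
have mphi n k : measurable_fun (`]0, 1[ : set R) (derive1n n (phi k)).
  apply: open_continuous_measurable_fun => // t _.
  have [/(_ n t)] := tphi k.
  by move=> /derivable1_diffP/differentiable_continuous.
have [C HC] : exists C, forall k t, 0 < t -> t < 1 -> `|\sum_(i < s.+1) h i k t| <= C.
  apply: bdd_family_sum => i; have [C HC] := cutoff_derive_bdd R i.
  have [_ [M HM]] := bdd_horner (Q i).
  exists (M * C) => k t t0 t1; rewrite normrM; apply: ler_pM => //; first exact: HM.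
  rewrite normrM ger0_norm; first exact: HC.
  by rewrite exprn_ge0// mulr_ge0// ?subr_ge0 ltW.
have limR : \int[mu]_(t in `]0, 1[) (g t * derive1n s (phi k) t) @[k --> \oo] -->
    \int[mu]_(t in `]0, 1[) (g t * (Q 0%N).[t] * weight a b t).
  apply: (@cvg_Rintegral _ _ (fun t => G * C * weight a b t)).
  - by move=> k; apply: measurable_funM.
  - apply: measurable_funM; last exact: measurable_weight.
    by apply: measurable_funM => //; have [] := bdd_horner (Q 0%N).
  - exact: (integrableZl _ (G * C) (integrable_weight a1 b1)).
  - move=> k t t0 t1; have w0 := weight_gt0 a b t0 t1.
    rewrite (phiE k t t0 t1) mulrA normrM (gtr0_norm w0) (ler_pM2r w0) normrM.
    by apply: ler_pM => //; [exact: HG | exact: HC].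
  - move=> t t0 t1; apply: cvg_near_cst; apply: filterS (cutoff_cvg t0 t1) => k hk.
    rewrite phiE// mulrA; congr (_ * _ * _); rewrite big_ord_recl/= /h hk eqxx.
    by rewrite expr0 !mulr1 big1 ?addr0// => i _; rewrite hk/= !mulr0.
have [C0 HC0] := cutoff_derive_bdd R 0.
have [_ [M HM]] := bdd_horner r.
have limL : \int[mu]_(t in `]0, 1[) (v t * phi k t) @[k --> \oo] -->
    \int[mu]_(t in `]0, 1[) (v t * r.[t] * w t).
  apply: (@cvg_Rintegral _ _ (fun t => M * C0 * `|v t * w t|)).
  - by move=> k; apply: measurable_funM => //; exact: (mphi 0%N).
  - apply: measurable_funM; last exact: measurable_weight.
    by apply: measurable_funM => //; have [] := bdd_horner r.
  - apply: (integrableZl _ (M * C0) (_ : mu.-integrable _ (EFin \o (fun t => `|v t * w t|)))) => //.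
    exact: (integrable_abse iv).
  - move=> k t t0 t1.
    rewrite (_ : v t * phi k t = r.[t] * cutoff k t * (v t * w t)); last by rewrite /phi; ring.
    rewrite normrM ler_wpM2r// normrM; apply: ler_pM => //; first exact: HM.
    by have := HC0 k t t0 t1; rewrite expr0 mul1r.
  - move=> t t0 t1; apply: cvg_near_cst; apply: filterS (cutoff_cvg t0 t1) => k hk.
    by have := hk 0%N; rewrite /phi /= => ->; ring.
have : (-1) ^+ s * \int[mu]_(t in `]0, 1[) (v t * phi k t) @[k --> \oo] -->
   (-1) ^+ s * wint (a + s%:R) (b + s%:R) (fun t => v t * r.[t]) by exact: cvgMl_tmp.
rewrite (_ : (fun k => _) = fun k => \int[mu]_(t in `]0, 1[) (g t * derive1n s (phi k) t)); last first.
  by apply/funext => k; rewrite (H _ (tphi k)).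
move=> /(cvg_unique (@norm_hausdorff _ R) limR); rewrite Q0 /wint => E.
by rewrite E mulrA -exprMn mulrNN mulr1
  expr1n mul1r.
Qed.

(** Use |v| <= v^2 + 1 and the integrability of the weight. *)
Lemma integrable_wsqr v a b : -1 < a -> -1 < b -> measurable_fun (`]0, 1[ : set R) v ->
  mu.-integrable `]0, 1[ (EFin \o (fun t => v t ^+ 2 * weight a b t)) ->
  mu.-integrable `]0, 1[ (EFin \o (fun t => v t * weight a b t)).
Proof.
move=> a1 b1 mv iv2.
apply: (le_integrable _ _ _ (integrableD _ iv2 (integrable_weight a1 b1))) => //.
  by apply/measurable_EFinP; apply: measurable_funM => //; exact: measurable_weight.
move=> t /=; rewrite in_itv/= => /andP[t0 t1].
have w0 := weight_gt0 a b t0 t1.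
rewrite lee_fin -[X in _ + X]mul1r -mulrDl !normrM ler_wpM2r//.
rewrite [leRHS]ger0_norm ?addr_ge0// ?sqr_ge0//.
rewrite -(real_normK (num_real (v t))).
have := sqr_ge0 (`|v t| - 1); have := normr_ge0 (v t).
by move: `|v t| => z; rewrite sqrrB1; nra.
Qed.

End WeakDerivative.

(** * Jacobi expansions of functions with a weak derivative *)

Section FourierJacobi.
Variable R : realType.
Notation mu := (@lebesgue_measure R).
Implicit Types (f g v : R -> R) (a b t x : R) (n k i s N : nat) (p q r : {poly R}).

Lemma within_itv_le0 f : {within `[0, 1], continuous f} ->
  (forall x, 0 < x -> x < 1 -> f x <= 0) -> forall x, 0 <= x -> x <= 1 -> f x <= 0.
Proof.
move=> /continuous_within_itvP-/(_ ltr01)[_ c0 c1] f0 x.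
rewrite le_eqVlt => /orP[/eqP<- _|x0].
  apply: (cvgr_to_le c0).
  near=> z; apply: f0; [near: z; exact: nbhs_right_gt | near: z; exact: nbhs_right_lt].
rewrite le_eqVlt => /orP[/eqP->|x1]; last exact: f0.
apply: (cvgr_to_le c1).
near=> z; apply: f0; [near: z; exact: nbhs_left_gt | near: z; exact: nbhs_left_lt].
Unshelve. all: by end_near. Qed.

Lemma interp_const_ge0 a b : -1 < a -> -1 < b -> 0 <= interp_const a b.
Proof. by move=> a1 b1; have := peak_const_ge0 a1 b1; rewrite /interp_const; lra. Qed.

Definition jacobi_coef a b g k :=
  wint a b (fun t => g t * (shifted_jacobi a b k).[t]) / jacobi_norm a b k.

(** The cut is at k <= N because N + 1 nodes reproduce polynomials of degree N. *)
Definition jacobi_tail a b g N k := if (k <= N)%N then 0 else jacobi_coef a b g k.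

Lemma jacobi_sum_tail a b g N n : (N < n)%N ->
  jacobi_sum a b n (jacobi_coef a b g) =
  jacobi_sum a b N.+1 (jacobi_coef a b g) + jacobi_sum a b n (jacobi_tail a b g N).
Proof.
elim: n => // n IH; rewrite ltnS leq_eqVlt => /orP[/eqP<-|Nn].
  rewrite [X in _ + X](_ : _ = 0) ?addr0// /jacobi_sum big1// => k _.
  by rewrite /jacobi_tail -ltnS ltn_ord scale0r.
rewrite /jacobi_sum big_ord_recr [X in _ + X]big_ord_recr/= -!/(jacobi_sum _ _ _ _) IH//.
by rewrite addrA {3}/jacobi_tail leqNgt Nn.
Qed.

Section coefficients.
Variables (a b : R) (g : R -> R).
Hypotheses (a1 : -1 < a) (b1 : -1 < b) (bg : bdd g).
Local Notation L p := (wint a b (fun t => g t * p.[t])).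

Lemma wint_hornerD p q : L (p + q) = L p + L q.
Proof.
rewrite -wintD//; try by apply: bddM => //; exact: bdd_horner.
by apply: eq_wint => x _ _; rewrite hornerD mulrDr.
Qed.

Lemma wint_hornerZ c p : L (c *: p) = c * L p.
Proof.
rewrite -wintZ//; last by apply: bddM => //; exact: bdd_horner.
by apply: eq_wint => x _ _; rewrite hornerZ mulrCA.
Qed.

Lemma wint_horner_sum n (F : 'I_n -> {poly R}) : L (\sum_(i < n) F i) = \sum_(i < n) L (F i).
Proof.
apply: (big_morph (fun p => L p) wint_hornerD).
by rewrite -(scale0r 0) wint_hornerZ mul0r.
Qed.

Lemma wint_shifted_jacobi k : L (shifted_jacobi a b k) = jacobi_coef a b g k * jacobi_norm a b k.
Proof. by rewrite divfK// gt_eqF// jacobi_norm_gt0. Qed.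

Lemma wint_remainder n q : (size q <= n)%N ->
  wint a b (fun t => (g t - (jacobi_sum a b n (jacobi_coef a b g)).[t]) * q.[t]) = 0.
Proof.
move=> sq; set S := jacobi_sum _ _ _ _.
have -> : wint a b (fun t => (g t - S.[t]) * q.[t]) = L q - pint a b (S * q).
  rewrite -pintN// -wintD//; try by apply: bddM => //; exact: bdd_horner.
    by apply: eq_wint => x _ _; rewrite hornerN hornerM; ring.
  exact: bdd_horner.
apply/eqP; rewrite subr_eq0; apply/eqP.
rewrite (jacobi_expand a1 b1 sq) [S * _]mulrC /jacobi_sum.
rewrite wint_horner_sum mulr_suml pint_sum//; apply: eq_bigr => k _.
rewrite -[X in _ = pint a b X]scalerAl wint_hornerZ pintZ//; congr (_ * _).
by rewrite wint_shifted_jacobi jacobi_sum_dot.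
Qed.

Section bessel.
Variables (s : nat) (v : R -> R).
Hypothesis mv : measurable_fun (`]0, 1[ : set R) v.
Hypothesis iv2 : mu.-integrable `]0, 1[
  (EFin \o (fun t => v t ^+ 2 * weight (a + s%:R) (b + s%:R) t)).
Hypothesis gv : is_weak_derivative s g v.

(** Coefficients may be dropped, so that the bound also serves tails. Pairing v with U gives the
    squared norm of U, and integrating 2 v U - U^2 <= v^2 concludes. *)
Lemma bessel_derivn n (d : nat -> R) :
  (forall k, d k = 0 \/ d k = jacobi_coef a b g k) ->
  pint (a + s%:R) (b + s%:R) ((jacobi_sum a b n d)^`(s) * (jacobi_sum a b n d)^`(s)) <=
  wint (a + s%:R) (b + s%:R) (fun t => v t ^+ 2).
Proof.
move=> dc; set U := (jacobi_sum a b n d)^`(s).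
have s0 : 0 <= s%:R :> R by [].
have as1 : -1 < a + s%:R by have := a1; lra.
have bs1 : -1 < b + s%:R by have := b1; lra.
have iv := integrable_wsqr as1 bs1 mv iv2.
have vU : wint (a + s%:R) (b + s%:R) (fun t => v t * U.[t]) =
    pint (a + s%:R) (b + s%:R) (U * U).
  rewrite (weak_derivative_wint _ a1 b1 bg gv iv) jacobi_sum_derivn//.
  rewrite /U /jacobi_sum linear_sum (big_morph (Dwn s a b) (@DwnD _ s a b) (@Dwn0 _ s a b)).
  rewrite wint_horner_sum mulr_sumr; apply: eq_bigr => k _.
  rewrite /= derivnZ DwnZ Dwn_derivn_shifted_jacobi !wint_hornerZ wint_shifted_jacobi.
  have ss : (-1) ^+ s * (-1) ^+ s = 1 :> R by rewrite -exprMn mulrNN mulr1 expr1n.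
  case: (dc k) => ->; first by rewrite !mul0r mulr0 expr0n/= !mul0r.
  move: (_ ^+ s) ss => e ee; transitivity ((e * e) * (jacobi_coef a b g k ^+ 2 *
    jacobi_norm a b k * eigenprod s a b k)); first by ring.
  by rewrite ee mul1r.
set w := weight (a + s%:R) (b + s%:R).
have iU : mu.-integrable `]0, 1[ (EFin \o (fun t => (U * U).[t] * w t)).
  by apply: integrable_bdd => //; exact: bdd_horner.
have ivU : mu.-integrable `]0, 1[ (EFin \o (fun t => v t * U.[t] * w t)).
  have [mU [M HM]] := bdd_horner U.
  apply: (le_integrable _ _ _ (integrableZl _ M iv)) => //.
    apply/measurable_EFinP; apply: measurable_funM; last exact: measurable_weight.
    exact: measurable_funM.
  move=> t /=; rewrite in_itv/= => /andP[t0 t1]; rewrite lee_fin mulrAC normrM [leRHS]normrM.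
  by rewrite mulrC ler_wpM2r// (le_trans (HM t t0 t1))// ler_norm.
have : \int[mu]_(t in `]0, 1[) (2 * (v t * U.[t] * w t) - (U * U).[t] * w t) <=
    wint (a + s%:R) (b + s%:R) (fun t => v t ^+ 2).
  apply: le_Rintegral => //.
    exact: (integrableB _ (integrableZl _ 2 ivU) iU).
  move=> t /=; rewrite in_itv/= => /andP[t0 t1].
  have w0 : 0 < w t by exact: weight_gt0.
  rewrite -/w mulrA -mulrBl (ler_pM2r w0) hornerM.
  by have := sqr_ge0 (v t - U.[t]); move: (v t) U.[t] => p q; nra.
rewrite RintegralB//; last exact: (integrableZl _ 2 ivU).
rewrite RintegralZl// -!/(wint _ _ _) vU.
rewrite -!/(pint _ _ _); move: (pint _ _ _) (wint _ _ _) => p q; lra.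
Qed.

Hypotheses (a2 : a <= - 2^-1) (b2 : b <= - 2^-1) (s1 : (1 <= s)%N).
Hypothesis cg : {within `[0, 1], continuous g}.
Local Notation S n := (jacobi_sum a b n (jacobi_coef a b g)).

Let tail_const := 2 * s%:R ^+ s * wint (a + s%:R) (b + s%:R) (fun t => v t ^+ 2).
Let rate N : R := N%:R / N%:R ^+ (2 * s).

Lemma tail_const_ge0 : 0 <= tail_const.
Proof.
rewrite mulr_ge0// ?mulr_ge0 ?exprn_ge0//.
by apply: wint_ge0 => t _ _; exact: sqr_ge0.
Qed.

Lemma energy_tail N n E : (1 <= N)%N -> (s <= N.+1)%N ->
  E = jacobi_sum a b n (jacobi_tail a b g N) ->
  N%:R * pint a b (E * E) + N%:R^-1 * pint (a + 1) (b + 1) (E^`() * E^`()) <=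
  tail_const * rate N.
Proof.
move=> N1 sN ->.
have c0 k : (k <= N)%N -> jacobi_tail a b g N k = 0 by rewrite /jacobi_tail => ->.
apply: (le_trans (@tail_energy_le R a b s N n _ _ a1 b1 s1 N1 sN c0 erefl)).
rewrite /tail_const mulrAC; apply: ler_wpM2r; first by rewrite divr_ge0.
apply: ler_wpM2l; first by rewrite mulr_ge0 ?exprn_ge0.
apply: bessel_derivn => k; rewrite /jacobi_tail; case: ifP => _; [by left | by right].
Qed.

Lemma jacobi_sum_dist N n x : (1 <= N)%N -> (s <= N.+1)%N -> (N < n)%N ->
  0 <= x -> x <= 1 ->
  ((S n).[x] - (S N.+1).[x]) ^+ 2 <= 2 * (tail_const * rate N).
Proof.
move=> N1 sN Nn x0 x1; rewrite (jacobi_sum_tail _ _ _ Nn) hornerD addrAC subrr add0r.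
set E := jacobi_sum _ _ _ _; have H := energy_tail N1 sN (erefl E).
have N0 : 1 <= N%:R :> R by rewrite ler1n.
have := @sup_sqr_le R a b E x N%:R a1 a2 b1 b2 (lt_le_trans ltr01 N0) x0 x1.
have a3 : -1 < a + 1 by have := a1; lra.
have b3 : -1 < b + 1 by have := b1; lra.
have P0 := pint_sqr_ge0 a b E.
have P1 : 0 <= N%:R^-1 * pint (a + 1) (b + 1) (E^`() * E^`()).
  by apply: mulr_ge0; [rewrite invr_ge0 | exact: pint_sqr_ge0].
move: (E.[x]^+2) (pint a b (E * E)) (N%:R^-1 * _) (tail_const * _) H P0 P1 => e p q t H P0 P1 h.
by have := ler_wpM2r P0 N0; lra.
Qed.

(** Convergence of S_n to g is not known beforehand. For c = 1 or -1, the function c (g - S_{N+1}) -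
    eps lies below every c (g - S_n) with n > N, and the latter is orthogonal to polynomials of
    degree below n, so [wint_bump_le0] makes the former nonpositive. *)
Lemma jacobi_sum_approx N x : (1 <= N)%N -> (s <= N.+1)%N -> 0 <= x -> x <= 1 ->
  `|g x - (S N.+1).[x]| <= Num.sqrt (2 * (tail_const * rate N)).
Proof.
move=> N1 sN; set eps := Num.sqrt _.
have dist n t : (N < n)%N -> 0 <= t -> t <= 1 -> `|(S n).[t] - (S N.+1).[t]| <= eps.
  move=> Nn t0 t1; rewrite -sqrtr_sqr ler_sqrt; first exact: jacobi_sum_dist.
  by apply: le_trans (jacobi_sum_dist N1 sN Nn t0 t1); exact: sqr_ge0.
have key (c : R) : `|c| = 1 -> forall t, 0 <= t -> t <= 1 ->
    c * (g t - (S N.+1).[t]) - eps <= 0.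
  move=> c1; have cphi : {within `[0, 1], continuous (fun t => c * (g t - (S N.+1).[t]) - eps)}.
    move=> t; apply: cvgB; last exact: cvg_cst.
    apply: cvgM; first exact: cvg_cst.
    by apply: cvgB; [exact: cg | exact: within_continuous_horner].
  apply: (within_itv_le0 cphi) => z z0 z1.
  (* B^k has degree at most 2k, so 2k + 1 terms make g - S_n orthogonal to it. *)
  pose n k := maxn N.+1 (2 * k + 1).
  apply: (@wint_bump_le0 R a b _ (fun k t => c * (g t - (S (n k)).[t])) a1 b1 cphi) => //.
  - move=> k; apply: bddZ; apply: bddD => //.
    by apply: bddN; exact: bdd_horner.
  - move=> k t t0 t1; rewrite lerBlDr -lerBlDl -mulrBr.
    apply: le_trans (ler_norm _) _; rewrite normrM c1 mul1r.
    rewrite [X in `|X|](_ : _ = (S (n k)).[t] - (S N.+1).[t]); last by ring.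
    by apply: dist; [rewrite /n leq_max leqnn | exact: ltW | exact: ltW].
  - move=> k B sB.
    have sBk : (size (B ^+ k)%R <= n k)%N.
      have sB2 : ((size B).-1 <= 2)%N by case: (size B) sB.
      apply: (leq_trans (size_poly_exp_leq _ _)); apply: leq_trans (leq_maxr _ _).
      by rewrite addn1 ltnS leq_mul2r sB2 orbT.
    transitivity (c * wint a b (fun t => (g t - (S (n k)).[t]) * (B ^+ k).[t])).
      rewrite -wintZ//; last first.
        apply: bddM; last exact: bdd_horner.
        by apply: bddD => //; apply: bddN; exact: bdd_horner.
      by apply: eq_wint => t _ _; rewrite mulrA.
    by rewrite wint_remainder// mulr0.
move=> x0 x1; rewrite ler_norml.
have := key 1 (normr1 _) x x0 x1; have := key (-1) (normrN1 _) x x0 x1.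
by rewrite mul1r mulN1r {dist key}; move: eps (g x - _) => e u; lra.
Qed.

Lemma rate_le N : (1 <= N)%N -> rate N <= N%:R^-1.
Proof.
move=> N1; have N0 : 1 <= N%:R :> R by rewrite ler1n.
have N0' : 0 < N%:R :> R by rewrite ltr0n.
rewrite /rate ler_pdivrMr ?exprn_gt0// ler_pdivlMl// -expr2.
by apply: ler_weXn2l => //; rewrite -[X in (X <= _)%N]muln1 leq_mul2l.
Qed.

Lemma jacobi_sum_unif N e : 0 < e ->
  exists2 n, (N < n)%N & forall x, 0 <= x -> x <= 1 -> `|g x - (S n).[x]| <= e.
Proof.
move=> e0; pose K := 2 * tail_const / e ^+ 2.
pose M := maxn (maxn N s) (Num.truncn K).+1.
have M1 : (1 <= M)%N by rewrite /M leq_max ltn0Sn orbT.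
have sM : (s <= M.+1)%N by rewrite ltnW// ltnS /M !leq_max leqnn orbT.
have e2 : 0 < e ^+ 2 by rewrite exprn_gt0.
exists M.+1; first by rewrite ltnS /M !leq_max leqnn.
move=> x x0 x1; apply: le_trans (jacobi_sum_approx M1 sM x0 x1) _.
rewrite -[leRHS]ger0_norm ?(ltW e0)// -sqrtr_sqr ler_sqrt ?(ltW e2)// mulrA.
have M0 : 0 < M%:R :> R by rewrite ltr0n.
have t0 : 0 <= 2 * tail_const by rewrite mulr_ge0// tail_const_ge0.
apply: le_trans (ler_wpM2l t0 (rate_le M1)) _.
rewrite ler_pdivrMr// [leRHS]mulrC -ler_pdivrMr// -/K.
apply/ltW/(lt_le_trans (truncnS_gt _)).
by rewrite ler_nat /M leq_max leqnn orbT.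
Qed.

Lemma linterpD n (y : 'I_n -> R) (f h : R -> R) :
  linterp y (fun x => f x + h x) = linterp y f + linterp y h.
Proof. by rewrite /linterp -big_split/=; apply: eq_bigr => j _; rewrite scalerDl. Qed.

(** Here N, the nodes and x are fixed, so the value L of the Lebesgue function at x may be of any
    size: n is chosen after it, and replacing g by S_n then costs at most e. *)
Lemma interpolation_error N (y : 'I_N.+1 -> R) x : (1 <= N)%N -> (s <= N.+1)%N ->
  injective y -> (forall i : 'I_N.+1, 0 < y i < 1) ->
  (forall i : 'I_N.+1, root (shifted_jacobi a b N.+1) (y i)) -> 0 <= x -> x <= 1 ->
  `|g x - (linterp y g).[x]| <= Num.sqrt (interp_const a b * (tail_const * rate N)).
Proof.
move=> N1 sN yinj y01 yr x0 x1; apply/ler_addgt0Pr => e e0.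
pose L := \sum_(j < N.+1) `|(lagr y j).[x]|.
have L0 : 0 <= L by rewrite sumr_ge0.
have L1 : 0 < 1 + L by lra.
have [n Nn gS] := jacobi_sum_unif N (divr_gt0 e0 L1).
set d := e / (1 + L) in gS.
have d0 : d * (1 + L) = e by rewrite divfK// gt_eqF.
have c0 := interp_const_ge0 a1 b1.
have SE : `|(S n).[x] - (linterp y (horner (S n))).[x]| <=
    Num.sqrt (interp_const a b * (tail_const * rate N)).
  have IE : (S n).[x] - (linterp y (horner (S n))).[x] =
      (jacobi_sum a b n (jacobi_tail a b g N)).[x] -
      (linterp y (horner (jacobi_sum a b n (jacobi_tail a b g N)))).[x].
    rewrite (jacobi_sum_tail _ _ _ Nn) (_ : horner (_ + _) = fun t =>
      (S N.+1).[t] + (jacobi_sum a b n (jacobi_tail a b g N)).[t]); last first.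
      by apply/funext => t; rewrite hornerD.
    rewrite linterpD linterp_id ?size_jacobi_sum// !hornerD; ring.
  have := interp_error_sqr (jacobi_sum a b n (jacobi_tail a b g N))
    a1 a2 b1 b2 N1 yinj y01 yr x0 x1.
  rewrite -IE => /le_trans/(_ (ler_wpM2l c0 (energy_tail N1 sN erefl))) H.
  rewrite -sqrtr_sqr ler_sqrt//; exact: le_trans (sqr_ge0 _) H.
have IS : `|(linterp y (horner (S n))).[x] - (linterp y g).[x]| <= d * L.
  rewrite -hornerN -hornerD /linterp -sumrB horner_sum mulr_sumr.
  apply: (le_trans (ler_norm_sum _ _ _)); apply: ler_sum => j _.
  rewrite -scalerBl hornerZ normrM ler_wpM2r// distrC.
  by have /andP[y0 y1] := y01 j; apply: gS; exact: ltW.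
rewrite [X in `|X|](_ : _ = ((S n).[x] - (linterp y (horner (S n))).[x]) + ((g x - (S n).[x]) +
  ((linterp y (horner (S n))).[x] - (linterp y g).[x]))); last by ring.
apply: (le_trans (ler_normD _ _)); apply: lerD => //.
apply: (le_trans (ler_normD _ _)); rewrite -d0 mulrDr mulr1; apply: lerD => //.
exact: gS.
Qed.

End bessel.
End coefficients.
End FourierJacobi.

(** * Change of variables *)

Section Pullback.
Variable R : realType.
Implicit Types (f v : R -> R) (rho x : R) (N : nat).

Lemma powRVK rho x : 0 < rho -> 0 <= x -> (x `^ rho) `^ rho^-1 = x.
Proof. by move=> r0 x0; rewrite -powRrM mulfV ?gt_eqF// powRr1. Qed.

Lemma powR_le1_ge0 rho x : 0 < rho -> 0 <= x -> x <= 1 -> x `^ rho <= 1.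
Proof.
move=> r0 x0 x1; have := ge0_ler_powR (ltW r0) x0 (ler01 : 1 \in Num.nneg) x1.
by rewrite powR1.
Qed.

Lemma powR_lt1_ge0 rho x : 0 < rho -> 0 <= x -> x < 1 -> x `^ rho < 1.
Proof.
move=> r0 x0 x1; have := gt0_ltr_powR r0 x0 (ler01 : 1 \in Num.nneg) x1.
by rewrite powR1.
Qed.

Lemma pullbackK rho f x : 0 < rho -> x <= 1 -> pullback rho f (1 - (1 - x) `^ rho) = f x.
Proof. by move=> r0 x1; rewrite /pullback !subKr powRVK ?subr_ge0// subKr. Qed.

Lemma lagrange_basisE rho N (t : 'I_N.+1 -> R) j x :
  lagrange_basis rho t j x = (lagr (fun i => 1 - (1 - t i) `^ rho) j).[1 - (1 - x) `^ rho].
Proof.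
rewrite /lagr horner_prod; apply: eq_bigr => i _.
rewrite hornerZ hornerXsubC -[LHS]mulrNN -invrN mulrC.
by congr (_^-1 * _); ring.
Qed.

Lemma interpolantE rho N (t : 'I_N.+1 -> R) f x : 0 < rho -> (forall i, t i <= 1) ->
  interpolant rho t f x =
  (linterp (fun i => 1 - (1 - t i) `^ rho) (pullback rho f)).[1 - (1 - x) `^ rho].
Proof.
move=> r0 t1; rewrite /interpolant /linterp horner_sum; apply: eq_bigr => j _.
by rewrite hornerZ pullbackK// lagrange_basisE.
Qed.

Lemma sqrt_rate N s : (1 <= N)%N ->
  Num.sqrt (N%:R / N%:R ^+ (2 * s) : R) = N%:R `^ (2^-1 - s%:R).
Proof.
move=> N1; have N0 : 0 < N%:R :> R by rewrite ltr0n.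
rewrite -[RHS]ger0_norm ?powR_ge0// -sqrtr_sqr; congr Num.sqrt.
rewrite powRD; last by apply/implyP => _; rewrite gt_eqF.
rewrite powRN powR_mulrn ?ltW// powR12_sqrt ?ltW// exprMn sqr_sqrtr ?ltW//.
by rewrite exprVn -exprM mulnC.
Qed.

End Pullback.

Theorem proposition4p4 (R : realType) (rho mu ups : R) (s : nat) :
  0 < rho -> rho <= 1 ->
  -1 < mu -> mu <= - 2^-1 ->
  -1 < ups -> ups <= - 2^-1 ->
  (1 <= s)%N ->
  exists c : R, forall (N : nat) (t : 'I_N.+1 -> R) (f v : R -> R),
    (1 <= N)%N -> (s <= N.+1)%N ->
    gjacobi_nodes mu ups rho t ->
    {within `[0, 1], continuous (pullback rho f)} ->
    in_B mu ups s (pullback rho f) ->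
    is_weak_derivative s (pullback rho f) v ->
    (supnorm (fun x => f x - interpolant rho t f x)%R <=
       (c * N%:R `^ (2^-1 - s%:R))%:E * wL2norm (mu + s%:R) (ups + s%:R) v)%E.
Proof.
move=> r0 _ a1 a2 b1 b2 s1.

(* The summand 1 makes the constant positive, so that the bound is +oo when the norm of v is
   infinite; with a zero constant the product would be 0. *)
exists (Num.sqrt (interp_const mu ups * (2 * s%:R ^+ s)) + 1).
move=> N t f v N1 sN [tinj trange] cg _ wv.
have [_ [mv _ _] _] := wv.
have N0 : 0 < N%:R :> R by rewrite ltr0n.
have t01 i : 0 < t i < 1 /\ gjacobi mu ups rho N.+1 (t i) = 0.
  by have : range t (t i) by []; rewrite trange.
pose y i := 1 - (1 - t i) `^ rho.
have yinj : injective y.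
  move=> i j /(congr1 (fun z => (1 - z) `^ rho^-1)); rewrite /y !subKr.
  have [[/andP[_ ti] _] [/andP[_ tj] _]] := (t01 i, t01 j).
  rewrite !powRVK// ?subr_ge0 ?ltW// => e; apply: tinj.
  by rewrite -(subKr 1 (t i)) e subKr.
have y01 i : 0 < y i < 1.
  have [/andP[ti0 ti1] _] := t01 i.
  have u0 : 0 < (1 - t i) `^ rho by rewrite powR_gt0// subr_gt0.
  have u1 : (1 - t i) `^ rho < 1.
    by apply: powR_lt1_ge0; rewrite ?subr_ge0 ?(ltW ti1)//; lra.
  by rewrite /y; lra.
have yr i : root (shifted_jacobi mu ups N.+1) (y i).
  have [_ /eqP] := t01 i.
  by rewrite /gjacobi /root -shifted_jacobiE /y subKr.
have coef0 : 0 < Num.sqrt (interp_const mu ups * (2 * s%:R ^+ s)) + 1.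
  by rewrite ltr_wpDl// sqrtr_ge0.
have cN0 : 0 < (Num.sqrt (interp_const mu ups * (2 * s%:R ^+ s)) + 1) *
  N%:R `^ (2^-1 - s%:R) by rewrite mulr_gt0// powR_gt0.
rewrite /wL2norm; set I := (\int[_]_(_ in _) _)%E.
have I0 : (0 <= I)%E.
  apply: integral_ge0 => x /=; rewrite in_itv/= => /andP[x0 x1].
  by rewrite lee_fin mulr_ge0 ?sqr_ge0// ltW// weight_gt0.
have mI : measurable_fun (`]0, 1[ : set R)
    (EFin \o (fun x => v x ^+ 2 * weight (mu + s%:R) (ups + s%:R) x)).
  apply/measurable_EFinP; apply: measurable_funM; last exact: measurable_weight.
  exact: measurable_funX.
have [Ioo|Ifin] := eqVneq I +oo%E.
  by rewrite Ioo poweRyr ?gt_eqF ?invr_gt0// gt0_muley ?lte_fin// leey.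
have If : I \is a fin_num by rewrite ge0_fin_numE// ltey.
have iv2 : lebesgue_measure.-integrable `]0, 1[
    (EFin \o (fun x => v x ^+ 2 * weight (mu + s%:R) (ups + s%:R) x)).
  apply/integrableP; split => //.
  rewrite (_ : (\int[_]_(_ in _) _)%E = I) ?ltey//.
  apply: eq_integral => x; rewrite inE/= in_itv/= => /andP[x0 x1].
  by rewrite ger0_norm// mulr_ge0 ?sqr_ge0// ltW// weight_gt0.
rewrite -(fineK If) poweR_EFin powR12_sqrt ?fine_ge0// -EFinM.
apply: ge_ereal_sup => /= _ [x + <-]; rewrite /= in_itv/= => /andP[x0 x1]; rewrite lee_fin.
rewrite interpolantE//; last by move=> i; have [/andP[_ /ltW]] := t01 i.
rewrite -(pullbackK f r0 x1) -/y.
have u0 : 0 <= (1 - x) `^ rho by exact: powR_ge0.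
have u1 : (1 - x) `^ rho <= 1.
  by apply: powR_le1_ge0; rewrite ?subr_ge0//; lra.
have bg := bdd_continuous cg.
have := @interpolation_error R mu ups (pullback rho f) a1 b1 bg s v mv iv2 wv a2 b2 s1 cg N y
  (1 - (1 - x) `^ rho) N1 sN yinj y01 yr.
move=> H; apply: le_trans (H _ _) _; [lra | lra |].
have c0 : 0 <= interp_const mu ups by exact: interp_const_ge0.
have A0 : 0 <= interp_const mu ups * (2 * s%:R ^+ s).
  by rewrite mulr_ge0// mulr_ge0 ?exprn_ge0.
have V0 : 0 <= fine I by exact: fine_ge0.
rewrite (_ : wint _ _ _ = fine I)// (_ : _ * (_ * (_ / _)) =
  interp_const mu ups * (2 * s%:R ^+ s) * fine I * (N%:R / N%:R ^+ (2 * s))); last by ring.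
rewrite sqrtrM ?mulr_ge0// sqrtrM// sqrt_rate// mulrAC.
rewrite ler_wpM2r ?sqrtr_ge0// ler_wpM2r ?powR_ge0// lerDl.
exact: ler01.
Qed.
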